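(* Let $\nu\ge2$ be even, let $\theta$ range near $0\in\mathbb R^m$, and suppose $\Phi(t,\theta)$ is jointly $C^\nu$ and $B(t,I,\theta)$ is jointly $C^2$ on a common product neighbourhood ($|t|\le T$, $I$ near $0$, $\theta$ near $0$). Write $\Phi_\theta(t)=\Phi(t,\theta)$, and assume $$\Phi_0(t)=at^\nu+o(|t|^\nu),\ a>0,\qquad\partial_t^\nu\Phi_\theta(t)\ge\kappa_*>0\quad(|t|\le T).$$ Consider $$I'=(I-\Phi_\theta(t))_+B(t,I,\theta),\qquad I(-T)=q,\qquad B(0,0,0)=\beta\ne0,$$ and put $$D(q,\theta)=I(T;q,\theta)-q,\qquad\tau_\theta=\min_{|t|\le T}\Phi_\theta(t).$$ After shrinking the common box and parameter germ, there is $\rho_0>0$ such that $|\tau_\theta|<\rho_0$, every trajectory with $|q|+\|\theta\|<\rho_0$ is inactive at both $t=-T$ and $t=T$, and the following hold. 1. For $|q|<\rho_0$, $D(q,\theta)=0$ whenever $q\le\tau_\theta$. On $|q|<\rho_0$, $D$ is $C^1$ in $q$, with $D_q$ jointly continuous in $(q,\theta)$. For each fixed $\theta$ there is a set $E_\theta\subset[\tau_\theta,\rho_0)$ of at most $\nu-1$ levels that contains $\tau_\theta$, such that $D$ is $C^2$ in $q$ off $E_\theta$. In particular, $D$ is smooth on the open inactive side and $C^2$ at every regular active level. 2. At a regular active level, write $$\mathcal A(q,\theta)=\{t:I(t;q,\theta)>\Phi_\theta(t)\}=\bigcup_{k=1}^N(a_k,b_k),$$ where $a_k$ is an entry and $b_k$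 is the following exit. Then $1\le N\le\nu/2$. With $\mathcal F=(I-\Phi_\theta)B$ and $J=\partial_qI>0$, $$D_{qq}=J(T)\Bigg[\sum_{k=1}^N\left\{\frac{B(b_k,I(b_k),\theta)J(b_k)}{\Phi_\theta'(b_k)}-\frac{B(a_k,I(a_k),\theta)J(a_k)}{\Phi_\theta'(a_k)}\right\}+\int_{\mathcal A(q,\theta)}\mathcal F_{II}(t,I(t),\theta)J(t)\,dt\Bigg].$$ 3. There are $\rho_1\in(0,\rho_0]$ and constants $b_0,C_2>0$ such that $\operatorname{sgn}B=\operatorname{sgn}\beta$, $|B|\ge b_0$, and $|\mathcal F_{II}|\le C_2$ on the resulting common box. For $0<\rho\le\rho_1$, put $$L(\rho)=\sup\{\operatorname{meas}\mathcal A(q,\theta):|q|+\|\theta\|\le\rho\},$$ $$\omega(\rho)=\sup\{|\Phi_\theta'(c)|:c\text{ is a regular event},\ |q|+\|\theta\|\le\rho\},$$ with the supremum of an empty event set defined to be zero. Both moduli tend to zero with $\rho$. At every regular active point with $|q|+\|\theta\|\le\rho$, the event set is nonempty, $\omega(\rho)>0$, and $$\operatorname{sgn}(\beta)D_{qq}(q,\theta)\ge\frac12\left(\frac{b_0}{\omega(\rho)}-2C_2L(\rho)\right).$$ Moreover, $D,D_q\to0$ uniformly as $(q,\theta)\to(0,0)$. Consequently, for every $\varepsilon,M>0$ there is $\rho\in(0,\rho_1]$ such that $|D|+|D_q|<\varepsilon$ whenever $|q|+\|\theta\|<\rho$, and at every regular active point there, $\operatorname{sgn}(\beta)D_{qq}>M$.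 Across the exceptional levels this becomes the global increment bound $$\operatorname{sgn}(\beta)\bigl(D_q(q_2,\theta)-D_q(q_1,\theta)\bigr)\ge M(q_2-q_1)$$ whenever $\tau_\theta<q_1<q_2$ and $|q_i|+\|\theta\|<\rho$ for $i=1,2$. Thus, on a sufficiently small common neighbourhood, $\operatorname{sgn}(\beta)D_q(\cdot,\theta)$ is strictly increasing throughout the active-level interval $q>\tau_\theta$, including across levels at which active components are born or merge.
   Context: $x_+=\max\{x,0\}$; primes on $\Phi_\theta$ and $I$ denote $t$-derivatives. A trajectory $I(t)=I(t;q,\theta)$ is inactive at time $t$ if $I(t)<\Phi_\theta(t)$ and active if $I(t)>\Phi_\theta(t)$. An event is a time $c$ with $I(c;q,\theta)=\Phi_\theta(c)$; it is regular (transverse) if $\Phi_\theta'(c)\ne0$. An entry is an event at which the trajectory passes from inactive to active, an exit one at which it passes from active to inactive. A regular active level (or point $(q,\theta)$) is one with $\tau_\theta<q<\rho_0$ all of whose events are regular; the exceptional levels, collected in $E_\theta$, are the threshold $\tau_\theta$ and the active levels that are not regular. The inactive side is $q<\tau_\theta$. *)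

(* Defs.v *)
From HB Require Import structures.
From mathcomp Require Export all_boot all_order all_algebra.
From mathcomp Require Export all_classical all_reals all_analysis.
Set Implicit Arguments.
Unset Strict Implicit.
Unset Printing Implicit Defensive.
Export Order.TTheory GRing.Theory Num.Theory numFieldNormedType.Exports.
Local Open Scope classical_set_scope.
Local Open Scope ring_scope.

(* f is C^k on U (meant for open U in a finite-dimensional V). Asking for
   directional derivatives in every direction v, rather than for partial
   derivatives, avoids choosing a basis. *)
Fixpoint Ck_on (R : realType) (V : normedModType R) (k : nat) (U : set V)
    (f : V -> R) : Prop :=
  match k with
  | 0%N => forall x, U x -> {for x, continuous f}
  | k'.+1 => (forall x, U x -> differentiable f x) /\
             (forall v : V, Ck_on k' U ('D_v f))
  end.

(* The library norm of 'rV[R]_m is the sup norm. *)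
Definition enorm (R : realType) (m : nat) (th : 'rV[R]_m) : R :=
  Num.sqrt (\sum_(i < m) th ord0 i ^+ 2).

Definition dPhi (R : realType) (m : nat) (Phi : R -> 'rV[R]_m -> R)
  (th : 'rV[R]_m) (t : R) : R := ((Phi ^~ th)^`()%classic) t.

(* Phi th is continuous on [-T, T], so this infimum is the minimum. *)
Definition tau (R : realType) (m : nat) (Phi : R -> 'rV[R]_m -> R) (T : R)
  (th : 'rV[R]_m) : R := inf [set Phi t th | t in `[- T, T]].

(* y solves y' = (y - Phi_th)_+ B, y(-T) = q, on [-T, T], staying in |y| < r. *)
Definition is_trajectory (R : realType) (m : nat) (Phi : R -> 'rV[R]_m -> R)
    (B : R -> R -> 'rV[R]_m -> R) (T r q : R) (th : 'rV[R]_m)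
    (y : R -> R) : Prop :=
  [/\ {within `[- T, T], continuous y},
      y (- T) = q,
      (forall t, - T <= t <= T -> `|y t| < r) &
      (forall t, - T < t < T ->
         is_derive t 1 y (Num.max (y t - Phi t th) 0 * B t (y t) th))].

(* Below, I t q th stands for I(t; q, theta). *)

Definition displacement (R : realType) (m : nat) (I : R -> R -> 'rV[R]_m -> R)
  (T q : R) (th : 'rV[R]_m) : R := I T q th - q.

Definition displacement_q (R : realType) (m : nat)
    (I : R -> R -> 'rV[R]_m -> R) (T q : R) (th : 'rV[R]_m) : R :=
  ((fun u => displacement I T u th)^`()%classic) q.

Definition displacement_qq (R : realType) (m : nat)
    (I : R -> R -> 'rV[R]_m -> R) (T q : R) (th : 'rV[R]_m) : R :=
  ((fun u => displacement I T u th)^`(2)%classic) q.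

Definition flow_q (R : realType) (m : nat) (I : R -> R -> 'rV[R]_m -> R)
  (q : R) (th : 'rV[R]_m) (t : R) : R := ((fun u => I t u th)^`()%classic) q.

Definition field_F (R : realType) (m : nat) (Phi : R -> 'rV[R]_m -> R)
    (B : R -> R -> 'rV[R]_m -> R) (t x : R) (th : 'rV[R]_m) : R :=
  (x - Phi t th) * B t x th.

Definition field_F_II (R : realType) (m : nat) (Phi : R -> 'rV[R]_m -> R)
    (B : R -> R -> 'rV[R]_m -> R) (t x : R) (th : 'rV[R]_m) : R :=
  ((fun u => field_F Phi B t u th)^`(2)%classic) x.

Definition inactive (R : realType) (m : nat) (Phi : R -> 'rV[R]_m -> R)
    (I : R -> R -> 'rV[R]_m -> R) (q : R) (th : 'rV[R]_m) (t : R) : Prop :=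
  I t q th < Phi t th.

Definition active (R : realType) (m : nat) (Phi : R -> 'rV[R]_m -> R)
    (I : R -> R -> 'rV[R]_m -> R) (q : R) (th : 'rV[R]_m) (t : R) : Prop :=
  Phi t th < I t q th.

Definition event (R : realType) (m : nat) (Phi : R -> 'rV[R]_m -> R)
    (I : R -> R -> 'rV[R]_m -> R) (T q : R) (th : 'rV[R]_m) (c : R) : Prop :=
  - T <= c <= T /\ I c q th = Phi c th.

Definition regular_event (R : realType) (m : nat) (Phi : R -> 'rV[R]_m -> R)
    (I : R -> R -> 'rV[R]_m -> R) (T q : R) (th : 'rV[R]_m) (c : R) : Prop :=
  event Phi I T q th c /\ dPhi Phi th c != 0.

Definition entry (R : realType) (m : nat) (Phi : R -> 'rV[R]_m -> R)
    (I : R -> R -> 'rV[R]_m -> R) (T q : R) (th : 'rV[R]_m) (c : R) : Prop :=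
  [/\ event Phi I T q th c,
      \forall t \near c^'-, inactive Phi I q th t &
      \forall t \near c^'+, active Phi I q th t].

Definition exit (R : realType) (m : nat) (Phi : R -> 'rV[R]_m -> R)
    (I : R -> R -> 'rV[R]_m -> R) (T q : R) (th : 'rV[R]_m) (c : R) : Prop :=
  [/\ event Phi I T q th c,
      \forall t \near c^'-, active Phi I q th t &
      \forall t \near c^'+, inactive Phi I q th t].

Definition regular_active (R : realType) (m : nat)
    (Phi : R -> 'rV[R]_m -> R) (I : R -> R -> 'rV[R]_m -> R)
    (T rho0 q : R) (th : 'rV[R]_m) : Prop :=
  tau Phi T th < q < rho0 /\
  forall c, event Phi I T q th c -> regular_event Phi I T q th c.

Definition exceptional (R : realType) (m : nat)
    (Phi : R -> 'rV[R]_m -> R) (I : R -> R -> 'rV[R]_m -> R)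
    (T rho0 : R) (th : 'rV[R]_m) : set R :=
  [set q | q = tau Phi T th \/
           (tau Phi T th < q < rho0 /\ ~ regular_active Phi I T rho0 q th)].

Definition active_set (R : realType) (m : nat)
    (Phi : R -> 'rV[R]_m -> R) (I : R -> R -> 'rV[R]_m -> R)
    (T q : R) (th : 'rV[R]_m) : set R :=
  [set t : R | - T <= t <= T /\ active Phi I q th t].

(* The active set is the union of the N intervals ]a_k, b_k[, listed from left
   to right, a_k an entry and b_k the exit that follows it. *)
Definition active_decomposition (R : realType) (m : nat)
    (Phi : R -> 'rV[R]_m -> R) (I : R -> R -> 'rV[R]_m -> R)
    (T q : R) (th : 'rV[R]_m) (N : nat) (a b : 'I_N -> R) : Prop :=
  [/\ active_set Phi I T q th =
        \bigcup_(k in [set: 'I_N]) [set t : R | a k < t < b k],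
      (forall k, a k < b k),
      (forall k l : 'I_N, (k < l)%N -> b k < a l),
      (forall k, entry Phi I T q th (a k)) &
      (forall k, exit Phi I T q th (b k))].

Definition modulus_L (R : realType) (m : nat)
    (Phi : R -> 'rV[R]_m -> R) (I : R -> R -> 'rV[R]_m -> R)
    (T rho : R) : R :=
  sup [set l | exists (q : R) (th : 'rV[R]_m), `|q| + enorm th <= rho /\
         l = fine (@lebesgue_measure R (active_set Phi I T q th))].

(* The library's sup of the empty set is 0, as the convention requires. *)
Definition modulus_omega (R : realType) (m : nat)
    (Phi : R -> 'rV[R]_m -> R) (I : R -> R -> 'rV[R]_m -> R)
    (T rho : R) : R :=
  sup [set s | exists (q : R) (th : 'rV[R]_m) (c : R), [/\ `|q| + enorm th <= rho,
         regular_event Phi I T q th c & s = `|dPhi Phi th c| ]].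

(* Main.v *)
Require Import Defs.
From mathcomp Require Import measurable_realfun ring lra zify.
Set Implicit Arguments.
Unset Strict Implicit.
Unset Printing Implicit Defensive.
Local Open Scope classical_set_scope.
Local Open Scope ring_scope.

(** Why the theorem is true.

The right-hand side (I - Phi)_+ B is continuous and Lipschitz in I, but its
I-derivative jumps across the curve I = Phi.  The whole argument consists in
showing that trajectories cross this curve so rarely, and so cleanly when they
are regular, that the jump does no harm to first derivatives and contributes
explicit boundary terms to second ones.

First derivatives.  The difference of two trajectories solves a scalar linear
equation whose coefficient is a difference quotient of the field, hence
(flow_separation)
  I(t; q2) - I(t; q1) = (q2 - q1) exp (int difference quotient).
As q2 tends to q1 the quotient stays bounded by the Lipschitz constant and
tends to the I-derivative of F, cut off to the active times, at every time that
is not an event.  Events are finite in number, so bounded convergence gives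
J = exp (int_A F_I), and the same convergence theorem with (q, theta) moving
gives the joint continuity of D_q = J(T) - 1 (jac_is_derive, pjac_param_cvg).

Counting.  As the nu-th time derivative of Phi does not vanish, Rolle's theorem
leaves at most nu - 1 critical times of Phi_theta.  Between two consecutive
regular events lies such a critical time, because an inactive trajectory is
constant (critical_between); so there are at most nu regular events and at most
nu/2 active arcs.  A trajectory at an exceptional level touches the curve at a
critical time, and distinct trajectories never meet, so exceptional levels
inject into critical times (exceptional_few).

Second derivatives.  At an event the field vanishes, so the derivative of
I - Phi in time is - Phi', and a regular event moves along a differentiable
branch of slope J / Phi' (contact_branch).  A compactness argument over the time
interval shows that the active set near a regular level is exactly the union of
the moved arcs (arcs_persist).  Differentiating
log J(T) = sum_k int_{a_k}^{b_k} F_I in q by Leibniz' rule, and using F_I = B at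
an event, gives the formula for D_qq, and continuity of each of its terms.

The lower bound.  Near the rest point Phi_0 is at least (a/2) |t|^nu, so all
active times and events shrink to t = 0, where Phi_0' vanishes: L and omega
tend to 0.  The time interval is short enough for J to stay between 3/4 and
4/3.  Since Phi' < 0 at entries and Phi' > 0 at exits, every end of an arc
contributes to sgn(beta) D_qq a term of at least (3/4) (3/4) b_0 / omega, and
there is at least one arc, while the integral is at most a multiple of L
(displacement_qq_lower_bound).  Finally D_q is continuous in q and has a
derivative above M off a finite set of levels; the mean value theorem on the
intervals between these levels gives the increment bound (increment_bound). *)

(** * Estimates in one variable *)

Section OneVariable.
Context {R : realType}.
Implicit Types (a b c t x C K e : R) (f df h w : R -> R).

Notation mu := (@lebesgue_measure R).

Lemma within_continuous_cc f a b :
  (forall t, a <= t <= b -> {for t, continuous f}) ->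
  {within `[a, b], continuous f}.
Proof.
move=> cf; apply: continuous_in_subspaceT => t.
by rewrite inE /= in_itv /=; apply: cf.
Qed.

Lemma ler_dist_mvt f df a b C :
  {within `[a, b], continuous f} ->
  (forall t, a < t < b -> is_derive t 1 f (df t)) ->
  (forall t, a < t < b -> `|df t| <= C) ->
  forall x t, a <= x <= b -> a <= t <= b -> `|f x - f t| <= C * `|x - t|.
Proof.
move=> cf hd hC x t.
wlog xt : x t / x <= t.
  move=> hw hx ht; have [xt|/ltW tx] := leP x t; first exact: hw.
  by rewrite distrC (distrC x); exact: hw.
move=> /andP[ax xb] /andP[at_ tb].
move: xt; rewrite le_eqVlt => /predU1P[->|xt].
  by rewrite !subrr normr0 mulr0.
have sub : `[x, t] `<=` `[a, b] by apply: subset_itv; rewrite bnd_simp.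
have [||c] := @MVT R f df x t xt.
- move=> c; rewrite in_itv /= => /andP[xc ct]; apply: hd.
  by rewrite (le_lt_trans ax xc) (lt_le_trans ct tb).
- exact: continuous_subspaceW cf.
rewrite in_itv /= => /andP[xc ct] e.
rewrite distrC (distrC x) e normrM ler_wpM2r// hC//.
by rewrite (le_lt_trans ax xc) (lt_le_trans ct tb).
Qed.

(** Over an interval with K (b - a) <= 1/2 the exponential is avoided: bounding the
increment of w by its largest absolute value gives max |w| <= |w t0| +
max |w| / 2 + e (b - a), and half of max |w| is absorbed on the left.  The base
time t0 may lie anywhere, which yields backward uniqueness for free. *)
Lemma gronwall_short w dw a b K e :
  a <= b -> 0 <= K -> 0 <= e -> K * (b - a) <= 2^-1 ->
  {within `[a, b], continuous w} ->
  (forall t, a < t < b -> is_derive t 1 w (dw t)) ->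
  (forall t, a < t < b -> `|dw t| <= K * `|w t| + e) ->
  forall t0 t, a <= t0 <= b -> a <= t <= b ->
    `|w t| <= 2 * `|w t0| + 2 * e * (b - a).
Proof.
move=> ab K0 e0 Kab cw hd hw t0 t ht0 ht.
have cn : {within `[a, b], continuous (fun t => `|w t|)}.
  by move=> s; apply: cvg_norm; exact: cw.
have [c] := EVT_max ab cn; rewrite in_itv /= => hc maxc.
have hM s : a <= s <= b -> `|w s| <= `|w c| by move=> hs; apply: maxc; rewrite in_itv.
have M0 : 0 <= `|w c| by [].
have hb s : a < s < b -> `|dw s| <= K * `|w c| + e.
  move=> /[dup] hs /andP[s1 s2]; apply: le_trans (hw _ hs) _.
  by rewrite lerD2r ler_wpM2l// hM// !ltW.
have h1 := ler_dist_mvt cw hd hb hc ht0.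
have h2 : `|w c| <= `|w t0| + (K * `|w c| + e) * (b - a).
  rewrite -lerBlDl; apply: le_trans (lerB_dist _ _) _; apply: le_trans h1 _.
  apply: ler_wpM2l; first by rewrite addr_ge0// mulr_ge0.
  case/andP: hc => *; case/andP: ht0 => *; rewrite ler_norml; apply/andP; split; lra.
have h3 : K * (b - a) * `|w c| <= 2^-1 * `|w c| by apply: ler_wpM2r.
apply: le_trans (hM _ ht) _; nra.
Qed.

(** The integrands met below jump at finitely many times; measurability and a
uniform bound are all that their integrals and limits require, and both
survive products, sums and cuts. *)
Definition bmeas a b C h :=
  measurable_fun `[a, b] h /\ forall t, a <= t <= b -> `|h t| <= C.

Lemma bmeas_integrable a b C h : bmeas a b C h ->
  mu.-integrable `[a, b] (EFin \o h).
Proof.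
move=> [mh bh]; apply: measurable_bounded_integrable => //.
  exact: (compact_finite_measure (@segment_compact _ a b)).
exists C; split; first exact: num_real.
move=> M CM t /=; rewrite in_itv /= => /bh; move=> /le_trans; apply.
exact: ltW.
Qed.

Lemma bmeas_sub a b C h c d : a <= c -> d <= b -> bmeas a b C h -> bmeas c d C h.
Proof.
move=> ac db [mh bh]; split.
  by apply: measurable_funS mh => //; apply: subset_itv; rewrite bnd_simp.
by move=> t /andP[ct td]; apply: bh; rewrite (le_trans ac ct) (le_trans td db).
Qed.

Lemma continuous_measurable_cc a b h :
  (forall t, a <= t <= b -> {for t, continuous h}) -> measurable_fun `[a, b] h.
Proof.
move=> /within_continuous_cc ch.
have /integrableP[+ _] := continuous_compact_integrable (@segment_compact _ a b) ch.
by move/measurable_EFinP.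
Qed.

Lemma continuous_bmeas a b h :
  (forall t, a <= t <= b -> {for t, continuous h}) -> exists C, bmeas a b C h.
Proof.
move=> ch; have [ab|ba] := leP a b.
  have cn : {within `[a, b], continuous (fun t => `|h t|)}.
    by apply: within_continuous_cc => t ht; apply: cvg_norm; exact: ch.
  have [c _ maxc] := EVT_max ab cn.
  exists `|h c|; split; first exact: continuous_measurable_cc.
  by move=> t ht; apply: maxc; rewrite in_itv.
exists 0; split; first exact: continuous_measurable_cc.
by move=> t /andP[/le_trans h1 /h1]; rewrite leNgt ba.
Qed.

Lemma ler_norm_integral a b C h : a <= b -> bmeas a b C h ->
  `|\int[mu]_(t in `[a, b]) h t| <= C * (b - a).
Proof.
move=> ab hh; have ih := bmeas_integrable hh.
apply: le_trans (le_normr_Rintegral _ ih) _ => //.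
apply: (@le_trans _ _ (\int[mu]_(t in `[a, b]) C)).
  apply: le_Rintegral => //.
  - exact: (integrable_norm ih).
  - apply: (@bmeas_integrable a b `|C|); split; first exact: measurable_cst.
    by [].
  - by move=> t /=; rewrite in_itv /= => /hh.2.
rewrite Rintegral_cst//= lebesgue_measure_itv /= lte_fin.
by case: ltP => // ba; rewrite (_ : b = a) ?subrr//; apply/eqP; rewrite eq_le ba ab.
Qed.

Lemma integral_sub_itv a b C h x t : a <= x -> x <= t -> t <= b -> bmeas a b C h ->
  \int[mu]_(s in `[a, t]) h s - \int[mu]_(s in `[a, x]) h s
    = \int[mu]_(s in `[x, t]) h s.
Proof.
move=> ax xt tb hh.
have it : mu.-integrable `[a, t] (EFin \o h).
  by apply: (@bmeas_integrable _ _ C); apply: bmeas_sub hh.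
rewrite (Rintegral_itvB it) ?bnd_simp//.
rewrite Rintegral_itv_obnd_cbnd//.
by apply: integrableS it => //; apply: subset_itv; rewrite bnd_simp// ltW.
Qed.

Lemma ler_dist_integral a b C h x t : bmeas a b C h ->
  a <= x <= b -> a <= t <= b ->
  `|\int[mu]_(s in `[a, x]) h s - \int[mu]_(s in `[a, t]) h s| <= C * `|x - t|.
Proof.
move=> hh; wlog xt : x t / x <= t.
  move=> hw hx ht; have [xt|/ltW tx] := leP x t; first exact: hw.
  by rewrite distrC (distrC x); exact: hw.
move=> /andP[ax xb] /andP[at_ tb]; rewrite distrC (integral_sub_itv ax xt tb hh).
rewrite (distrC x) (ger0_norm (_ : 0 <= t - x)) ?subr_ge0//.
by apply: ler_norm_integral => //; apply: bmeas_sub hh.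
Qed.

Lemma integral_is_derive a b h t : a < t < b ->
  (forall s, a <= s <= b -> {for s, continuous h}) ->
  is_derive t 1 (fun u => \int[mu]_(s in `[a, u]) h s) (h t).
Proof.
move=> /andP[at_ tb] ch; have [C hC] := continuous_bmeas ch.
have [] := @continuous_FTC1_closed R h a t b tb (bmeas_integrable hC) at_.
  by apply: ch; rewrite !ltW.
by move=> h1 h2; apply: DeriveDef; [exact: h1|rewrite -derive1E; exact: h2].
Qed.

End OneVariable.

(** * Integrals depending on a parameter *)

Section BoundedConvergence.
Context {R : realType}.
Notation mu := (@lebesgue_measure R).

(** Dominated convergence is a statement about sequences.  A filter with a
countable base lets it be used for limits over levels and parameters: a failure
of convergence would already occur along a sequence. *)
Definition countable_base (V : Type) (F : set_system V) :=
  exists U : nat -> set V, (forall n, F (U n)) /\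
    forall A, F A -> \forall n \near \oo, U n `<=` A.

Lemma nbhs_countable_base (V : pseudoMetricType R) (x : V) :
  countable_base (nbhs x).
Proof.
exists (fun n => ball x n.+1%:R^-1); split => [n|A].
  by apply: nbhsx_ballx; rewrite invr_gt0.
move=> /nbhs_ballP[e /= e0 eA].
near=> n; move=> y xy; apply: eA; apply: le_ball xy.
by apply: ltW; near: n; exact: (near_infty_natSinv_lt (PosNum e0)).
Unshelve. all: by end_near. Qed.

Lemma dnbhs_countable_base (V : pseudoMetricType R) (x : V) :
  countable_base (x^').
Proof.
have [U [nU bU]] := nbhs_countable_base x.
exists (fun n => U n `&` [set y | y != x]); split => [n|A].
  by rewrite /dnbhs /within /=; near=> y => yx; split => //; near: y; exact: nU.
move=> /bU; apply: filterS => n UA y [Uy yx]; exact: UA.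
Unshelve. all: by end_near. Qed.

(** Pointwise convergence may fail at finitely many times: these will be the events
of a trajectory, where the cut integrand jumps. *)
Lemma bounded_cvg_integral (V : Type) (F : set_system V) {FF : ProperFilter F}
    (f : V -> R -> R) (f0 : R -> R) (a b C : R) (Z : set R) :
  countable_base F -> finite_set Z ->
  (\forall p \near F, bmeas a b C (f p)) -> measurable_fun `[a, b] f0 ->
  (forall t, a <= t <= b -> ~ Z t -> f p t @[p --> F] --> f0 t) ->
  \int[mu]_(t in `[a, b]) f p t @[p --> F] --> \int[mu]_(t in `[a, b]) f0 t.
Proof.
move=> [U [FU bU]] fZ hf mf0 hcv.
apply/cvgrPdist_lt => e e0; apply: contrapT => hne.
have hp n : exists p, [/\ U n p, bmeas a b C (f p) &
    ~ `|\int[mu]_(t in `[a, b]) f0 t - \int[mu]_(t in `[a, b]) f p t| < e].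
  apply: contrapT => hnp; apply: hne; near=> p; apply: contrapT => hlt.
  by apply: hnp; exists p; split => //; near: p; [exact: FU|exact: hf].
have [p hp'] := choice hp.
have pF A : F A -> \forall n \near \oo, A (p n).
  by move=> /bU; apply: filterS => n; apply; case: (hp' n).
have mf n : measurable_fun `[a, b] (EFin \o f (p n)).
  by apply/measurable_EFinP; case: (hp' n) => _ [].
have mf0' : measurable_fun `[a, b] (EFin \o f0) by apply/measurable_EFinP.
have ig : mu.-integrable `[a, b] (EFin \o cst `|C|).
  by apply: (@bmeas_integrable _ a b `|C|); split; [exact: measurable_cst|move=> *; rewrite normr_id].
have aeZ (P : R -> Prop) : (forall t, ~ Z t -> P t) -> {ae mu, forall t, P t}.
  move=> hP; exists Z; split.
  - apply: countable_measurable => [t|]; [exact: measurable_set1|exact: finite_set_countable].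
  - by apply: countable_lebesgue_measure0; exact: finite_set_countable.
  - by move=> t /= /contra_notP; apply => /hP.
have cvf : {ae mu, forall t, `[a, b]%classic t ->
    (EFin \o f (p n)) t @[n --> \oo] --> (EFin \o f0) t}.
  apply: aeZ => t nZ; rewrite /= in_itv /= => ht.
  apply: cvg_EFin; first by apply: nearW.
  move=> A hA; exact: (pF (fun q => A (f q t)) (hcv _ ht nZ _ hA)).
have bdf : {ae mu, forall t n, `[a, b]%classic t ->
    (`|(EFin \o f (p n)) t| <= (EFin \o cst `|C|%R) t)%E}.
  apply: nearW => t n; rewrite /= in_itv /= => ht.
  rewrite lee_fin; case: (hp' n) => _ [_ /(_ _ ht) h] _.
  by apply: (le_trans h); exact: ler_norm.
have [if0 _] := @dominated_convergence _ _ R mu _ (measurable_itv `[a, b])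
  (fun n => EFin \o f (p n)) (EFin \o f0) _ mf mf0' cvf ig bdf.
have fin0 : (\int[mu]_(t in `[a, b]) (EFin \o f0) t)%E \is a fin_num.
  exact: integrable_fin_num.
rewrite -(fineK fin0).
move=> /fine_cvgP[_] /cvgrPdist_lt /(_ e e0) [n _ /(_ n (leqnn n))] /=.
by case: (hp' n).
Unshelve. all: by end_near. Qed.

End BoundedConvergence.

(** * Solving a short initial value problem *)

Section Geometric.
Context {R : realType}.

(** Passing to the limit in an estimate whose error halves at each step. *)
Lemma ler_addgt0_geometric (x z C : R) :
  (forall n : nat, x <= z + C * 2^-1 ^+ n) -> x <= z.
Proof.
move=> h.
have c1 : (C * 2^-1 ^+ n) @[n --> \oo] --> (0 : R).
  rewrite -(mulr0 C); apply: cvgM; first exact: cvg_cst.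
  by apply: cvg_expr; rewrite ger0_norm; lra.
have c2 : (z + C * 2^-1 ^+ n) @[n --> \oo] --> z.
  by rewrite -[X in _ --> X]addr0; apply: cvgD; [exact: cvg_cst|].
rewrite -(cvg_lim (@Rhausdorff R) c2); apply: limr_ge; first by apply/cvg_ex; exists z.
by apply: nearW.
Qed.

(** The sequences u n - 2 c / 2 ^ n and u n + 2 c / 2 ^ n are monotone and enclose
u, so the limit is the supremum of the first one. *)
Lemma geometric_limit (u : nat -> R) (c : R) :
  (forall n, `|u n.+1 - u n| <= c * 2^-1 ^+ n) ->
  exists l, forall n, `|l - u n| <= 2 * c * 2^-1 ^+ n.
Proof.
move=> hu; pose L n := u n - 2 * c * 2^-1 ^+ n; pose U n := u n + 2 * c * 2^-1 ^+ n.
have c0 : 0 <= c by have := hu 0%N; rewrite expr0 mulr1; exact: le_trans.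
have p0 n : 0 <= (2^-1 : R) ^+ n by apply: exprn_ge0; lra.
have Lm : {homo L : m n / (m <= n)%N >-> m <= n}.
  apply/nondecreasing_seqP => n; rewrite /L exprS.
  by have := hu n; rewrite ler_norml => /andP[? ?]; lra.
have Um : {homo U : m n / (m <= n)%N >-> m >= n}.
  apply/nonincreasing_seqP => n; rewrite /U exprS.
  by have := hu n; rewrite ler_norml => /andP[? ?]; lra.
have LU m n : L m <= U n.
  apply: (le_trans (Lm _ _ (leq_maxl m n))); apply: le_trans (Um _ _ (leq_maxr m n)).
  by rewrite /L /U lerD2l; have := mulr_ge0 c0 (p0 (maxn m n)); lra.
exists (sup (range L)) => n.
have hs : has_sup (range L).
  split; first by exists (L 0%N), 0%N.
  by exists (U 0%N) => _ [m _ <-].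
have h1 : L n <= sup (range L) by apply: sup_upper_bound => //; exists n.
have h2 : sup (range L) <= U n.
  by apply: ge_sup => [|_ [m _ <-]]; [case: hs|].
by rewrite ler_norml; apply/andP; split; rewrite /L /U in h1 h2; lra.
Qed.

End Geometric.

Section Picard.
Context {R : realType}.
Notation mu := (@lebesgue_measure R).
Implicit Types (y z : R -> R) (e : R).

Definition clamp (a b t : R) := Num.max a (Num.min t b).

Lemma clamp_itv a b t : a <= b -> a <= clamp a b t <= b.
Proof. by move=> ab; rewrite le_max lexx /= ge_max ab ge_min lexx orbT. Qed.

Lemma clamp_id a b t : a <= t <= b -> clamp a b t = t.
Proof. by case/andP => h1 h2; rewrite /clamp min_l// max_r. Qed.

Lemma clamp_lipschitz a b t u : `|clamp a b t - clamp a b u| <= `|t - u|.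
Proof.
wlog tu : t u / t <= u.
  by move=> hw; have [/hw//|/ltW/hw] := leP t u; rewrite distrC (distrC u).
have tu' : t - u <= 0 by rewrite subr_le0.
rewrite (ler0_norm tu').
rewrite /clamp !maxEle !minEle.
by do !case: ifPn; rewrite -?ltNge => *; rewrite ler_norml; apply/andP; split; lra.
Qed.

Lemma lipschitz_continuous y M (M0 : 0 <= M) :
  (forall t u, `|y t - y u| <= M * `|t - u|) -> forall t, {for t, continuous y}.
Proof.
move=> hy t; apply/cvgrPdist_lt => e e0.
have M1 : 0 < M + 1 by lra.
have e1 : 0 < e / (M + 1) by exact: divr_gt0.
near=> u; apply: le_lt_trans (hy _ _) _.
have : `|t - u| < e / (M + 1) by near: u; exact: (@cvgr_dist_lt _ _ _ _ _ id t (@cvg_id _ _)).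
rewrite ltr_pdivlMr// => h; apply: le_lt_trans h; rewrite mulrC ler_wpM2l//; lra.
Unshelve. all: by end_near. Qed.

Variables (a b K M q : R) (psi : R -> R -> R).
Hypotheses (ab : a <= b) (K0 : 0 <= K) (Kab : K * (b - a) <= 2^-1).
Hypothesis psi_cont : forall t x, a <= t <= b ->
  {for (t, x), continuous (fun p : R * R => psi p.1 p.2)}.
Hypothesis psi_bound : forall t x, a <= t <= b -> `|psi t x| <= M.
Hypothesis psi_lip : forall t x x', a <= t <= b ->
  `|psi t x - psi t x'| <= K * `|x - x'|.

Let M0 : 0 <= M.
Proof. by apply: le_trans (psi_bound (t := a) 0 _); rewrite ?lexx. Qed.

(** The clamp makes every iterate defined and Lipschitz on the whole line, so that
continuity never has to be stated relative to the interval. *)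
Definition picard_step y t := q + \int[mu]_(s in `[a, clamp a b t]) psi s (y s).

Let comp_cont y : (forall t, {for t, continuous y}) ->
  forall t, a <= t <= b -> {for t, continuous (fun s => psi s (y s))}.
Proof.
move=> cy t ht; apply: (@continuous2_cvg _ _ _ _ _ _ (fun s => s) y psi t (y t)) => //.
- exact: psi_cont.
- exact: cy.
Qed.

Let comp_bmeas y : (forall t, {for t, continuous y}) ->
  bmeas a b M (fun s => psi s (y s)).
Proof.
move=> cy; split; last by move=> t /psi_bound.
by apply: continuous_measurable_cc => t; exact: comp_cont.
Qed.

Let step_lip y : (forall t, {for t, continuous y}) ->
  forall t u, `|picard_step y t - picard_step y u| <= M * `|t - u|.
Proof.
move=> cy t u; rewrite /picard_step opprD addrACA subrr add0r.
apply: le_trans (ler_dist_integral (comp_bmeas cy) _ _) _; rewrite ?clamp_itv//.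
by apply: ler_wpM2l => //; exact: clamp_lipschitz.
Qed.

Let step_contract y z e : (forall t, {for t, continuous y}) ->
  (forall t, {for t, continuous z}) -> (forall t, `|y t - z t| <= e) ->
  forall t, `|picard_step y t - picard_step z t| <= 2^-1 * e.
Proof.
move=> cy cz yz t; rewrite /picard_step opprD addrACA subrr add0r.
have /andP[h1 h2] := clamp_itv t ab.
have iy := bmeas_integrable (bmeas_sub (lexx _) h2 (comp_bmeas cy)).
have iz := bmeas_integrable (bmeas_sub (lexx _) h2 (comp_bmeas cz)).
rewrite -RintegralB//.
have e0 : 0 <= e by apply: le_trans (yz 0).
apply: (@le_trans _ _ (K * e * (clamp a b t - a))).
  apply: ler_norm_integral => //; split.
    by apply: measurable_funB; [case: (bmeas_sub (lexx _) h2 (comp_bmeas cy))|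
      case: (bmeas_sub (lexx _) h2 (comp_bmeas cz))].
  move=> s /andP[s1 s2]; apply: le_trans (psi_lip _ _ _) _.
    by rewrite s1 (le_trans s2).
  exact: ler_wpM2l.
have : K * (clamp a b t - a) <= 2^-1.
  by apply: le_trans Kab; apply: ler_wpM2l => //; lra.
by move=> /(ler_wpM2r e0); rewrite mulrAC.
Qed.

(** With K (b - a) <= 1/2 the Picard map halves uniform distances, so its iterates
converge geometrically at each time, with limits that inherit the common
Lipschitz constant M. *)
Lemma picard_lindelof : exists y, [/\ (forall t, {for t, continuous y}), y a = q &
  forall t, a < t < b -> is_derive t 1 y (psi t (y t))].
Proof.
pose u n := iter n picard_step (cst q).
have cu n : forall t, {for t, continuous (u n)}.
  elim: n => [t|n IH]; first exact: cvg_cst.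
  exact: (lipschitz_continuous M0 (step_lip IH)).
have hu t n : `|u n.+1 t - u n t| <= (M * (b - a)) * 2^-1 ^+ n.
  elim: n t => [|n IH] t.
    rewrite expr0 mulr1 /= /picard_step addrC addKr.
    have /andP[h1 h2] := clamp_itv t ab.
    apply: le_trans (ler_norm_integral h1 (bmeas_sub (lexx _) h2 (comp_bmeas (cu 0%N)))) _.
    by apply: ler_wpM2l => //; lra.
  apply: le_trans (step_contract (cu n.+1) (cu n) IH t) _.
  by rewrite exprS mulrCA.
have [y hy] := choice (fun t => geometric_limit (hu t)).
set c := 2 * _ in hy.
have ylip t s : `|y t - y s| <= M * `|t - s|.
  apply: (@ler_addgt0_geometric R _ _ (2 * c + 2 * M * `|t - s|)) => -[|n].
    have h1 := hy t 0%N; have h2 := hy s 0%N.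
    rewrite expr0 !mulr1 in h1 h2 *.
    have -> : y t - y s = (y t - u 0%N t) - (y s - u 0%N s) by rewrite /u /=; ring.
    apply: le_trans (ler_normB _ _) _.
    by have := mulr_ge0 M0 (normr_ge0 (t - s)); lra.
  have h1 := hy t n.+1; have h2 := hy s n.+1.
  have -> : y t - y s = (y t - u n.+1 t) - (y s - u n.+1 s) + (u n.+1 t - u n.+1 s) by ring.
  apply: le_trans (ler_normD _ _) _.
  have h3 := ler_normB (y t - u n.+1 t) (y s - u n.+1 s).
  have h4 := step_lip (cu n) t s; rewrite -/(u n.+1) in h4.
  have : 0 <= 2 * M * `|t - s| * 2^-1 ^+ n.+1.
    by rewrite !mulr_ge0// ?exprn_ge0//; lra.
  rewrite mulrDl; lra.
have cy := lipschitz_continuous M0 ylip.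
have yE t : y t = picard_step y t.
  apply/eqP; rewrite -subr_eq0 -normr_le0.
  apply: (@ler_addgt0_geometric R _ _ c) => n; rewrite add0r.
  have -> : y t - picard_step y t =
     (y t - u n.+1 t) - (picard_step y t - picard_step (u n) t).
    by rewrite /u iterS; ring.
  apply: le_trans (ler_normB _ _) _.
  have := step_contract cy (cu n) (fun s => hy s n) t.
  by have := hy t n.+1; rewrite exprS; lra.
exists y; split => // [|t /andP[at_ tb]].
  rewrite yE /picard_step clamp_id ?lexx//.
  by rewrite set_itv1 Rintegral_set1 addr0.
have h := @integral_is_derive R a b (fun s => psi s (y s)) t _ (comp_cont cy).
have {}h : is_derive t 1 (fun w => q + \int[mu]_(s in `[a, w]) psi s (y s)) (psi t (y t)).
  rewrite -[X in is_derive _ _ _ X]add0r; apply: is_deriveD.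
  by apply: h; rewrite at_.
apply: near_eq_is_derive h.
near=> w; rewrite yE /picard_step clamp_id//; apply/andP; split.
- by apply: ltW; near: w; exact: lt_nbhsr.
- by apply: ltW; near: w; exact: lt_nbhsl.
Unshelve. all: by end_near. Qed.

End Picard.

(** * Counting zeros and crossings *)

Section Counting.
Context {R : realType}.
Implicit Types (X Z : set R) (s : seq R) (n k : nat) (f g : R -> R).

(** Bounding the length of strictly sorted lists makes interlacing arguments
inductions on a list, before anything is known to be finite. *)
Definition at_most n X :=
  forall s, sorted <%R s -> (forall x, x \in s -> X x) -> (size s <= n)%N.

(** The chosen points z, one in each gap between neighbours of a sorted list of X,
form a sorted list of Z that is shorter by one. *)
Lemma at_most_interlace n X Z : at_most n Z ->
  (forall x y, X x -> X y -> x < y -> exists2 z, x < z < y & Z z) ->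
  at_most n.+1 X.
Proof.
move=> hZ hX [|x s] //= ps hs.
suff [zs [<- pz hz]] : exists zs, [/\ size zs = size s, path <%R x zs &
    forall z, z \in zs -> Z z].
  by rewrite ltnS; apply: hZ => //; exact: path_sorted pz.
elim: s x ps hs => [|y s IH] x /=; first by exists [::].
move=> /andP[xy ps] hs.
have [z /andP[xz zy] Zz] : exists2 z, x < z < y & Z z.
  by apply: hX => //; apply: hs; rewrite !inE eqxx ?orbT.
have [||zs [sz pz hz]] := IH y => //.
  by move=> w ws; apply: hs; rewrite inE ws orbT.
exists (z :: zs); split => /=; first by rewrite sz.
  rewrite xz /=; case: zs pz {sz hz} => //= w zs /andP[yw ->].
  by rewrite (lt_trans zy yw).
by move=> w; rewrite inE => /predU1P[->|/hz].
Qed.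

Lemma at_most_inj n X Z (c : R -> R) : at_most n Z ->
  (forall x, X x -> Z (c x)) ->
  (forall x y, X x -> X y -> c x = c y -> x = y) -> at_most n X.
Proof.
move=> hZ hc ci s ss hs; rewrite -(size_map c) -(size_sort <=%R).
apply: hZ => [|z].
  rewrite lt_sorted_uniq_le sort_uniq sort_le_sorted andbT map_inj_in_uniq.
    exact: lt_sorted_uniq.
  by move=> x y /hs Xx /hs Xy; exact: ci.
by rewrite mem_sort => /mapP[x /hs Xx ->]; exact: hc.
Qed.

(** A longest sorted list in X exhausts X, since any missing point could be
inserted. *)
Lemma at_most_enum n X : at_most n X -> exists s,
  [/\ sorted <%R s, (size s <= n)%N & forall x, X x <-> x \in s].
Proof.
move=> hX.
pose P k := `[< exists s, [/\ sorted <%R s, size s = k & forall x, x \in s -> X x] >].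
have P0 : exists k, P k by exists 0%N; apply/asboolP; exists [::].
have Pn k : P k -> (k <= n)%N by move=> /asboolP[s [h1 <- h2]]; exact: hX.
case: (ex_maxnP P0 Pn) => k /asboolP[s [ss sk hs]] maxk.
exists s; split => //; first by rewrite sk Pn//; apply/asboolP; exists s.
move=> x; split => [Xx|/hs//]; apply: contrapT => /negP xs.
have : P k.+1.
  apply/asboolP; exists (sort <=%R (x :: s)); split.
  - by rewrite lt_sorted_uniq_le sort_uniq sort_le_sorted andbT /= xs lt_sorted_uniq.
  - by rewrite size_sort /= sk.
  - by move=> y; rewrite mem_sort inE => /predU1P[->|/hs].
by move=> /maxk; rewrite ltnn.
Qed.

Lemma at_most_finite n X : at_most n X -> finite_set X.
Proof.
move=> /at_most_enum[s [_ _ Xs]]; apply/finite_seqP; exists s.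
by apply/seteqP; split => x /= /Xs.
Qed.

Lemma at_most_card n X : at_most n X -> (X #<= `I_n)%card.
Proof.
move=> /at_most_enum[s [_ sn Xs]].
have -> : X = nth 0 s @` `I_(size s).
  apply/seteqP; split => [x /Xs xs|_ [i /= si <-]]; last by apply/Xs/mem_nth.
  by exists (index x s); [rewrite /= index_mem|rewrite nth_index].
by apply: card_le_trans (card_image_le _ _) _; rewrite card_le_II.
Qed.

(** Descending from the derivative of order n, which has no zero: by Rolle's
theorem, each integration adds at most one zero. *)
Lemma at_most_roots n (d : nat -> R -> R) (a b : R) :
  (forall k t, (k < n)%N -> a <= t <= b -> is_derive t 1 (d k) (d k.+1 t)) ->
  (forall t, a <= t <= b -> d n t != 0) ->
  forall k, (k <= n)%N -> at_most (n - k) [set t | a <= t <= b /\ d k t = 0].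
Proof.
move=> hd hn k kn; rewrite -(subKn kn).
have : (n - k <= n)%N by exact: leq_subr.
move: (n - k)%N => j {k kn}; elim: j => [|j IH] jn.
  rewrite subn0 subnn => -[|t s] //= _ /(_ t); rewrite inE eqxx => /(_ isT)[/hn/eqP].
  by [].
rewrite subKn//; apply: at_most_interlace; first by have := IH (ltnW jn); rewrite (subKn (ltnW jn)); exact.
move=> x y [/andP[ax xb] dx] [/andP[ay yb] dy] xy.
have kn : (n - j.+1 < n)%N by lia.
have [||c] := Rolle xy _ _ (etrans dx (esym dy)).
- move=> t; rewrite in_itv /= => /andP[xt ty].
  by have := hd _ t kn; case => //; rewrite (le_trans ax (ltW xt)) (le_trans (ltW ty) yb).
- apply: within_continuous_cc => t /andP[xt ty].
  apply: differentiable_continuous; apply/derivable1_diffP.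
  by have := hd _ t kn; case => //; rewrite (le_trans ax xt) (le_trans ty yb).
rewrite in_itv /= => /[dup] cxy /andP[xc cy] dc.
have hc : a <= c <= b by rewrite (le_trans ax (ltW xc)) (le_trans (ltW cy) yb).
exists c => //; split => //.
have -> : (n - j = (n - j.+1).+1)%N by lia.
have := hd _ c kn hc => dc'.
by rewrite -(@derive_val _ _ _ _ _ _ _ dc') (@derive_val _ _ _ _ _ _ _ dc).
Qed.

End Counting.

Section Signs.
Context {R : realType}.
Implicit Types (a b l u t : R) (f g : R -> R) (s : seq R).

(** A change of sign would produce a zero by the intermediate value theorem. *)
Lemma constant_sign g a b l u :
  (forall t, a <= t <= b -> {for t, continuous g}) ->
  a <= l -> u <= b -> (forall t, l < t < u -> g t != 0) ->
  (\forall t \near l^'+, 0 < g t) -> forall t, l < t < u -> 0 < g t.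
Proof.
move=> cg al ub g0 gl t /andP[lt_ tu]; rewrite ltNge; apply/negP => gt0.
have lx : \forall x \near l^'+, l < x < t by near=> x; apply/andP; split; near: x;
  [exact: nbhs_right_gt|exact: nbhs_right_lt].
have [x [gx /andP[lx' xt]]] : exists x, 0 < g x /\ l < x < t.
  by apply: (@filter_ex _ (l^'+)); apply: filterI.
have [||c] := @IVT R g x t 0 (ltW xt) _ _.
- apply: within_continuous_cc => y /andP[xy yt]; apply: cg.
  by apply/andP; split; [exact: le_trans al (le_trans (ltW lx') xy)|
    exact: le_trans yt (le_trans (ltW tu) ub)].
- by rewrite ge_min gt0 orbT /= le_max (ltW gx).
rewrite in_itv /= => /andP[xc ct] gc.
have := g0 c; rewrite gc eqxx (lt_le_trans lx' xc) (le_lt_trans ct tu).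
by move=> /(_ isT).
Unshelve. all: by end_near. Qed.

Lemma constant_signN g a b l u :
  (forall t, a <= t <= b -> {for t, continuous g}) ->
  a <= l -> u <= b -> (forall t, l < t < u -> g t != 0) ->
  (\forall t \near l^'+, g t < 0) -> forall t, l < t < u -> g t < 0.
Proof.
move=> cg al ub g0 gl t ht; rewrite -oppr_gt0.
apply: (@constant_sign (fun t => - g t) a b l u _ al ub _ _ t ht).
- by move=> x hx; apply: cvgN; exact: cg.
- by move=> x /g0; rewrite oppr_eq0.
- by apply: filterS gl => x; rewrite oppr_gt0.
Qed.

Definition up_crossing g t :=
  [/\ g t = 0, \forall x \near t^'-, g x < 0 & \forall x \near t^'+, 0 < g x].
Definition down_crossing g t :=
  [/\ g t = 0, \forall x \near t^'-, 0 < g x & \forall x \near t^'+, g x < 0].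

(** Between two neighbouring zeros g keeps its sign, so up- and down-crossings
alternate; starting below zero the first zero is an up-crossing, and ending
below zero forces it to be followed by a down-crossing.  Zeros are thus
consumed two at a time. *)
Lemma crossing_intervals_from g a b s l :
  (forall t, a <= t <= b -> {for t, continuous g}) -> g b < 0 ->
  (forall t, a <= t <= b -> g t = 0 -> up_crossing g t \/ down_crossing g t) ->
  a <= l < b -> path <%R l s ->
  (forall t, t \in s <-> l < t <= b /\ g t = 0) ->
  (\forall t \near l^'+, g t < 0) ->
  exists ps : seq (R * R),
  [/\ size s = (size ps).*2,
      forall i j, (i < j < size ps)%N -> (nth (0, 0) ps i).2 < (nth (0, 0) ps j).1,
      forall p, p \in ps -> [/\ l < p.1 < p.2, up_crossing g p.1 & down_crossing g p.2],
      forall t, l < t <= b -> (0 < g t <-> exists2 p, p \in ps & p.1 < t < p.2) &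
      forall t, t \in s <-> exists2 p, p \in ps & t = p.1 \/ t = p.2].
Proof.
move=> cg gb hz; have [n] := ubnP (size s).
elim: n s l => // n IH s l; rewrite ltnS => sn /andP[al lb] ps hs gl.
case: s sn ps hs => [|x s] sn ps hs.
  exists [::]; split => //= [i j|t /andP[lt_ tb]|t]; last by split => // -[].
    by rewrite ltn0 andbF.
  split => [gt0|[]//]; exfalso.
  have g0 y : l < y < b -> g y != 0.
    move=> /andP[ly yb]; apply/eqP => gy.
    by have [_ /(_ (conj _ gy))] := hs y; rewrite ly ltW// in_nil => /(_ isT).
  move: tb; rewrite le_eqVlt => /predU1P[tb|tb].
    by move: gt0; rewrite tb ltNge ltW.
  have := constant_signN cg al (lexx b) g0 gl (t := t); rewrite lt_ tb => /(_ isT).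
  by rewrite ltNge ltW.
have /andP[lx ps'] : (l < x) && path <%R x s by [].
have [/(_ (mem_head _ _))[/andP[_ xb] gx] _] := hs x.
have sx y : y \in s -> x < y by move=> ys; have /allP := order_path_min lt_trans ps'; exact.
have ax : a <= x by apply: le_trans al (ltW lx).
have gneg t : l < t < x -> g t < 0.
  apply: (constant_signN cg al xb) => // y /andP[ly yx]; apply/eqP => gy.
  have [_ /(_ (conj _ gy))] := hs y; rewrite ly (le_trans (ltW yx) xb) => /(_ isT).
  rewrite inE => /predU1P[e|/sx]; first by rewrite e ltxx in yx.
  by rewrite ltNge ltW.
have upx : up_crossing g x.
  case: (hz x _ gx) => //; first by rewrite ax xb.
  case=> _ gl' _; exfalso.
  have : \forall y \near x^'-, False.
    near=> y; have : 0 < g y by near: y.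
    rewrite ltNge => /negP; apply; apply: ltW; apply: gneg; apply/andP; split; near: y.
      exact: nbhs_left_gt.
    exact: nbhs_left_lt.
  by move/filter_ex => [].
have xb' : x < b by rewrite lt_neqAle xb andbT; apply/eqP => e; move: gb; rewrite -e gx ltxx.
have gxr : \forall t \near x^'+, 0 < g t by case: upx.
case: s sn ps hs ps' sx => [|y s] sn ps hs ps' sx.
  exfalso.
  have g0 y : x < y < b -> g y != 0.
    move=> /andP[xy yb]; apply/eqP => gy.
    have [_ /(_ (conj _ gy))] := hs y; rewrite (lt_trans lx xy) (ltW yb) => /(_ isT).
    by rewrite inE => /eqP e; rewrite e ltxx in xy.
  have gpos := constant_sign cg ax (lexx b) g0 gxr.
  have : 0 <= g b.
    have cgb : g t @[t --> b^'-] --> g b by apply: cvg_at_left_filter; apply: cg; rewrite (le_trans ax xb) lexx.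
    rewrite -(cvg_lim (@Rhausdorff R) cgb); apply: limr_ge; first by apply/cvg_ex; exists (g b).
    near=> t; apply: ltW; apply: gpos; apply/andP; split; near: t.
      exact: nbhs_left_gt.
    exact: nbhs_left_lt.
  by rewrite leNgt gb.
have /andP[xy ps''] : (x < y) && path <%R y s by [].
have /hs[/andP[_ yb] gy] : y \in [:: x, y & s] by rewrite !inE eqxx orbT.
have sy z : z \in s -> y < z by move=> zs; have /allP := order_path_min lt_trans ps''; exact.
have ay : a <= y by apply: le_trans ax (ltW xy).
have gpos t : x < t < y -> 0 < g t.
  apply: (constant_sign cg ax yb) => // z /andP[xz zy]; apply/eqP => gz.
  have [_ /(_ (conj _ gz))] := hs z.
  rewrite (lt_trans lx xz) (le_trans (ltW zy) yb) => /(_ isT).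
  rewrite !inE => /or3P[/eqP e|/eqP e|/sy]; first by rewrite e ltxx in xz.
    by rewrite e ltxx in zy.
  by rewrite ltNge ltW.
have dny : down_crossing g y.
  case: (hz y _ gy) => //; first by rewrite ay yb.
  case=> _ gl' _; exfalso.
  have : \forall z \near y^'-, False.
    near=> z; have : g z < 0 by near: z.
    rewrite ltNge => /negP; apply; apply: ltW; apply: gpos; apply/andP; split; near: z.
      exact: nbhs_left_gt.
    exact: nbhs_left_lt.
  by move/filter_ex => [].
have yb' : y < b by rewrite lt_neqAle yb andbT; apply/eqP => e; move: gb; rewrite -e gy ltxx.
have [|||||qs [q1 q2 q3 q4 q5]] := IH s y.
- exact: ltnW sn.
- by rewrite ay yb'.
- exact: ps''.
- move=> t; split.
    move=> ts; have /hs[/andP[_ h1] h2] : t \in [:: x, y & s] by rewrite !inE ts !orbT.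
    by rewrite sy.
  move=> [/andP[yt tb] gt_]; have [_ /(_ (conj _ gt_))] := hs t.
  rewrite (lt_trans lx (lt_trans xy yt)) tb => /(_ isT).
  by rewrite !inE => /or3P[/eqP e|/eqP e|//]; subst t; move: yt; rewrite ?ltxx// ltNge ltW.
- by case: dny.
exists ((x, y) :: qs); split => /=.
- by rewrite q1 doubleS.
- move=> [|i] [|j]; rewrite ?ltn0//= ltnS; last exact: q2.
  by move=> jq; have [/andP[]//] := q3 _ (mem_nth (0, 0) jq).
- move=> p; rewrite inE => /predU1P[->|/q3[/andP[h1 h2] h3 h4]]; first by rewrite /= lx xy.
  by split => //; rewrite h2 (lt_trans lx (lt_trans xy h1)).
- move=> t /andP[lt_ tb]; have [yt|ty] := ltP y t.
    rewrite q4 ?yt//; split => [[p pq hp]|[p + hp]]; first by exists p => //; rewrite inE pq orbT.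
    rewrite inE => /predU1P[e|pq]; last by exists p.
    by move: hp; rewrite e /= => /andP[_]; rewrite ltNge ltW.
  split => [gt_|[p]].
    exists (x, y); rewrite ?mem_head//=; apply/andP; split.
      rewrite ltNge; apply/negP; rewrite le_eqVlt => /predU1P[e|tx].
        by move: gt_; rewrite e gx ltxx.
      by have := gneg t; rewrite lt_ tx => /(_ isT); rewrite ltNge ltW.
    rewrite lt_neqAle ty andbT; apply/eqP => e.
    by move: gt_; rewrite e gy ltxx.
  rewrite inE => /predU1P[->|/q3[/andP[h1 h2] _ _] /andP[h3 _]] /=; first exact: gpos.
  by have := lt_le_trans (lt_trans h1 h3) ty; rewrite ltxx.
- move=> t; split; last first.
    move=> [p]; rewrite inE => /predU1P[-> [->|->]|pq hp]; rewrite !inE ?eqxx ?orbT//.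
    by rewrite (_ : t \in s) ?orbT//; apply/q5; exists p.
  rewrite !inE => /or3P[/eqP->|/eqP->|/q5[p pq hp]].
  + by exists (x, y); [rewrite mem_head|left].
  + by exists (x, y); [rewrite mem_head|right].
  + by exists p => //; rewrite inE pq orbT.
Unshelve. all: by end_near. Qed.

Lemma crossing_intervals g a b s : a < b ->
  (forall t, a <= t <= b -> {for t, continuous g}) -> g a < 0 -> g b < 0 ->
  (forall t, a <= t <= b -> g t = 0 -> up_crossing g t \/ down_crossing g t) ->
  sorted <%R s -> (forall t, t \in s <-> a <= t <= b /\ g t = 0) ->
  exists (N : nat) (A B : 'I_N -> R),
  [/\ size s = N.*2, (forall k, A k < B k),
      (forall k l : 'I_N, (k < l)%N -> B k < A l),
      (forall k, up_crossing g (A k) /\ down_crossing g (B k)) &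
      (forall t, a <= t <= b -> (0 < g t <-> exists k, A k < t < B k)) /\
      (forall t, t \in s <-> exists k, t = A k \/ t = B k)].
Proof.
move=> ab cg ga gb hz ss hs.
have sa t : t \in s -> a < t.
  move=> /hs[/andP[at_ _] gt_]; rewrite lt_neqAle at_ andbT; apply/eqP => e.
  by move: ga; rewrite e gt_ ltxx.
have [|||| ps [h1 h2 h3 h4 h5]] := @crossing_intervals_from g a b s a cg gb hz.
- by rewrite lexx.
- by rewrite path_sortedE ?ss ?andbT; [apply/allP => t; exact: sa|exact: lt_trans].
- move=> t; rewrite hs; split => -[/andP[at_ tb] gt_]; last by rewrite (ltW at_).
  by rewrite sa// hs at_ tb.
- have cga : g t @[t --> a^'+] --> g a.
    by apply: cvg_at_right_filter; apply: cg; rewrite lexx ltW.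
  exact: (cvgr_lt _ cga).
have hin (k : 'I_(size ps)) := h3 _ (mem_nth (0, 0) (ltn_ord k)).
exists (size ps), (fun k => (nth (0, 0) ps k).1), (fun k => (nth (0, 0) ps k).2); split => //.
- by move=> k; have [/andP[]] := hin k.
- by move=> k l kl; apply: h2; rewrite kl ltn_ord.
- by move=> k; have [_] := hin k.
- split=> t.
    move=> /andP[]; rewrite le_eqVlt => /predU1P[<- _|at_ tb].
      split => [|[k /andP[h _]]]; first by rewrite ltNge ltW.
      by have [/andP[/lt_trans/(_ h)]] := hin k; rewrite ltxx.
    rewrite h4 ?at_//; split => [[p /(nthP (0, 0))[i ip <-] hp]|[k hk]].
      by exists (Ordinal ip).
    by exists (nth (0, 0) ps k) => //; rewrite mem_nth.
  rewrite h5; split => [[p /(nthP (0, 0))[i ip <-] hp]|[k hk]]; first by exists (Ordinal ip).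
  by exists (nth (0, 0) ps k) => //; rewrite mem_nth.
Qed.

(** Splitting the interval at the exceptional points leaves pieces on which the
mean value theorem applies; continuity glues them. *)
Lemma nondecreasing_off_finite f df s a b :
  a <= b -> {within `[a, b], continuous f} ->
  (forall t, a < t < b -> t \notin s -> is_derive t 1 f (df t) /\ 0 <= df t) ->
  f a <= f b.
Proof.
elim: s a b => [|c s IH] a b ab cf hd.
  move: ab; rewrite le_eqVlt => /predU1P[->//|ab].
  have [|c] := @MVT R f df a b ab _ cf.
    by move=> t; rewrite in_itv /= => ht; case: (hd t ht).
  rewrite in_itv /= => hc e; rewrite -subr_ge0 e mulr_ge0 ?subr_ge0 ?(ltW ab)//.
  by case: (hd c hc).
have [/andP[ac cb]|nc] := boolP (a < c < b).
  apply: (@le_trans _ _ (f c)); apply: IH; rewrite ?(ltW ac) ?(ltW cb)//.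
  - by apply: continuous_subspaceW cf; apply: subset_itv; rewrite bnd_simp// ltW.
  - move=> t /andP[at_ tc] ts; apply: hd; first by rewrite at_ (lt_trans tc cb).
    by rewrite inE negb_or ts lt_eqF.
  - by apply: continuous_subspaceW cf; apply: subset_itv; rewrite bnd_simp// ltW.
  - move=> t /andP[ct tb] ts; apply: hd; first by rewrite (lt_trans ac ct).
    by rewrite inE negb_or ts gt_eqF.
apply: IH => // t ht ts; apply: hd => //; rewrite inE negb_or ts andbT.
by apply: contraNneq nc => <-.
Qed.

End Signs.

(** * Branches of zeros, and uniformity over a compact interval *)

Section TwoVariables.
Context {R : realType}.
Implicit Types (f g : R -> R) (G Gt : R -> R -> R) (c : R -> R).

Lemma continuous_dist_lt (V : topologicalType) (f : V -> R) (x : V) (e : R) :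
  {for x, continuous f} -> 0 < e -> \forall y \near x, `|f x - f y| < e.
Proof. by move=> /cvgrPdist_lt; exact. Qed.

Lemma continuous_lt (V : topologicalType) (f : V -> R) (x : V) (z : R) :
  {for x, continuous f} -> f x < z -> \forall y \near x, f y < z.
Proof. by move=> cf; exact: (cvgr_lt _ cf). Qed.

Lemma continuous_gt (V : topologicalType) (f : V -> R) (x : V) (z : R) :
  {for x, continuous f} -> z < f x -> \forall y \near x, z < f y.
Proof. by move=> cf; exact: (cvgr_gt _ cf). Qed.

Lemma near_dist_lt (x e : R) : 0 < e -> \forall y \near x, `|x - y| < e.
Proof. by move=> e0; apply/nbhs_ballP; exists e. Qed.

Lemma sum_continuous (V : topologicalType) (J : Type) (s : seq J) (f : J -> V -> R) (x : V) :
  (forall j, {for x, continuous (f j)}) ->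
  {for x, continuous (fun y => \sum_(j <- s) f j y)}.
Proof.
move=> cf; elim: s => [|j s IH].
  have -> : (fun y => \sum_(j <- [::]) f j y) = cst 0 by apply/funext => y; rewrite big_nil.
  exact: cvg_cst.
have -> : (fun y => \sum_(i <- j :: s) f i y) = (fun y => f j y + \sum_(i <- s) f i y).
  by apply/funext => y; rewrite big_cons.
by apply: cvgD; [exact: cf|exact: IH].
Qed.

Lemma is_derive_slope f g (x : R) :
  (\forall z \near x, f z - f x = g z * (z - x)) -> {for x, continuous g} ->
  is_derive x 1 f (g x).
Proof.
move=> hf cg; apply: (@near_eq_is_derive _ _ _ (fun z => f x + g z * (z - x))).
  by apply: filterS hf => z <-; rewrite addrC subrK.
apply/is_derive1_caratheodory; exists g; split => // z.
by rewrite subrr mulr0 addr0 addrAC subrr add0r.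
Qed.

Lemma is_derive_continuous f (x l : R) : is_derive x 1 f l -> {for x, continuous f}.
Proof. by move=> [df _]; apply: differentiable_continuous; apply/derivable1_diffP. Qed.

Definition derive_near G Gt (t0 q0 : R) :=
  nbhs (t0, q0) (fun p : R * R => is_derive p.1 1 (G^~ p.2) (Gt p.1 p.2)).

Lemma near_pair_ball (P : R * R -> Prop) (t0 q0 : R) :
  nbhs (t0, q0) P ->
  exists2 d, 0 < d & forall t q, `|t - t0| < d -> `|q - q0| < d -> P (t, q).
Proof.
move=> /nbhs_ballP[d /= d0 hd]; exists d => // t q ht hq; apply: hd.
by split; rewrite /ball /= distrC.
Qed.

(** The difference quotient of G in its first variable, taken along a curve through
(t0, q0), extends continuously to q0: by the mean value theorem it is a value
of Gt at an intermediate point. *)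
Lemma slope_along_curve G Gt c (t0 q0 : R) :
  derive_near G Gt t0 q0 ->
  {for (t0, q0), continuous (fun p : R * R => Gt p.1 p.2)} ->
  c q0 = t0 -> {for q0, continuous c} ->
  exists s : R -> R, [/\ {for q0, continuous s}, s q0 = Gt t0 q0 &
    \forall q \near q0, G (c q) q - G t0 q = s q * (c q - t0)].
Proof.
move=> hG cGt c0 cc; have [d d0 hd] := near_pair_ball hG.
pose s q := if c q == t0 then Gt t0 q0 else (G (c q) q - G t0 q) / (c q - t0).
have s0 : s q0 = Gt t0 q0 by rewrite /s c0 eqxx.
exists s; split => //.
- apply/cvgrPdist_lt => e e0.
  have /near_pair_ball[d' d'0 hd'] := continuous_dist_lt cGt e0.
  have m0 : 0 < Num.min d d' by rewrite lt_min d0.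
  near=> q; rewrite s0 /s; case: eqVneq => cq; first by rewrite subrr normr0.
  have cqd : `|c q - t0| < Num.min d d'.
    by rewrite -c0 distrC; near: q; exact: (continuous_dist_lt cc m0).
  have qd : `|q - q0| < Num.min d d'.
    rewrite distrC; near: q.
    exact: near_dist_lt.
  move: cqd qd; rewrite !lt_min => /andP[cd cd'] /andP[qd qd'].
  have dv t : `|t - t0| < d -> is_derive t 1 (G^~ q) (Gt t q) by move=> ht; exact: hd ht qd.
  have [xi xid ->] : exists2 xi, `|xi - t0| < d' &
      (G (c q) q - G t0 q) / (c q - t0) = Gt xi q.
    have btw (x y : R) : `|x - t0| < d -> `|y - t0| < d -> forall z, x <= z <= y -> `|z - t0| < d.
      by move=> + + z /andP[]; rewrite !ltr_norml => /andP[? ?] /andP[? ?] ? ?; apply/andP; split; lra.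
    have t0d : `|t0 - t0| < d by rewrite subrr normr0.
    have [lt_c|lt_c|e_] := ltgtP (c q) t0; last by rewrite e_ eqxx in cq.
      have [||x] := @MVT R (G^~ q) (Gt^~ q) _ _ lt_c.
      + by move=> x; rewrite in_itv /= => /andP[x1 x2]; apply/dv/(btw (c q) t0); rewrite ?(ltW x1) ?(ltW x2).
      + apply: within_continuous_cc => x hx; apply: is_derive_continuous.
        by apply/dv/(btw (c q) t0).
      rewrite in_itv /= => /andP[x1 x2] e_; exists x.
        by move: cd'; rewrite !ltr_norml => /andP[? ?]; apply/andP; split; lra.
      apply: (canLR (mulfK _)); first by rewrite subr_eq0.
      by rewrite -opprB e_ -mulrN opprB.
    have [||x] := @MVT R (G^~ q) (Gt^~ q) _ _ lt_c.
    + by move=> x; rewrite in_itv /= => /andP[x1 x2]; apply/dv/(btw t0 (c q)); rewrite ?(ltW x1) ?(ltW x2).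
    + apply: within_continuous_cc => x hx; apply: is_derive_continuous.
      by apply/dv/(btw t0 (c q)).
    rewrite in_itv /= => /andP[x1 x2] e_; exists x.
      by move: cd'; rewrite !ltr_norml => /andP[? ?]; apply/andP; split; lra.
    by rewrite e_ mulfK// subr_eq0.
  exact: (hd' xi q).
- near=> q; rewrite /s; case: eqVneq => [->|h]; first by rewrite !subrr mulr0.
  by rewrite divfK// subr_eq0.
Unshelve. all: by end_near. Qed.

(** The chain rule in a form that asks for joint continuity of the partial
derivative in the first variable only. *)
Lemma is_derive_along_curve G Gt c (t0 q0 c' Gq : R) :
  derive_near G Gt t0 q0 ->
  {for (t0, q0), continuous (fun p : R * R => Gt p.1 p.2)} ->
  c q0 = t0 -> is_derive q0 1 c c' -> is_derive q0 1 (G t0) Gq ->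
  is_derive q0 1 (fun q => G (c q) q) (Gt t0 q0 * c' + Gq).
Proof.
move=> hG cGt c0 dc dG; have cc := is_derive_continuous dc.
have [s [cs s0 hs]] := slope_along_curve hG cGt c0 cc.
have /is_derive1_caratheodory[k [hk ck k0]] := dc.
have /is_derive1_caratheodory[h [hh ch h0]] := dG.
rewrite -s0 -k0 -h0; apply: (@is_derive_slope _ (fun q => s q * k q + h q)); last first.
  by apply: cvgD => //; exact: cvgM.
apply: filterS hs => q hs; rewrite c0.
have -> : G (c q) q - G t0 q0 = (G (c q) q - G t0 q) + (G t0 q - G t0 q0) by ring.
by rewrite hs hh -{1}c0 hk; ring.
Qed.

Lemma is_derive_implicit G Gt c (t0 q0 Gq : R) :
  derive_near G Gt t0 q0 ->
  {for (t0, q0), continuous (fun p : R * R => Gt p.1 p.2)} ->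
  Gt t0 q0 != 0 -> c q0 = t0 -> {for q0, continuous c} ->
  (\forall q \near q0, G (c q) q = 0) -> is_derive q0 1 (G t0) Gq ->
  is_derive q0 1 c (- Gq / Gt t0 q0).
Proof.
move=> hG cGt Gt0 c0 cc hc dG.
have [s [cs s0 hs]] := slope_along_curve hG cGt c0 cc.
have /is_derive1_caratheodory[h [hh ch h0]] := dG.
rewrite -s0 -h0; apply: (@is_derive_slope _ (fun q => - h q / s q)); last first.
  by apply: cvgM; [exact: cvgN|apply: cvgV => //; rewrite s0].
have hc0 : G t0 q0 = 0 by rewrite -{1}c0; exact: (nbhs_singleton hc).
have sn0 : \forall q \near q0, s q != 0.
  by apply: (cvgr_neq0 _ cs); rewrite s0.
near=> q.
have s1 : s q != 0 by near: q.
have e1 : G (c q) q - G t0 q = s q * (c q - t0) by near: q; exact: hs.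
have e2 : G (c q) q = 0 by near: q.
have := hh q; rewrite hc0 subr0 => e3; rewrite e2 sub0r e3 in e1.
rewrite c0; apply: (mulfI s1); rewrite -e1.
by field.
Unshelve. all: by end_near. Qed.

(** Near t0 the sections G(., q) are strictly increasing and change sign, so each
has one zero.  Comparing c q with t is then the same as reading the sign of
G t q, which is the form in which the order of events is used later. *)
Lemma implicit_branch G Gt (t0 q0 : R) :
  derive_near G Gt t0 q0 ->
  {for (t0, q0), continuous (fun p : R * R => Gt p.1 p.2)} ->
  0 < Gt t0 q0 -> G t0 q0 = 0 ->
  (\forall t \near t0, {for q0, continuous (G t)}) ->
  exists c, [/\ c q0 = t0, {for q0, continuous c} &
    nbhs (t0, q0) (fun p : R * R => (0 < G p.1 p.2) = (c p.2 < p.1) /\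
                                    (G p.1 p.2 < 0) = (p.1 < c p.2))].
Proof.
move=> hG cGt Gt0 G0 cG.
have hpos : nbhs (t0, q0) (fun p : R * R => 0 < Gt p.1 p.2) by apply: (cvgr_gt _ cGt).
have [d1 d10 hd1] := near_pair_ball (filterI hG hpos).
have /nbhs_ballP[d2 /= d20 hd2] := cG.
pose d := Num.min d1 d2; have d0 : 0 < d by rewrite lt_min d10.
have hder t q : `|t - t0| < d -> `|q - q0| < d ->
    is_derive t 1 (G^~ q) (Gt t q) /\ 0 < Gt t q.
  by rewrite !lt_min => /andP[h1 _] /andP[h2 _]; exact: hd1.
have hcont t : `|t - t0| < d -> {for q0, continuous (G t)}.
  by rewrite lt_min distrC => /andP[_ h]; exact: hd2.
have mono q : `|q - q0| < d -> forall t u, `|t - t0| < d -> `|u - t0| < d ->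
    t < u -> G t q < G u q.
  move=> hq t u ht hu tu.
  have btw z : t <= z <= u -> `|z - t0| < d.
    move: ht hu; rewrite !ltr_norml => /andP[? ?] /andP[? ?] /andP[? ?].
    by apply/andP; split; lra.
  have [||x] := @MVT R (G^~ q) (Gt^~ q) _ _ tu.
  - by move=> x; rewrite in_itv /= => /andP[x1 x2]; apply: (hder x q _ hq).1; apply: btw; rewrite !ltW.
  - apply: within_continuous_cc => x /btw hx; apply: is_derive_continuous.
    exact: (hder x q hx hq).1.
  rewrite in_itv /= => /andP[x1 x2] e; rewrite -subr_gt0 e mulr_gt0 ?subr_gt0//.
  by apply: (hder x q _ hq).2; apply: btw; rewrite !ltW.
have q0d : `|q0 - q0| < d by rewrite subrr normr0.
have t0d : `|t0 - t0| < d by rewrite subrr normr0.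
have near_sign e : 0 < e < d -> \forall q \near q0, G (t0 - e) q < 0 < G (t0 + e) q.
  move=> /andP[e0 ed].
  have h1 : `|t0 - e - t0| < d by rewrite addrC addKr normrN gtr0_norm.
  have h2 : `|t0 + e - t0| < d by rewrite addrC addKr gtr0_norm.
  have s1 : G (t0 - e) q0 < 0 by rewrite -G0; apply: mono => //; lra.
  have s2 : 0 < G (t0 + e) q0 by rewrite -G0; apply: mono => //; lra.
  by near=> q; apply/andP; split; near: q; [exact: (cvgr_lt _ (hcont _ h1))|exact: (cvgr_gt _ (hcont _ h2))].
pose Q q := `|q - q0| < d /\ exists2 e, 0 < e < d & G (t0 - e) q < 0 < G (t0 + e) q.
have ex q : exists t, Q q -> `|t - t0| < d /\ G t q = 0.
  have [hQ|nQ] := pselect (Q q); last by exists 0.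
  case: (hQ) => hq [e /andP[e0 ed] /andP[g1 g2]].
  have btw z : t0 - e <= z <= t0 + e -> `|z - t0| < d.
    by move=> /andP[? ?]; rewrite ltr_norml; apply/andP; split; lra.
  have le_ : t0 - e <= t0 + e by lra.
  have [||t] := @IVT R (G^~ q) (t0 - e) (t0 + e) 0 le_.
  - by apply: within_continuous_cc => x /btw hx; apply: is_derive_continuous; exact: (hder x q hx hq).1.
  - by rewrite ge_min (ltW g1) /= le_max (ltW g2) orbT.
  by rewrite in_itv /= => /btw h1 h2; exists t.
have [c hc] := choice ex.
have sgn q : Q q -> forall t, `|t - t0| < d ->
    (0 < G t q) = (c q < t) /\ (G t q < 0) = (t < c q).
  move=> hQ t ht; have [hcd hc0] := hc q hQ; have hq := hQ.1.
  have [h|h|->] := ltgtP t (c q).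
  - by have := mono q hq _ _ ht hcd h; rewrite hc0 => h'; rewrite h' ltNge ltW.
  - by have := mono q hq _ _ hcd ht h; rewrite hc0 => h'; rewrite h' ltNge ltW.
  - by rewrite hc0 ltxx.
have Qn : \forall q \near q0, Q q.
  have hd2' : 0 < d / 2 < d by lra.
  near=> q; split; last by exists (d / 2) => //; near: q; exact: near_sign.
  by rewrite distrC; near: q; exact: near_dist_lt.
have Qq0 := nbhs_singleton Qn.
have c0 : c q0 = t0.
  have [h1 h2] := sgn q0 Qq0 t0 t0d; rewrite G0 ltxx in h1 h2.
  by apply/eqP; rewrite eq_le !leNgt -h1 -h2.
exists c; split => //.
  apply/cvgrPdist_lt => e e0; rewrite c0.
  pose e' := Num.min e d / 2.
  have m0 : 0 < Num.min e d by rewrite lt_min e0.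
  have m1 : Num.min e d <= e by rewrite ge_min lexx.
  have m2 : Num.min e d <= d by rewrite ge_min lexx orbT.
  have he' : 0 < e' < d by rewrite /e'; lra.
  near=> q.
  have hQ : Q q by near: q.
  have /andP[h1 h2] : G (t0 - e') q < 0 < G (t0 + e') q by near: q; exact: near_sign.
  case/andP: (he') => e1 e2.
  have k1 : `|t0 - e' - t0| < d by rewrite addrC addKr normrN gtr0_norm.
  have k2 : `|t0 + e' - t0| < d by rewrite addrC addKr gtr0_norm.
  have [_ l1] := sgn q hQ _ k1; have [l2 _] := sgn q hQ _ k2.
  rewrite h1 in l1; rewrite h2 in l2.
  by rewrite /e' in l1 l2; rewrite ltr_norml; apply/andP; split; lra.
exists (ball t0 d, Q) => /=; first by split => //; apply: nbhsx_ballx.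
by move=> [t q] /= [ht hQ]; apply: sgn => //; rewrite distrC.
Unshelve. all: by end_near. Qed.

End TwoVariables.

Section UniformOnCompact.
Context {R : realType}.

(** Compactness turns a property that holds locally in time into one that holds for
all times at once. *)
Lemma near_itv (I : Type) (F : set_system I) {FF : Filter F} (a b : R)
    (P : I -> R -> Prop) :
  (forall t, a <= t <= b -> \forall s \near t & i \near F, P i s) ->
  \forall i \near F, forall t, a <= t <= b -> P i t.
Proof.
move=> h; have /compact_near_coveringP hc := @segment_compact R a b.
have hF : forall x, `[a, b]%classic x -> \forall x' \near x & i \near F, P i x'.
  by move=> t; rewrite /= in_itv /=; exact: h.
by apply: filterS (hc I F P FF hF) => i hi t ht; apply: hi; rewrite /= in_itv.
Qed.

Lemma uniform_cvg_itv (V : topologicalType) (h : R -> V -> R) (v0 : V) (a b e : R) :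
  (forall t, a <= t <= b -> {for (t, v0), continuous (fun p : R * V => h p.1 p.2)}) ->
  0 < e -> \forall v \near v0, forall t, a <= t <= b -> `|h t v - h t v0| < e.
Proof.
move=> ch e0; apply: near_itv => t ht.
have e2 : 0 < e / 2 by rewrite divr_gt0.
have [[A B] /= [tA vB] hAB] := continuous_dist_lt (ch t ht) e2.
exists (A, B) => //= -[s v] /= [As Bv].
have h1 := hAB (s, v) (conj As Bv).
have h2 := hAB (s, v0) (conj As (nbhs_singleton vB)).
rewrite /= in h1 h2.
have -> : h s v - h s v0 = - (h t v0 - h s v) + (h t v0 - h s v0) by ring.
apply: le_lt_trans (ler_normD _ _) _; rewrite normrN; lra.
Qed.

End UniformOnCompact.

(** * The flow at one parameter value *)

(** Cutting F off is preferred to multiplying by the positive part, since the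
same cut applied to F_I gives the derivative of the cut field off the curve. *)
Definition cut {R : realType} (a x k : R) : R := if a < x then k else 0.

(** What is used of one parameter value.  The quarter in K_short makes both the
Picard map a contraction and J close to 1; the margin r >= 3 rho keeps
trajectories starting below rho inside the box; phi_left and phi_right put the
curve above every trajectory at both ends. *)
Record scalar_box {R : realType} (phi dphi : R -> R) (F Fx Fxx : R -> R -> R)
    (T r K K2 rho : R) (nu : nat) : Prop := ScalarBox {
  T_gt0 : 0 < T;
  K_ge0 : 0 <= K;
  K_short : K * (T - - T) <= 4^-1;
  rho_gt0 : 0 < rho;
  rho_r : 3 * rho <= r;
  phi_der : forall t : R, - T <= t <= T -> is_derive t 1 phi (dphi t);
  dphi_cont : forall t : R, - T <= t <= T -> {for t, continuous dphi};
  phi_left : r <= phi (- T);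
  phi_right : r <= phi T;
  phi_low : forall t : R, - T <= t <= T -> - rho <= phi t;
  crit_few : at_most nu.-1 [set t : R | - T <= t <= T /\ dphi t = 0];
  F_phi : forall t, F t (phi t) = 0;
  F_der : forall t x : R, - T <= t <= T -> `|x| <= r -> is_derive x 1 (F t) (Fx t x);
  Fx_der : forall t x : R, - T <= t <= T -> `|x| <= r -> is_derive x 1 (Fx t) (Fxx t x);
  Fx_le : forall t x : R, - T <= t <= T -> `|x| <= r -> `|Fx t x| <= K;
  Fxx_le : forall t x : R, - T <= t <= T -> `|x| <= r -> `|Fxx t x| <= K2;
  F_cont : forall t x : R, - T <= t <= T -> `|x| <= r ->
    {for (t, x), continuous (fun p : R * R => F p.1 p.2)};
  Fx_cont : forall t x : R, - T <= t <= T -> `|x| <= r ->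
    {for (t, x), continuous (fun p : R * R => Fx p.1 p.2)};
  Fxx_cont : forall t x : R, - T <= t <= T -> `|x| <= r ->
    {for (t, x), continuous (fun p : R * R => Fxx p.1 p.2)} }.

Section CutField.
Context {R : realType}.
Variables (phi dphi : R -> R) (F Fx Fxx : R -> R -> R) (T r K K2 rho : R) (nu : nat).
Hypothesis box : scalar_box phi dphi F Fx Fxx T r K K2 rho nu.
Implicit Types (t s q x : R).

Definition cut_field t x := cut (phi t) x (F t x).
Local Notation f := cut_field.

Lemma box_facts : [/\ 0 < T, 0 <= K, K * (T - - T) <= 4^-1, 0 < rho & 3 * rho <= r].
Proof. by case: box. Qed.

Lemma Fxx_bound_ge0 : 0 <= K2.
Proof.
have [T0 _ _ rho0 rr] := box_facts.
apply: le_trans (Fxx_le box (t := 0) (x := 0) _ _) => //; last by rewrite normr0; lra.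
by apply/andP; split; lra.
Qed.

Lemma phi_cont t : - T <= t <= T -> {for t, continuous phi}.
Proof. by move=> /(phi_der box) h; exact: is_derive_continuous h. Qed.

(** F vanishes on the curve, so if the curve separates x and y the value at the
lower point may be replaced by the value 0 of F on the curve. *)
Lemma cut_field_lipschitz t x y : - T <= t <= T -> `|x| <= r -> `|y| <= r ->
  `|f t x - f t y| <= K * `|x - y|.
Proof.
move=> ht; wlog yx : x y / y <= x.
  move=> hw hx hy; have [yx|/ltW xy] := leP y x; first exact: hw.
  by rewrite distrC (distrC x); exact: hw.
move=> hx hy.
have inb z : y <= z <= x -> `|z| <= r.
  move=> /andP[? ?]; move: hx hy; rewrite !ler_norml => /andP[? ?] /andP[? ?].
  by apply/andP; split; lra.
have lipF u v : y <= u -> u <= v -> v <= x -> `|F t v - F t u| <= K * `|v - u|.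
  move=> yu uv vx.
  apply: (@ler_dist_mvt _ (F t) (Fx t) y x K).
  - by apply: within_continuous_cc => z hz; apply: is_derive_continuous; exact: F_der box _ _ ht (inb z hz).
  - by move=> z /andP[z1 z2]; apply: (F_der box ht); apply: inb; rewrite !ltW.
  - by move=> z /andP[z1 z2]; apply: (Fx_le box ht); apply: inb; rewrite !ltW.
  - by rewrite (le_trans yu uv).
  - by rewrite yu (le_trans uv).
have [_ K0 _ _ _] := box_facts.
rewrite /f /cut; case: ltP => hxp; case: ltP => hyp.
- exact: lipF.
- rewrite subr0 -[F t x]subr0 -(F_phi box t).
  apply: le_trans (lipF _ _ hyp (ltW hxp) (lexx _)) _; apply: ler_wpM2l => //.
  by rewrite !ger0_norm; lra.
- by move: (lt_le_trans hyp yx); rewrite ltNge hxp.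
- by rewrite subr0 normr0 mulr_ge0.
Qed.

(** The cut field vanishes at the level - rho, which lies below the curve at all
times. *)
Lemma cut_field_growth t x : - T <= t <= T -> `|x| <= r ->
  `|f t x| <= K * `|x| + K * rho.
Proof.
move=> ht hx; have [_ K0 _ rho0 rr] := box_facts.
have f0 : f t (- rho) = 0 by rewrite /f /cut ltNge (phi_low box ht).
have hr : `|- rho| <= r by rewrite normrN gtr0_norm//; lra.
rewrite -[f t x]subr0 -f0; apply: le_trans (cut_field_lipschitz ht hx hr) _.
rewrite opprK -mulrDr; apply: ler_wpM2l => //; apply: le_trans (ler_normD _ _) _.
by rewrite (gtr0_norm rho0).
Qed.

Lemma cut_field_cont t x : - T <= t <= T -> `|x| <= r ->
  {for (t, x), continuous (fun p : R * R => f p.1 p.2)}.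
Proof.
move=> ht hx; have cF := F_cont box ht hx.
have cp : (phi p.1) @[p --> (t, x)] --> phi t.
  apply: (@continuous_cvg _ _ _ (nbhs (t, x)) _ (fun p : R * R => p.1) phi t).
    exact: phi_cont.
  exact: cvg_fst.
have cx : p.2 @[p --> ((t, x) : R * R)] --> x by exact: cvg_snd.
have cd : (phi p.1 - p.2) @[p --> (t, x)] --> phi t - x by apply: cvgB.
have [lt_|gt_|e_] := ltgtP (phi t) x.
- rewrite /prop_for /continuous_at {2}/f /cut /= lt_.
  have n1 : nbhs (t, x) (fun p : R * R => phi p.1 - p.2 < 0).
    by have := @cvgr_lt _ _ _ _ _ _ cd 0; rewrite subr_lt0; exact.
  apply: cvg_trans cF; apply: near_eq_cvg; apply: filterS n1 => p.
  by rewrite subr_lt0 /f /cut => ->.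
- rewrite /prop_for /continuous_at {2}/f /cut /= ltNge (ltW gt_) /=.
  have n1 : nbhs (t, x) (fun p : R * R => 0 < phi p.1 - p.2).
    by have := @cvgr_gt _ _ _ _ _ _ cd 0; rewrite subr_gt0; exact.
  have c0 : (fun=> 0 : R) p @[p --> ((t, x) : R * R)] --> (0 : R) by exact: cvg_cst.
  apply: cvg_trans c0; apply: near_eq_cvg; apply: filterS n1 => p.
  by rewrite subr_gt0 /f /cut => h; rewrite ltNge (ltW h).
- rewrite /prop_for /continuous_at {2}/f /cut /= e_ ltxx.
  have F0 : F t x = 0 by rewrite -e_ (F_phi box).
  apply/cvgrPdist_lt => e e0; rewrite /prop_for /continuous_at F0 in cF.
  move/cvgrPdist_lt: cF => /(_ e e0); apply: filterS => p.
  by rewrite !sub0r !normrN /f /cut; case: ifP => // _; rewrite normr0.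
Qed.

Lemma cut_field_is_derive t x : - T <= t <= T -> `|x| <= r -> phi t != x ->
  is_derive x 1 (f t) (cut (phi t) x (Fx t x)).
Proof.
move=> ht hx; rewrite neq_lt /cut => /orP[lt_|gt_].
  rewrite lt_; apply: near_eq_is_derive (F_der box ht hx).
  by near=> z; rewrite /f /cut ifT//; near: z; exact: lt_nbhsr.
rewrite ltNge (ltW gt_) /=; apply: (@near_eq_is_derive _ _ _ (cst 0)).
by near=> z; rewrite /f /cut ifF//; apply/negbTE; rewrite -leNgt; apply: ltW; near: z; exact: lt_nbhsl.
Unshelve. all: by end_near. Qed.

(** Continuity in time is asked on the whole line and the initial value for every
q, which costs nothing since the solutions come from a field with clamped
state; only the equation and the bound are restricted to |q| < rho. *)
Record flow (I : R -> R -> R) : Prop := Flow {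
  flow_cont : forall q t, {for t, continuous (I^~ q)};
  flow_init : forall q, I (- T) q = q;
  flow_der : forall q t, `|q| < rho -> - T < t < T ->
    is_derive t 1 (I^~ q) (f t (I t q));
  flow_bound : forall q t, `|q| < rho -> - T <= t <= T -> `|I t q| <= 2 * `|q| + rho }.

(** Clamping the state to [- r, r] makes the field globally Lipschitz.  The growth
bound then shows that a trajectory starting below rho never reaches the clamp. *)
Lemma flow_exists : exists I, flow I.
Proof.
have [T0 K0 KT rho0 rr] := box_facts.
have TT : - T <= T by lra.
have r0 : 0 < r by lra.
pose psi t x := f t (clamp (- r) r x).
have cin x : `|clamp (- r) r x| <= r.
  by rewrite ler_norml; apply: clamp_itv; lra.
have cle x : `|clamp (- r) r x| <= `|x|.
  have -> : `|x| = `|x - 0| by rewrite subr0.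
  rewrite -[clamp _ _ x]subr0 -{1}(@clamp_id R (- r) r 0); first exact: clamp_lipschitz.
  by apply/andP; split; lra.
have ex q : exists y, [/\ (forall t, {for t, continuous y}), y (- T) = q &
    forall t, - T < t < T -> is_derive t 1 y (psi t (y t))].
  apply: (@picard_lindelof _ _ _ K (K * r + K * rho)) => //.
  - by apply: le_trans KT _; lra.
  - move=> t x ht; apply: (@continuous2_cvg _ _ _ _ _ _ (fun p : R * R => p.1)
      (fun p => clamp (- r) r p.2) f t (clamp (- r) r x)).
    + exact: (cut_field_cont ht (cin x)).
    + exact: cvg_fst.
    + apply: (@continuous_cvg _ _ _ (nbhs (t, x)) _ snd (clamp (- r) r) x).
        by apply: (@lipschitz_continuous _ _ 1) => // u v; rewrite mul1r; exact: clamp_lipschitz.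
      exact: cvg_snd.
  - move=> t x ht; apply: le_trans (cut_field_growth ht (cin x)) _.
    by rewrite lerD2r ler_wpM2l.
  - move=> t x x' ht; apply: le_trans (cut_field_lipschitz ht (cin x) (cin x')) _.
    by rewrite ler_wpM2l// clamp_lipschitz.
have [I hI] := choice ex.
have bd q t : - T <= t <= T -> `|I q t| <= 2 * `|q| + rho.
  move=> ht; have [cy y0 dy] := hI q.
  have hT : - T <= - T <= T by rewrite lexx.
  have Kr0 : 0 <= K * rho by rewrite mulr_ge0// ltW.
  have := @gronwall_short _ (I q) (fun t => psi t (I q t)) (- T) T K (K * rho) TT K0 Kr0 _ _ dy _ (- T) t hT ht.
  rewrite y0 => h; apply: le_trans (h _ _ _) _.
  - by apply: le_trans KT _; lra.
  - by apply: within_continuous_cc.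
  - move=> s /andP[s1 s2]; apply: le_trans (cut_field_growth _ (cin _)) _; first by rewrite !ltW.
    by rewrite lerD2r ler_wpM2l.
  - rewrite lerD2l.
    have -> : 2 * (K * rho) * (T - - T) = K * (T - - T) * (2 * rho) by ring.
    apply: (@le_trans _ _ (4^-1 * (2 * rho))); first by rewrite ler_wpM2r//; lra.
    lra.
exists (fun t q => I q t); split => [q t|q|q t hq ht|q t hq ht].
- by have [] := hI q.
- by have [] := hI q.
- have [_ _ /(_ t ht)] := hI q; rewrite /psi clamp_id//.
  rewrite -ler_norml; apply: le_trans (bd q t _) _; first by case/andP: ht => *; rewrite !ltW.
  lra.
- exact: bd.
Qed.

Section Flow.
Variable I : R -> R -> R.
Hypothesis hI : flow I.

Lemma flow_lt q t : `|q| < rho -> - T <= t <= T -> `|I t q| < r.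
Proof.
move=> hq ht; have [_ _ _ rho0 rr] := box_facts.
by apply: le_lt_trans (flow_bound hI hq ht) _; lra.
Qed.

Lemma flow_le q t : `|q| < rho -> - T <= t <= T -> `|I t q| <= r.
Proof. by move=> hq ht; rewrite ltW// flow_lt. Qed.

Definition solution q (y : R -> R) :=
  [/\ {within `[- T, T], continuous y}, y (- T) = q,
      (forall t, - T <= t <= T -> `|y t| < r) &
      (forall t, - T < t < T -> is_derive t 1 y (f t (y t)))].

Lemma flow_solution q : `|q| < rho -> solution q (I^~ q).
Proof.
move=> hq; split.
- by apply: within_continuous_cc => t _; exact: flow_cont.
- exact: flow_init.
- by move=> t; exact: flow_lt.
- by move=> t; exact: flow_der.
Qed.

(** The comparison may be based at any time t0, so solutions that meet once
coincide at all times, earlier ones included. *)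
Lemma solution_close q1 q2 y1 y2 t0 t : solution q1 y1 -> solution q2 y2 ->
  - T <= t0 <= T -> - T <= t <= T -> `|y1 t - y2 t| <= 2 * `|y1 t0 - y2 t0|.
Proof.
move=> [c1 _ b1 d1] [c2 _ b2 d2] ht0 ht; have [T0 K0 KT rho0 rr] := box_facts.
have TT : - T <= T by lra.
have := @gronwall_short _ (fun t => y1 t - y2 t) (fun t => f t (y1 t) - f t (y2 t))
  (- T) T K 0 TT K0 (lexx 0) _ _ _ _ t0 t ht0 ht.
rewrite mulr0 mul0r addr0; apply.
- by apply: le_trans KT _; lra.
- by move=> s; apply: cvgB; [exact: c1|exact: c2].
- by move=> s hs; apply: is_deriveB; [exact: d1|exact: d2].
- move=> s /andP[s1 s2]; rewrite addr0; have hs : - T <= s <= T by rewrite !ltW.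
  by apply: cut_field_lipschitz => //; apply: ltW; [exact: b1|exact: b2].
Qed.

Lemma solution_unique q y t : `|q| < rho -> solution q y -> - T <= t <= T -> y t = I t q.
Proof.
move=> hq hy ht; have [T0 _ _ _ _] := box_facts.
have h0 : - T <= - T <= T by rewrite lexx; lra.
have := solution_close hy (flow_solution hq) h0 ht.
have [_ -> _ _] := hy; rewrite (flow_init hI) subrr normr0 mulr0 normr_le0 subr_eq0.
by move/eqP.
Qed.

Lemma flow_lipschitz q1 q2 t : `|q1| < rho -> `|q2| < rho -> - T <= t <= T ->
  `|I t q1 - I t q2| <= 2 * `|q1 - q2|.
Proof.
move=> h1 h2 ht; have [T0 _ _ _ _] := box_facts.
have h0 : - T <= - T <= T by rewrite lexx; lra.
by have := solution_close (flow_solution h1) (flow_solution h2) h0 ht; rewrite !(flow_init hI).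
Qed.

Lemma flow_neq q1 q2 t : `|q1| < rho -> `|q2| < rho -> - T <= t <= T ->
  q1 != q2 -> I t q1 != I t q2.
Proof.
move=> h1 h2 ht; apply: contraNneq => e; have [T0 _ _ _ _] := box_facts.
have h0 : - T <= - T <= T by rewrite lexx; lra.
have := solution_close (flow_solution h1) (flow_solution h2) ht h0.
by rewrite !(flow_init hI) e subrr normr0 mulr0 normr_le0 subr_eq0.
Qed.

(** The constant q solves the equation as long as it stays below the curve. *)
Lemma flow_inactive q : `|q| < rho -> (forall t, - T <= t <= T -> q <= phi t) ->
  forall t, - T <= t <= T -> I t q = q.
Proof.
move=> hq hphi t ht; have [_ _ _ rho0 rr] := box_facts.
rewrite -(@solution_unique q (cst q))//; split => //.
- by apply: within_continuous_cc => s _; exact: cvg_cst.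
- by move=> s _; rewrite /cst; lra.
- move=> s /andP[s1 s2]; rewrite /f /cut /cst ltNge hphi ?ltW//=.
  exact: is_derive_cst.
Qed.

Lemma near_level q : `|q| < rho -> \forall q' \near q, `|q'| < rho.
Proof.
move=> hq; have e0 : 0 < rho - `|q| by rewrite subr_gt0.
apply: filterS (near_dist_lt q e0) => q'; rewrite distrC => h.
by rewrite -(subrK q q'); apply: le_lt_trans (ler_normD _ _) _; lra.
Qed.

Lemma flow_cont_level q t : `|q| < rho -> - T <= t <= T -> {for q, continuous (I t)}.
Proof.
move=> hq ht; apply/cvgrPdist_lt => e e0.
have e2 : 0 < e / 2 by rewrite divr_gt0.
near=> q'; have hq' : `|q'| < rho by near: q'; exact: near_level.
apply: le_lt_trans (flow_lipschitz hq hq' ht) _.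
have : `|q - q'| < e / 2 by near: q'; exact: near_dist_lt.
lra.
Unshelve. all: by end_near. Qed.

(** Continuity in time at fixed q, together with the Lipschitz constant in q that is
uniform in time. *)
Lemma flow_cont2 q t : `|q| < rho -> - T < t < T ->
  {for (t, q), continuous (fun p : R * R => I p.1 p.2)}.
Proof.
move=> hq /andP[t1 t2]; apply/cvgrPdist_lt => e e0.
have e4 : 0 < e / 4 by rewrite divr_gt0.
have [d d0 hd] : exists2 d, 0 < d & forall s, `|t - s| < d -> `|I t q - I s q| < e / 4.
  have /nbhs_ballP[d d0 hd] := continuous_dist_lt (@flow_cont _ hI q t) e4.
  by exists d.
have d'0 : 0 < Num.min d (Num.min (T - t) (t + T)) by rewrite !lt_min d0; apply/andP; split => //; apply/andP; split; lra.
exists (ball t (Num.min d (Num.min (T - t) (t + T))), [set q' | `|q'| < rho /\ `|q - q'| < e / 4]).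
  split; first exact: nbhsx_ballx.
  by apply: filterI; [exact: near_level|exact: near_dist_lt].
move=> [s q'] /= [hs [hq' hqq]]; move: hs; rewrite /ball /= !lt_min => /and3P[s1 s2 s3].
have hs : - T <= s <= T.
  by move: s2 s3; rewrite !ltr_norml => /andP[? ?] /andP[? ?]; apply/andP; split; lra.
have -> : I t q - I s q' = (I t q - I s q) + (I s q - I s q') by ring.
apply: le_lt_trans (ler_normD _ _) _.
have := hd s s1; have := flow_lipschitz hq hq' hs; lra.
Qed.

End Flow.
End CutField.

(** * Contacts of a trajectory with the threshold curve *)

Section OneSided.
Context {R : realType}.
Implicit Types (g : R -> R) (x l : R).

Lemma negative_slope_sides g x l : is_derive x 1 g l -> l < 0 ->
  (\forall z \near x^'-, g x < g z) /\ (\forall z \near x^'+, g z < g x).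
Proof.
move=> /is_derive1_caratheodory[k [hk ck <-]] k0.
have kn : \forall z \near x, k z < 0 by exact: continuous_lt.
split; near=> z; rewrite -subr_lt0.
- rewrite -opprB oppr_lt0 hk nmulr_rgt0 ?subr_lt0; first by near: z; exact: nbhs_left_lt.
  by near: z; exact: cvg_at_left_filter kn.
- rewrite hk nmulr_rlt0 ?subr_gt0; first by near: z; exact: nbhs_right_gt.
  by near: z; exact: cvg_at_right_filter kn.
Unshelve. all: by end_near. Qed.

Lemma positive_slope_sides g x l : is_derive x 1 g l -> 0 < l ->
  (\forall z \near x^'-, g z < g x) /\ (\forall z \near x^'+, g x < g z).
Proof.
move=> dg l0; have [|h1 h2] := negative_slope_sides (is_deriveN dg); first by rewrite oppr_lt0.
by split; [apply: filterS h1|apply: filterS h2] => z; rewrite ltrN2.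
Qed.

End OneSided.

Section Contacts.
Context {R : realType}.
Variables (phi dphi : R -> R) (F Fx Fxx : R -> R -> R) (T r K K2 rho : R) (nu : nat).
Hypothesis box : scalar_box phi dphi F Fx Fxx T r K K2 rho nu.
Variable I : R -> R -> R.
Hypothesis hI : flow phi F T rho I.
Implicit Types (t s q x c : R).

Definition contact q := [set t : R | - T <= t <= T /\ I t q = phi t].
Definition gap q t := I t q - phi t.

Lemma gap_ends q : `|q| < rho -> gap q (- T) < 0 /\ gap q T < 0.
Proof.
move=> hq; have [T0 _ _ _ _] := box_facts box; rewrite /gap !subr_lt0; split.
- apply: lt_le_trans (phi_left box); apply: le_lt_trans (ler_norm _) _.
  by apply: (flow_lt box hI hq); lra.
- apply: lt_le_trans (phi_right box); apply: le_lt_trans (ler_norm _) _.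
  by apply: (flow_lt box hI hq); lra.
Qed.

Lemma contact_interior q c : `|q| < rho -> contact q c -> - T < c < T.
Proof.
move=> /gap_ends[g1 g2] [/andP[c1 c2] e].
have g0 : gap q c = 0 by rewrite /gap e subrr.
rewrite !lt_neqAle c1 c2 !andbT; apply/andP; split.
- by apply/eqP => e'; move: g1; rewrite e' g0 ltxx.
- by apply/eqP => e'; move: g2; rewrite -e' g0 ltxx.
Qed.

Lemma gap_cont q t : - T <= t <= T -> {for t, continuous (gap q)}.
Proof. by move=> ht; apply: cvgB; [exact: (flow_cont hI)|exact: (phi_cont box ht)]. Qed.

Lemma gap_is_derive q t : `|q| < rho -> - T < t < T ->
  is_derive t 1 (gap q) (cut_field phi F t (I t q) - dphi t).
Proof.
move=> hq /[dup] ht /andP[t1 t2]; apply: is_deriveB; first exact: (flow_der hI).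
by apply: (phi_der box); rewrite !ltW.
Qed.

(** The cut field vanishes at a contact, so only the slope of the curve is left. *)
Lemma gap_is_derive_contact q c : `|q| < rho -> contact q c ->
  is_derive c 1 (gap q) (- dphi c).
Proof.
move=> hq /[dup] hc [_ e]; have := gap_is_derive hq (contact_interior hq hc).
by rewrite /cut_field /cut e ltxx sub0r.
Qed.

Lemma contact_up q c : `|q| < rho -> contact q c -> dphi c < 0 -> up_crossing (gap q) c.
Proof.
move=> hq hc dc; have g0 : gap q c = 0 by case: hc => _ e; rewrite /gap e subrr.
have [|h1 h2] := positive_slope_sides (gap_is_derive_contact hq hc); first by rewrite oppr_gt0.
by rewrite g0 in h1 h2; split.
Qed.

Lemma contact_down q c : `|q| < rho -> contact q c -> 0 < dphi c -> down_crossing (gap q) c.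
Proof.
move=> hq hc dc; have g0 : gap q c = 0 by case: hc => _ e; rewrite /gap e subrr.
have [|h1 h2] := negative_slope_sides (gap_is_derive_contact hq hc); first by rewrite oppr_lt0.
by rewrite g0 in h1 h2; split.
Qed.

Lemma no_up_and_down (g : R -> R) c : up_crossing g c -> down_crossing g c -> False.
Proof.
move=> [_ h1 _] [_ h2 _].
have : \forall x \near c^'-, False.
  near=> x; have : g x < 0 by near: x. have : 0 < g x by near: x.
  by move=> /lt_trans h /h; rewrite ltxx.
by move/filter_ex => [].
Unshelve. all: by end_near. Qed.

(** If the gap is negative somewhere between the two contacts it has an interior
minimum there; the trajectory is inactive at that time, so its velocity is zero
and that of the curve must vanish too.  Otherwise the curve descends at
the first contact and ascends at the second one, and its derivative has a zero
by the intermediate value theorem. *)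
Lemma critical_between q t1 t2 : `|q| < rho ->
  contact q t1 -> dphi t1 != 0 -> contact q t2 -> dphi t2 != 0 -> t1 < t2 ->
  exists2 z, t1 < z < t2 & - T <= z <= T /\ dphi z = 0.
Proof.
move=> hq c1 d1 c2 d2 t12.
have /andP[i1 _] := contact_interior hq c1; have /andP[_ i2] := contact_interior hq c2.
have inT z : t1 <= z <= t2 -> - T <= z <= T.
  by move=> /andP[z1 z2]; rewrite (le_trans (ltW i1) z1) (le_trans z2 (ltW i2)).
have inT' z : t1 <= z <= t2 -> - T < z < T.
  by move=> /andP[z1 z2]; rewrite (lt_le_trans i1 z1) (le_lt_trans z2 i2).
have g1 : gap q t1 = 0 by case: c1 => _ e; rewrite /gap e subrr.
have g2 : gap q t2 = 0 by case: c2 => _ e; rewrite /gap e subrr.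
have negative_min : (exists2 z, t1 < z < t2 & gap q z < 0) ->
    exists2 z, t1 < z < t2 & - T <= z <= T /\ dphi z = 0.
  move=> [z /andP[z1 z2] gz].
  have cg : {within `[t1, t2], continuous (gap q)}.
    by apply: within_continuous_cc => s /inT; exact: gap_cont.
  have [m] := EVT_min (ltW t12) cg; rewrite in_itv /= => hm minm.
  have gm : gap q m < 0 by apply: le_lt_trans gz; apply: minm; rewrite in_itv /= !ltW.
  have /andP[m1 m2] : t1 < m < t2.
    case/andP: hm => h1 h2; rewrite !lt_neqAle h1 h2 !andbT; apply/andP; split; apply/eqP => e.
    - by move: gm; rewrite -e g1 ltxx.
    - by move: gm; rewrite e g2 ltxx.
  have dm := gap_is_derive hq (inT' m hm).
  have dm0 : is_derive m 1 (gap q) 0.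
    apply: (@derive1_at_min _ _ t1 t2) => //; first exact: ltW.
    - move=> s; rewrite in_itv /= => /andP[s1 s2].
      have [] // := @gap_is_derive q s hq _.
      by apply: inT'; rewrite !ltW.
    - by rewrite in_itv /= m1 m2.
    - by move=> s; rewrite in_itv /= => /andP[s1 s2]; apply: minm; rewrite in_itv /= !ltW.
  exists m; first by rewrite m1 m2.
  split; first exact: inT.
  have := @derive_val _ _ _ _ _ _ _ dm; rewrite (@derive_val _ _ _ _ _ _ _ dm0).
  have -> : cut_field phi F m (I m q) = 0.
    by rewrite /cut_field /cut ltNge ltW// -subr_lt0.
  by rewrite sub0r => /esym/eqP; rewrite oppr_eq0 => /eqP.
have lt12 : \forall z \near t1^'+, t1 < z < t2.
  by near=> z; apply/andP; split; near: z; [exact: nbhs_right_gt|exact: nbhs_right_lt].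
have lt21 : \forall z \near t2^'-, t1 < z < t2.
  by near=> z; apply/andP; split; near: z; [exact: nbhs_left_gt|exact: nbhs_left_lt].
have [d1p|d1n] : 0 < dphi t1 \/ dphi t1 < 0 by move: d1; rewrite neq_lt => /orP[]; [right|left].
  have [_ _ h] := contact_down hq c1 d1p.
  have [z [h1 h2]] := @filter_ex _ (t1^'+) _ _ (filterI lt12 h).
  by apply: negative_min; exists z.
have [d2p|d2n] : 0 < dphi t2 \/ dphi t2 < 0 by move: d2; rewrite neq_lt => /orP[]; [right|left].
  have [||z] := @IVT R dphi t1 t2 0 (ltW t12) _ _.
  - by apply: within_continuous_cc => s /inT; exact: (dphi_cont box).
  - by rewrite ge_min (ltW d1n) /= le_max (ltW d2p) orbT.
  rewrite in_itv /= => hz dz; exists z; last by split => //; exact: inT.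
  case/andP: hz => h1 h2; rewrite !lt_neqAle h1 h2 !andbT; apply/andP; split; apply/eqP => e.
  - by move: d1; rewrite e dz eqxx.
  - by move: d2; rewrite -e dz eqxx.
have [_ h _] := contact_up hq c2 d2n.
have [z [h1 h2]] := @filter_ex _ (t2^'-) _ _ (filterI lt21 h).
by apply: negative_min; exists z.
Unshelve. all: by end_near. Qed.

(** Critical times interlace the regular contacts, and there are at most nu - 1 of
them. *)
Lemma regular_contacts_few q : (0 < nu)%N -> `|q| < rho ->
  at_most nu [set t | contact q t /\ dphi t != 0].
Proof.
move=> nu0 hq; rewrite -(prednK nu0); apply: at_most_interlace (crit_few box) _.
by move=> x y [cx dx] [cy dy]; move=> xy; exact: (critical_between hq cx dx cy dy xy).
Qed.

(** A contact is either regular or a critical time of the curve. *)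
Lemma contact_finite q : (0 < nu)%N -> `|q| < rho -> finite_set (contact q).
Proof.
move=> nu0 hq.
apply: (@sub_finite_set _ _ ([set t | contact q t /\ dphi t != 0] `|`
   [set t : R | - T <= t <= T /\ dphi t = 0])).
  by move=> t ct; have [e|e] := eqVneq (dphi t) 0; [right; split => //; case: ct|left].
rewrite finite_setU; split; first exact: at_most_finite (regular_contacts_few nu0 hq).
exact: at_most_finite (crit_few box).
Qed.

Definition regular q := forall c, contact q c -> dphi c != 0.

(** Ends of arcs are recorded both through the sign of the slope of the curve,
which is what the derivative formulas use, and through the exact description of
the contacts and of the active times, which is what the integrals use. *)
Record active_arcs q N (A B : 'I_N -> R) : Prop := ActiveArcs {
  arcs_lt : forall k, A k < B k;
  arcs_sep : forall k l : 'I_N, (k < l)%N -> B k < A l;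
  arcs_in : forall k, - T < A k /\ B k < T;
  arcs_contact : forall t, - T <= t <= T ->
    (I t q = phi t <-> exists k, t = A k \/ t = B k);
  arcs_active : forall t, - T <= t <= T ->
    (phi t < I t q <-> exists k, A k < t < B k);
  arcs_entry : forall k, dphi (A k) < 0;
  arcs_exit : forall k, 0 < dphi (B k) }.

(** At a regular level every contact is a transverse crossing of the gap, and the
gap is negative at both ends, so crossings pair up. *)
Lemma active_arcs_exist q : (0 < nu)%N -> `|q| < rho -> regular q ->
  exists N (A B : 'I_N -> R), active_arcs q A B /\ (N.*2 <= nu)%N.
Proof.
move=> nu0 hq hreg; have [T0 _ _ _ _] := box_facts box.
have TT : - T < T by lra.
have am : at_most nu (contact q).
  by move=> s ss hs; apply: (regular_contacts_few nu0 hq) => // x /hs cx; split => //; exact: hreg.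
have [s [ss sn hs]] := at_most_enum am.
have [g1 g2] := gap_ends hq.
have contactE t : contact q t <-> - T <= t <= T /\ gap q t = 0.
  by split => -[h e]; split => //; [rewrite /gap e subrr|apply/eqP; rewrite -subr_eq0; apply/eqP].
have cross t : contact q t -> up_crossing (gap q) t \/ down_crossing (gap q) t.
  move=> ct; move: (hreg t ct); rewrite neq_lt => /orP[d|d].
    by left; exact: contact_up.
  by right; exact: contact_down.
have [|||N [A [B [sN h1 h2 h3 [h4 h5]]]]] := @crossing_intervals _ (gap q) _ _ s TT _ g1 g2 _ ss _.
- by move=> t; exact: gap_cont.
- by move=> t ht gt_; apply: cross; apply/contactE.
- by move=> t; rewrite -contactE; split => /hs.
have cA k : contact q (A k) by apply/hs/h5; exists k; left.
have cB k : contact q (B k) by apply/hs/h5; exists k; right.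
exists N, A, B; split; last by rewrite -sN.
split => //.
- by move=> k; have /andP[] := contact_interior hq (cA k); have /andP[] := contact_interior hq (cB k).
- move=> t ht; rewrite -h5; split => [e|]; first by apply/hs; split.
  by move=> /hs[].
- by move=> t ht; rewrite -h4// /gap subr_gt0.
- move=> k; move: (hreg _ (cA k)); rewrite neq_lt => /orP[//|d].
  by have [u _] := h3 k; case: (no_up_and_down u (contact_down hq (cA k) d)).
- move=> k; move: (hreg _ (cB k)); rewrite neq_lt => /orP[d|//].
  by have [_ u] := h3 k; case: (no_up_and_down (contact_up hq (cB k) d) u).
Qed.

(** Without an arc the trajectory is nowhere active, hence constant, and the curve
would nowhere be below the level. *)
Lemma active_arcs_nonempty q N (A B : 'I_N -> R) : `|q| < rho -> active_arcs q A B ->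
  (exists2 t, - T <= t <= T & phi t < q) -> (0 < N)%N.
Proof.
move=> hq arcs [t0 ht0 pt0]; have [T0 _ _ _ _] := box_facts box.
have hT : - T <= - T <= T by rewrite lexx; lra.
rewrite lt0n; apply/eqP => N0; have nok : 'I_N -> False by rewrite N0 => -[].
have le_ t : - T <= t <= T -> I t q <= phi t.
  move=> ht; rewrite leNgt; apply/negP => h.
  by have [+ _] := arcs_active arcs ht => /(_ h)[k]; case: (nok k).
have := @ler_dist_mvt _ (I^~ q) (fun t => cut_field phi F t (I t q)) (- T) T 0 _ _ _ t0 (- T) ht0 hT.
rewrite mul0r (flow_init hI) normr_le0 subr_eq0 => h.
have /eqP e : I t0 q == q.
  apply: h.
  - by apply: within_continuous_cc => t _; exact: (flow_cont hI).
  - by move=> t; exact: (flow_der hI).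
  - by move=> t /andP[t1 t2]; rewrite /cut_field /cut ltNge le_ ?normr0// !ltW.
by have := le_ _ ht0; rewrite e leNgt pt0.
Qed.

End Contacts.

(** * The first derivative in the initial level *)

Section CutLimits.
Context {R : realType}.

(** The cut is discontinuous only where its first two arguments agree. *)
Lemma cvg_cut (V : Type) (G : set_system V) {FG : Filter G} (a x k : V -> R) (a0 x0 k0 : R) :
  a p @[p --> G] --> a0 -> x p @[p --> G] --> x0 -> k p @[p --> G] --> k0 ->
  a0 != x0 -> cut (a p) (x p) (k p) @[p --> G] --> cut a0 x0 k0.
Proof.
move=> ca cx ck ax; have cd : a p - x p @[p --> G] --> a0 - x0 by apply: cvgB.
move: ax; rewrite neq_lt => /orP[h|h].
  have n1 : \forall p \near G, a p - x p < 0.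
    by have := @cvgr_lt _ _ _ _ _ _ cd 0; rewrite subr_lt0; exact.
  rewrite {2}/cut h; apply: cvg_trans ck; apply: near_eq_cvg.
  by apply: filterS n1 => p; rewrite subr_lt0 /cut => ->.
have n1 : \forall p \near G, 0 < a p - x p.
  by have := @cvgr_gt _ _ _ _ _ _ cd 0; rewrite subr_gt0; exact.
rewrite {2}/cut ltNge (ltW h) /=.
have c0 : (fun=> 0 : R) p @[p --> G] --> (0 : R) by exact: cvg_cst.
apply: cvg_trans c0; apply: near_eq_cvg; apply: filterS n1 => p.
by rewrite subr_gt0 /cut => h'; rewrite ltNge (ltW h').
Qed.

Lemma bmeas_cut (a b C : R) (u v k : R -> R) :
  measurable_fun `[a, b] u -> measurable_fun `[a, b] v -> bmeas a b C k ->
  bmeas a b C (fun t => cut (u t) (v t) (k t)).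
Proof.
move=> mu mv [mk bk]; split.
  apply: measurable_fun_if => //.
  - exact: measurable_fun_ltr.
  - by apply: measurable_funS mk => //; apply: subIsetl.
move=> t /bk h; rewrite /cut; case: ifP => // _; rewrite normr0.
exact: le_trans h.
Qed.

Lemma continuous_dnbhs (f : R -> R) (x : R) :
  f z @[z --> x^'] --> f x -> {for x, continuous f}.
Proof. by move=> h; apply/continuous_withinNx. Qed.

End CutLimits.

Section Jacobian.
Context {R : realType}.
Variables (phi dphi : R -> R) (F Fx Fxx : R -> R -> R) (T r K K2 rho : R) (nu : nat).
Hypothesis box : scalar_box phi dphi F Fx Fxx T r K K2 rho nu.
Variable I : R -> R -> R.
Hypothesis hI : flow phi F T rho I.
Hypothesis nu0 : (0 < nu)%N.
Implicit Types (t s q x c : R).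
Notation mu := (@lebesgue_measure R).

Lemma along_flow_cont (H : R -> R -> R) q t :
  (forall t x : R, - T <= t <= T -> `|x| <= r ->
    {for (t, x), continuous (fun p : R * R => H p.1 p.2)}) ->
  `|q| < rho -> - T <= t <= T -> {for t, continuous (fun s => H s (I s q))}.
Proof.
move=> cH hq ht.
apply: (@continuous2_cvg _ _ _ _ _ _ id (I^~ q) H t (I t q)).
- by apply: cH => //; exact: (flow_le box hI).
- exact: cvg_id.
- exact: (flow_cont hI).
Qed.

Lemma along_flow_cont_level (H : R -> R -> R) q t :
  (forall t x : R, - T <= t <= T -> `|x| <= r ->
    {for (t, x), continuous (fun p : R * R => H p.1 p.2)}) ->
  `|q| < rho -> - T <= t <= T -> {for q, continuous (fun q => H t (I t q))}.
Proof.
move=> cH hq ht.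
apply: (@continuous2_cvg _ _ _ _ _ _ (fun=> t) (I t) H t (I t q)).
- by apply: cH => //; exact: (flow_le box hI).
- exact: cvg_cst.
- exact: (flow_cont_level box hI).
Qed.

Lemma sub_bmeas t C h : - T <= t <= T -> bmeas (- T) T C h -> bmeas (- T) t C h.
Proof. by move=> /andP[_ tT]; apply: bmeas_sub. Qed.

Lemma phi_measurable : measurable_fun `[- T, T] phi.
Proof. by apply: continuous_measurable_cc => s; exact: (phi_cont box). Qed.

Lemma flow_measurable q : measurable_fun `[- T, T] (I^~ q).
Proof. by apply: continuous_measurable_cc => s _; exact: (flow_cont hI). Qed.

Lemma along_flow_bmeas (H : R -> R -> R) C q :
  (forall t x : R, - T <= t <= T -> `|x| <= r ->
    {for (t, x), continuous (fun p : R * R => H p.1 p.2)}) ->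
  (forall t x : R, - T <= t <= T -> `|x| <= r -> `|H t x| <= C) ->
  `|q| < rho -> bmeas (- T) T C (fun s => H s (I s q)).
Proof.
move=> cH bH hq; split; last by move=> t ht; apply: bH => //; exact: (flow_le box hI).
by apply: continuous_measurable_cc => t; exact: along_flow_cont.
Qed.

(** The coefficient of the linear equation solved by the derivative of the
trajectory in its initial level; jac is the solution of that equation. *)
Definition growth q s := cut (phi s) (I s q) (Fx s (I s q)).
Definition log_jac t q := \int[mu]_(s in `[- T, t]) growth q s.
Definition jac t q := expR (log_jac t q).

Lemma growth_bmeas q : `|q| < rho -> bmeas (- T) T K (growth q).
Proof.
move=> hq; apply: bmeas_cut; [exact: phi_measurable|exact: flow_measurable|].
apply: along_flow_bmeas => //; [exact: (Fx_cont box)|exact: (Fx_le box)].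
Qed.

Lemma log_jac_le q t : `|q| < rho -> - T <= t <= T -> `|log_jac t q| <= 4^-1.
Proof.
move=> hq /[dup] ht /andP[t1 t2]; have [_ K0 KT _ _] := box_facts box.
apply: le_trans (ler_norm_integral t1 (sub_bmeas ht (growth_bmeas hq))) _.
by apply: le_trans KT; apply: ler_wpM2l => //; lra.
Qed.

Definition difference_quotient q1 q2 s :=
  (cut_field phi F s (I s q2) - cut_field phi F s (I s q1)) / (I s q2 - I s q1).

Lemma difference_quotient_bmeas q1 q2 : `|q1| < rho -> `|q2| < rho -> q1 != q2 ->
  (forall t, - T <= t <= T -> {for t, continuous (difference_quotient q1 q2)}) /\
  bmeas (- T) T K (difference_quotient q1 q2).
Proof.
move=> h1 h2 q12.
have ne t : - T <= t <= T -> I t q2 - I t q1 != 0.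
  by move=> ht; rewrite subr_eq0; apply: (flow_neq box hI) => //; rewrite eq_sym.
have cc t : - T <= t <= T -> {for t, continuous (difference_quotient q1 q2)}.
  move=> ht; apply: cvgM.
    by apply: cvgB; apply: along_flow_cont => // *; exact: (cut_field_cont box).
  apply: cvgV; first exact: ne.
  by apply: cvgB; exact: (flow_cont hI).
split => //; split; first exact: continuous_measurable_cc.
move=> t ht; rewrite normrM normfV ler_pdivrMr ?normr_gt0 ?ne//.
by apply: (cut_field_lipschitz box) => //; exact: (flow_le box hI).
Qed.

(** The difference w of the two trajectories satisfies w' = w * (difference
quotient), so w times the inverse exponential has zero derivative. *)
Lemma flow_separation q1 q2 t : `|q1| < rho -> `|q2| < rho -> q1 != q2 ->
  - T <= t <= T ->
  I t q2 - I t q1 =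
    (q2 - q1) * expR (\int[mu]_(s in `[- T, t]) difference_quotient q1 q2 s).
Proof.
move=> h1 h2 q12 ht; have [T0 K0 _ _ _] := box_facts box.
have hT : - T <= - T <= T by rewrite lexx; lra.
have [cd bd] := difference_quotient_bmeas h1 h2 q12.
pose E t := \int[mu]_(s in `[- T, t]) difference_quotient q1 q2 s.
pose w t := I t q2 - I t q1.
have ne s : - T <= s <= T -> I s q2 - I s q1 != 0.
  by move=> hs; rewrite subr_eq0; apply: (flow_neq box hI) => //; rewrite eq_sym.
have cE s : {for s, continuous (fun s => E (clamp (- T) T s))}.
  apply: (@lipschitz_continuous _ _ K K0) => u v; rewrite /E.
  apply: le_trans (ler_dist_integral bd _ _) _; rewrite ?clamp_itv//; try lra.
  by apply: ler_wpM2l => //; exact: clamp_lipschitz.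
have dE s : - T < s < T -> is_derive s 1 E (difference_quotient q1 q2 s).
  by move=> hs; exact: (integral_is_derive hs cd).
pose u s := w s * expR (- E (clamp (- T) T s)).
have du s : - T < s < T -> is_derive s 1 u 0.
  move=> hs; have hs' : - T <= s <= T by case/andP: hs => *; rewrite !ltW.
  have d1 : is_derive s 1 w (cut_field phi F s (I s q2) - cut_field phi F s (I s q1)).
    by apply: is_deriveB; exact: (flow_der hI).
  have d2 : is_derive s 1 (fun s => expR (- E s)) (expR (- E s) * - difference_quotient q1 q2 s).
    have dN : is_derive s 1 (fun s => - E s) (- difference_quotient q1 q2 s).
      by apply: is_deriveN; exact: dE.
    have := @is_derive1_comp _ expR (fun s => - E s) s _ _ (is_derive_expR _) dN.
    exact.
  have d3 := is_deriveM d1 d2.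
  apply: (@near_eq_is_derive _ _ _ (fun s => w s * expR (- E s))).
    near=> z; rewrite /u clamp_id//; apply/andP; split; apply: ltW; near: z.
    - by apply: lt_nbhsr; case/andP: hs.
    - by apply: lt_nbhsl; case/andP: hs.
  apply: is_derive_eq d3 _.
  rewrite /difference_quotient /GRing.scale /= -/(w s).
  by field; exact: ne.
have uc : u t = u (- T).
  apply/eqP; rewrite -subr_eq0 -normr_le0 -[leRHS](mul0r `|t - - T|).
  apply: (@ler_dist_mvt _ u (cst 0) (- T) T 0) => //; last by move=> s _; rewrite normr0.
  apply: within_continuous_cc => s _; apply: cvgM.
    by apply: cvgB; exact: (flow_cont hI).
  by apply: continuous_cvg; [exact: continuous_expR|apply: cvgN; exact: cE].
have cT : clamp (- T) T (- T) = - T by apply: clamp_id; rewrite lexx; case/andP: ht => t1 t2; exact: le_trans t2.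
move: uc; rewrite /u /w (clamp_id ht) cT !(flow_init hI) /E set_itv1 Rintegral_set1 oppr0 expR0 mulr1.
by move=> <-; rewrite -mulrA -expRD addNr expR0 mulr1.
Unshelve. all: by end_near. Qed.

(** By flow_separation the slope of I t between q and z is an exponential of an
integral; the integrand converges to growth except at the finitely many
contacts of q. *)
Lemma jac_is_derive q t : `|q| < rho -> - T <= t <= T ->
  is_derive q 1 (I t) (jac t q).
Proof.
move=> hq ht; have [T0 K0 _ _ _] := box_facts box.
(* the slope of I t between q and z, completed by its limit at q *)
pose k z := if z == q then jac t q
  else expR (\int[mu]_(s in `[- T, t]) difference_quotient q z s).
have -> : jac t q = k q by rewrite /k eqxx.
apply: is_derive_slope.
  near=> z; rewrite /k; case: eqVneq => [->|zq]; first by rewrite !subrr mulr0.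
  rewrite mulrC; apply: flow_separation => //; last by rewrite eq_sym.
  by near: z; exact: (near_level hq).
apply: continuous_dnbhs.
have -> : k q = jac t q by rewrite /k eqxx.
have nz : \forall z \near q^', z != q by exact: nbhs_dnbhs_neq.
have nr : \forall z \near q^', `|z| < rho by apply: cvg_within; exact: (near_level hq).
have hc : expR (\int[mu]_(s in `[- T, t]) difference_quotient q z s) @[z --> q^'] --> jac t q.
  apply: continuous_cvg; first exact: continuous_expR.
  apply: (@bounded_cvg_integral _ _ _ _ _ _ _ _ K (contact phi T I q)).
  - exact: dnbhs_countable_base.
  - exact: (contact_finite box hI).
  - apply: filterS2 nz nr => z zq hz; apply: sub_bmeas => //.
    by apply: (difference_quotient_bmeas hq hz _).2; rewrite eq_sym.
  - by case: (sub_bmeas ht (growth_bmeas hq)).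
  - move=> s /andP[s1 s2] ns.
    have hs : - T <= s <= T by rewrite s1 (le_trans s2)//; case/andP: ht.
    have ps : phi s != I s q by apply/eqP => e; apply: ns.
    have /is_derive1_caratheodory[g [hg cg g0]] :=
      cut_field_is_derive box hs (flow_le box hI hq hs) ps.
    rewrite /growth -g0.
    have cgI : g (I s z) @[z --> q^'] --> g (I s q).
      apply: (@continuous_cvg _ _ _ (q^') _ (I s) g (I s q) cg).
      by apply: cvg_within_filter; exact: (flow_cont_level box hI hq hs).
    apply: cvg_trans cgI; apply: near_eq_cvg.
    apply: filterS2 nz nr => z zq hz; rewrite /difference_quotient hg mulfK//.
    by rewrite subr_eq0; exact: (flow_neq box hI).
apply: cvg_trans hc; apply: near_eq_cvg; apply: filterS nz => z zq.
by rewrite /k (negbTE zq).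
Unshelve. all: by end_near. Qed.

Lemma jac_gt0 t q : 0 < jac t q.
Proof. exact: expR_gt0. Qed.

(** From 1 + x <= exp x applied at x and - x with |x| <= 1/4. *)
Lemma jac_bounds q t : `|q| < rho -> - T <= t <= T ->
  3 / 4 <= jac t q /\ jac t q <= 4 / 3.
Proof.
move=> hq ht; have := log_jac_le hq ht; rewrite ler_norml => /andP[l1 l2].
have h1 := expR_ge1Dx (log_jac t q); have h2 := expR_ge1Dx (- log_jac t q).
rewrite /jac; split; first lra.
have e0 := expR_gt0 (log_jac t q).
have : expR (log_jac t q) * expR (- log_jac t q) = 1 by rewrite -expRD subrr expR0.
nra.
Qed.

(** The active set depends on the level only through a cut, which converges at every
time that is not a contact. *)
Lemma active_integral_cont (H : R -> R -> R) C q t : - T <= t <= T -> `|q| < rho ->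
  (forall q', `|q'| < rho -> bmeas (- T) T C (H q')) ->
  (forall s, - T <= s <= T -> {for q, continuous (H^~ s)}) ->
  {for q, continuous (fun q => \int[mu]_(s in `[- T, t]) cut (phi s) (I s q) (H q s))}.
Proof.
move=> ht hq bH cH.
have bm q' : `|q'| < rho -> bmeas (- T) t C (fun s => cut (phi s) (I s q') (H q' s)).
  move=> hq'; apply: sub_bmeas => //; apply: bmeas_cut; last exact: bH.
    exact: phi_measurable.
  exact: flow_measurable.
apply: (@bounded_cvg_integral _ R (nbhs q) _ _ _ _ _ C (contact phi T I q)).
- exact: (@nbhs_countable_base R R q).
- exact: (contact_finite box hI).
- by apply: filterS (near_level hq) => z hz; exact: bm.
- by case: (bm q hq).
- move=> s /andP[s1 s2] ns.
  have hs : - T <= s <= T by rewrite s1 (le_trans s2)//; case/andP: ht.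
  apply: cvg_cut; [exact: cvg_cst|exact: (flow_cont_level box hI hq hs)|exact: cH|].
  by apply/eqP => e; apply: ns.
Qed.

Lemma jac_cont_level q t : `|q| < rho -> - T <= t <= T -> {for q, continuous (jac t)}.
Proof.
move=> hq ht; apply: continuous_cvg; first exact: continuous_expR.
apply: (@active_integral_cont (fun q s => Fx s (I s q)) K) => //.
  by move=> q' hq'; apply: along_flow_bmeas => //; [exact: (Fx_cont box)|exact: (Fx_le box)].
by move=> s hs; apply: along_flow_cont_level => //; exact: (Fx_cont box).
Qed.

(** Uniformity in q is what turns the continuity of jac in each variable into joint
continuity. *)
Lemma jac_lipschitz q t s : `|q| < rho -> - T <= t <= T -> - T <= s <= T ->
  `|jac t q - jac s q| <= 4 / 3 * K * `|t - s|.
Proof.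
move=> hq; wlog h : t s / log_jac s q <= log_jac t q.
  move=> hw ht hs; have [h|/ltW h] := leP (log_jac s q) (log_jac t q); first exact: hw.
  by rewrite distrC (distrC t); exact: hw.
move=> ht hs.
have hl := ler_dist_integral (growth_bmeas hq) ht hs.
rewrite -/(log_jac t q) -/(log_jac s q) (ger0_norm (_ : 0 <= log_jac t q - log_jac s q)) ?subr_ge0// in hl.
have le_ : expR (log_jac s q) <= expR (log_jac t q) by rewrite ler_expR.
rewrite /jac ger0_norm ?subr_ge0//.
have -> : expR (log_jac s q) = expR (log_jac t q) * expR (log_jac s q - log_jac t q).
  by rewrite -expRD addrC subrK.
have [_ h2] := jac_bounds hq ht.
apply: (@le_trans _ _ (4 / 3 * (log_jac t q - log_jac s q))); last by rewrite -(mulrA (4 / 3)) ler_wpM2l.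
rewrite -[X in X - _]mulr1 -mulrBr; apply: ler_pM; [exact: expR_ge0| |exact: h2|].
  by rewrite subr_ge0 -expR0 ler_expR subr_le0.
rewrite lerBlDr -lerBlDl opprB; exact: expR_ge1Dx.
Qed.

Lemma jac_cont2 q t : `|q| < rho -> - T < t < T ->
  {for (t, q), continuous (fun p : R * R => jac p.1 p.2)}.
Proof.
move=> hq /[dup] ht' /andP[t1 t2]; apply/cvgrPdist_lt => e e0.
have ht : - T <= t <= T by rewrite !ltW.
have [_ K0 _ _ _] := box_facts box.
have K1 : 0 < 4 / 3 * K + 1 by apply: ltr_wpDl => //; apply: mulr_ge0 => //; lra.
pose e' := Num.min (e / 2 / (4 / 3 * K + 1)) (Num.min (T - t) (t + T)).
have e'0 : 0 < e'.
  rewrite !lt_min; apply/andP; split; first by rewrite !divr_gt0.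
  by apply/andP; split; lra.
have e2 : 0 < e / 2 by rewrite divr_gt0.
exists (ball t e', [set q' | `|q'| < rho /\ `|jac t q - jac t q'| < e / 2]).
  split; first exact: nbhsx_ballx.
  by apply: filterI; [exact: near_level|exact: (continuous_dist_lt (jac_cont_level hq ht))].
move=> [s q'] /= [hs [hq' hqq]]; move: hs; rewrite /ball /= !lt_min => /and3P[s1 s2 s3].
have hs : - T <= s <= T.
  by move: s2 s3; rewrite !ltr_norml => /andP[? ?] /andP[? ?]; apply/andP; split; lra.
have -> : jac t q - jac s q' = (jac t q - jac t q') + (jac t q' - jac s q').
  by rewrite addrA subrK.
rewrite [e]splitr; apply: (le_lt_trans (ler_normD _ _)); apply: ltrD; first exact: hqq.
apply: le_lt_trans (jac_lipschitz hq' ht hs) _.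
apply: (@le_lt_trans _ _ ((4 / 3 * K + 1) * `|t - s|)); last by rewrite mulrC -ltr_pdivlMr.
by rewrite ler_wpM2r// lerDl.
Qed.

(** The clamp gives a statement at the end times as well. *)
Lemma jac_cont_time q t : `|q| < rho -> - T <= t <= T -> {for t, continuous (fun s => jac (clamp (- T) T s) q)}.
Proof.
move=> hq ht; have [T0 K0 _ _ _] := box_facts box.
have K1 : 0 <= 4 / 3 * K by apply: mulr_ge0 => //; lra.
apply: (lipschitz_continuous K1) => u v.
apply: le_trans (jac_lipschitz hq _ _) _; rewrite ?clamp_itv//; try lra.
by apply: ler_wpM2l => //; exact: clamp_lipschitz.
Qed.

Lemma jac_bmeas q : `|q| < rho -> bmeas (- T) T (4 / 3) (jac^~ q).
Proof.
move=> hq; split; last first.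
  by move=> t ht; rewrite gtr0_norm ?jac_gt0//; case: (jac_bounds hq ht).
apply: (@eq_measurable_fun _ _ _ _ _ (fun s => jac (clamp (- T) T s) q)).
  by move=> s; rewrite inE /= in_itv /= => hs; rewrite clamp_id.
by apply: continuous_measurable_cc => t; exact: jac_cont_time.
Qed.

End Jacobian.

(** * Motion of the active arcs with the level *)

Section SumIntegral.
Context {R : realType}.
Notation mu := (@lebesgue_measure R).

Lemma integral_sum (J : Type) (s : seq J) (a b C : R) (f : J -> R -> R) :
  (forall j, bmeas a b C (f j)) ->
  (exists D, bmeas a b D (fun t => \sum_(j <- s) f j t)) /\
  \int[mu]_(t in `[a, b]) (\sum_(j <- s) f j t) =
    \sum_(j <- s) \int[mu]_(t in `[a, b]) f j t.
Proof.
move=> hf; elim: s => [|j s [[D hD] es]].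
  have -> : (fun t => \sum_(j <- [::]) f j t) = cst 0 by apply/funext => t; rewrite big_nil.
  split; first by exists 0; split; [exact: measurable_cst|move=> t _; rewrite normr0].
  by rewrite big_nil Rintegral_cst// mul0r.
have -> : (fun t => \sum_(i <- j :: s) f i t) = (fun t => f j t + \sum_(i <- s) f i t).
  by apply/funext => t; rewrite big_cons.
split; last first.
  rewrite big_cons RintegralD// ?es//; first exact: bmeas_integrable (hf j).
  exact: bmeas_integrable hD.
exists (C + D); split; first by apply: measurable_funD; [case: (hf j)|case: hD].
by move=> t ht; apply: le_trans (ler_normD _ _) _; apply: lerD; [apply: (hf j).2|apply: hD.2].
Qed.

(** The difference of two integrals from the fixed end a has both arc ends as
upper bounds, which is the form suited to differentiation. *)
Lemma integral_arc (a b C A B : R) (h : R -> R) : a <= A -> A < B -> B <= b ->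
  bmeas a b C h ->
  bmeas a b C (fun t => if A < t < B then h t else 0) /\
  \int[mu]_(t in `[a, b]) (if A < t < B then h t else 0) =
    \int[mu]_(t in `[a, B]) h t - \int[mu]_(t in `[a, A]) h t.
Proof.
move=> aA AB Bb hh; have ie : (fun t => if A < t < B then h t else 0) = h \_ `]A, B[.
  by apply/funext => t; rewrite patchE mem_setE in_itv.
split.
  split; last by move=> t ht; have := hh.2 t ht; case: ifP => // _; rewrite normr0; exact: le_trans.
  rewrite ie; apply/measurable_restrict => //.
  by apply: measurable_funS hh.1 => //; apply: subIsetr.
rewrite ie -Rintegral_mkcondr.
have -> : `[a, b] `&` `]A, B[ = `]A, B[%classic.
  apply/setIidPr; apply: subset_itv; rewrite bnd_simp//.
rewrite (integral_sub_itv aA (ltW AB) Bb hh).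
have iAB : mu.-integrable `[A, B] (EFin \o h).
  by apply: (@bmeas_integrable _ _ _ C); apply: bmeas_sub hh.
rewrite Rintegral_itv_bndo_bndc; last first.
  by apply: integrableS iAB => //; apply: subset_itv; rewrite bnd_simp.
by rewrite Rintegral_itv_obnd_cbnd//; apply: integrableS iAB => //; apply: subset_itv; rewrite bnd_simp.
Qed.

End SumIntegral.

Section Ordering.
Context {R : realType}.

(** Two continuous quantities that differ at a point keep their order nearby; here
for a moving contact c q and the time itself. *)
Lemma order_near (c : R -> R) (t0 q0 : R) : {for q0, continuous c} -> c q0 != t0 ->
  nbhs (t0, q0) (fun p : R * R => [/\ (c p.2 < p.1) = (c q0 < t0),
     (p.1 < c p.2) = (t0 < c q0) & p.1 != c p.2]).
Proof.
move=> cc ne.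
have cd : {for (t0, q0), continuous (fun p : R * R => c p.2 - p.1)}.
  apply: cvgB; last exact: cvg_fst.
  by apply: (@continuous_cvg _ _ _ (nbhs (t0, q0)) _ snd c q0 cc); exact: cvg_snd.
move: ne; rewrite neq_lt => /orP[h|h].
- have h' : (fun p : R * R => c p.2 - p.1) (t0, q0) < 0 by rewrite /= subr_lt0.
  apply: filterS (continuous_lt cd h') => p; rewrite subr_lt0 => hp.
  by rewrite hp h !ltNge (ltW hp) (ltW h) /= gt_eqF.
- have h' : 0 < (fun p : R * R => c p.2 - p.1) (t0, q0) by rewrite /= subr_gt0.
  apply: filterS (continuous_gt cd h') => p; rewrite subr_gt0 => hp.
  by rewrite hp h !ltNge (ltW hp) (ltW h) /= lt_eqF.
Qed.

End Ordering.

Section SecondDerivative.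
Context {R : realType}.
Variables (phi dphi : R -> R) (F Fx Fxx : R -> R -> R) (T r K K2 rho : R) (nu : nat).
Hypothesis box : scalar_box phi dphi F Fx Fxx T r K K2 rho nu.
Variable I : R -> R -> R.
Hypothesis hI : flow phi F T rho I.
Hypothesis nu0 : (0 < nu)%N.
Implicit Types (t s q x c : R).
Notation mu := (@lebesgue_measure R).
Local Notation jac := (jac phi Fx T I).
Local Notation log_jac := (log_jac phi Fx T I).
Local Notation active_arcs := (active_arcs phi dphi T I).
Local Notation contact := (contact phi T I).

(** The antiderivative of F_I along a trajectory without any cut: it is
differentiable in time and level, and log J is a combination of its values at
the ends of the arcs. *)
Definition prim t q := \int[mu]_(s in `[- T, t]) Fx s (I s q).

Let Fx_flow_cont q t : `|q| < rho -> - T <= t <= T ->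
  {for t, continuous (fun s => Fx s (I s q))}.
Proof. by apply: (along_flow_cont box hI); exact: (Fx_cont box). Qed.

Lemma prim_is_derive_time q t : `|q| < rho -> - T < t < T ->
  is_derive t 1 (prim^~ q) (Fx t (I t q)).
Proof. by move=> hq ht; apply: (integral_is_derive ht) => s; exact: Fx_flow_cont. Qed.

Let Fx_flow_is_derive q s : `|q| < rho -> - T <= s <= T ->
  is_derive q 1 (fun q => Fx s (I s q)) (Fxx s (I s q) * jac s q).
Proof.
move=> hq hs; have d1 := Fx_der box hs (flow_le box hI hq hs).
by have := @is_derive1_comp _ (Fx s) (I s) q _ _ d1 (jac_is_derive box hI nu0 hq hs).
Qed.

Let K20 : 0 <= K2 := Fxx_bound_ge0 box.

Let Fx_lipschitz s x y : - T <= s <= T -> `|x| <= r -> `|y| <= r ->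
  `|Fx s x - Fx s y| <= K2 * `|x - y|.
Proof.
move=> hs hx hy; apply: (@ler_dist_mvt _ (Fx s) (Fxx s) (- r) r K2).
- apply: within_continuous_cc => z hz; apply: is_derive_continuous.
  by apply: (Fx_der box hs); rewrite ler_norml.
- by move=> z /andP[z1 z2]; apply: (Fx_der box hs); rewrite ler_norml !ltW.
- by move=> z /andP[z1 z2]; apply: (Fxx_le box hs); rewrite ler_norml !ltW.
- by rewrite -ler_norml.
- by rewrite -ler_norml.
Qed.

Lemma bmeas_mul (a b C D : R) (f g : R -> R) : bmeas a b C f -> bmeas a b D g ->
  bmeas a b (C * D) (fun t => f t * g t).
Proof.
move=> [mf bf] [mg bg]; split; first exact: measurable_funM.
by move=> t ht; rewrite normrM ler_pM// ?bf ?bg.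
Qed.

Lemma curvature_bmeas q : `|q| < rho ->
  bmeas (- T) T (K2 * (4 / 3)) (fun s => Fxx s (I s q) * jac s q).
Proof.
move=> hq; apply: bmeas_mul; last exact: (jac_bmeas box hI).
by apply: (along_flow_bmeas box hI) => //; [exact: (Fxx_cont box)|exact: (Fxx_le box)].
Qed.

(** Differentiation under the integral sign; the quotients are bounded because both
F_I and the trajectories are Lipschitz in their last variable. *)
Lemma prim_is_derive_level q t : `|q| < rho -> - T <= t <= T ->
  is_derive q 1 (prim t) (\int[mu]_(s in `[- T, t]) (Fxx s (I s q) * jac s q)).
Proof.
move=> hq ht; have [T0 K0 _ _ _] := box_facts box.
pose k z := if z == q then \int[mu]_(s in `[- T, t]) (Fxx s (I s q) * jac s q)
  else \int[mu]_(s in `[- T, t]) ((Fx s (I s z) - Fx s (I s q)) / (z - q)).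
have bmF z : `|z| < rho -> bmeas (- T) T K (fun s => Fx s (I s z)).
  by apply: (along_flow_bmeas box hI); [exact: (Fx_cont box)|exact: (Fx_le box)].
have bmQ z : `|z| < rho -> z != q ->
    bmeas (- T) T (K2 * 2) (fun s => (Fx s (I s z) - Fx s (I s q)) / (z - q)).
  move=> hz zq; split.
    apply: measurable_funM; last exact: measurable_cst.
    by apply: measurable_funB; [case: (bmF z hz)|case: (bmF q hq)].
  move=> s hs; rewrite normrM normfV ler_pdivrMr ?normr_gt0 ?subr_eq0//.
  apply: le_trans (Fx_lipschitz hs (flow_le box hI hz hs) (flow_le box hI hq hs)) _.
  by rewrite -mulrA ler_wpM2l//; exact: (flow_lipschitz box hI).
have -> : \int[mu]_(s in `[- T, t]) (Fxx s (I s q) * jac s q) = k q by rewrite /k eqxx.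
have nz : \forall z \near q^', z != q by exact: nbhs_dnbhs_neq.
have nr : \forall z \near q^', `|z| < rho by apply: cvg_within; exact: (near_level hq).
apply: is_derive_slope.
  apply: filterS (near_level hq) => z hz; rewrite /k.
  case: eqVneq => [->|zq]; first by rewrite !subrr mulr0.
  rewrite /prim -RintegralB//; last 2 first.
  - exact: bmeas_integrable (sub_bmeas ht (bmF z hz)).
  - exact: bmeas_integrable (sub_bmeas ht (bmF q hq)).
  rewrite -RintegralZr//; last exact: bmeas_integrable (sub_bmeas ht (bmQ z hz zq)).
  by apply: eq_Rintegral => s _; rewrite divfK// subr_eq0.
apply: continuous_dnbhs; rewrite {2}/k eqxx.
suff hc : \int[mu]_(s in `[- T, t]) ((Fx s (I s z) - Fx s (I s q)) / (z - q)) @[z --> q^'] -->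
    \int[mu]_(s in `[- T, t]) (Fxx s (I s q) * jac s q).
  apply: cvg_trans hc; apply: near_eq_cvg; apply: filterS nz => z zq.
  by rewrite /k (negbTE zq).
apply: (@bounded_cvg_integral _ _ _ _ _ _ _ _ (K2 * 2) set0).
- exact: dnbhs_countable_base.
- exact: finite_set0.
- by apply: filterS2 nz nr => z zq hz; apply: sub_bmeas => //; exact: bmQ.
- by case: (sub_bmeas ht (curvature_bmeas hq)).
- move=> s /andP[s1 s2] _.
  have hs : - T <= s <= T by rewrite s1 (le_trans s2)//; case/andP: ht.
  have /is_derive1_caratheodory[g [hg cg <-]] := Fx_flow_is_derive hq hs.
  have cg' : g z @[z --> q^'] --> g q by apply: cvg_within_filter; exact: cg.
  apply: cvg_trans cg'; apply: near_eq_cvg; apply: filterS nz => z zq.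
  by rewrite hg mulfK// subr_eq0.
Qed.

Lemma near_time t : - T < t < T -> \forall s \near t, - T < s < T.
Proof.
move=> /andP[t1 t2]; near=> s; apply/andP; split; near: s.
  exact: lt_nbhsr.
exact: lt_nbhsl.
Unshelve. all: by end_near. Qed.

Lemma near_time_level q t : `|q| < rho -> - T < t < T ->
  nbhs (t, q) (fun p : R * R => - T < p.1 < T /\ `|p.2| < rho).
Proof.
move=> hq ht; exists ([set s | - T < s < T], [set q' | `|q'| < rho]).
  by split; [exact: near_time|exact: near_level].
by move=> [s z].
Qed.

Lemma along_flow_cont2 (H : R -> R -> R) q t :
  (forall t x : R, - T <= t <= T -> `|x| <= r ->
    {for (t, x), continuous (fun p : R * R => H p.1 p.2)}) ->
  `|q| < rho -> - T < t < T ->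
  {for (t, q), continuous (fun p : R * R => H p.1 (I p.1 p.2))}.
Proof.
move=> cH hq ht; have ht' : - T <= t <= T by case/andP: ht => *; rewrite !ltW.
apply: (@continuous2_cvg _ _ _ _ (nbhs (t, q)) _ fst (fun p : R * R => I p.1 p.2) H t (I t q)).
- by apply: cH => //; exact: (flow_le box hI).
- exact: cvg_fst.
- exact: (flow_cont2 box hI hq ht).
Qed.

(** The gap has time derivative - phi' at a contact, since the field vanishes there;
when this is positive the implicit branch applies to the gap, otherwise to its
opposite.  The level derivative of the gap is J, whence the slope J / phi'. *)
Lemma contact_branch q0 c0 : `|q0| < rho -> contact q0 c0 -> dphi c0 != 0 ->
  exists c : R -> R, [/\ c q0 = c0, is_derive q0 1 c (jac c0 q0 / dphi c0) &
    nbhs (c0, q0) (fun p : R * R => [/\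
      dphi c0 < 0 -> (phi p.1 < I p.1 p.2) = (c p.2 < p.1),
      0 < dphi c0 -> (phi p.1 < I p.1 p.2) = (p.1 < c p.2) &
      (I p.1 p.2 == phi p.1) = (p.1 == c p.2)])].
Proof.
move=> hq hc dc; have hc' := contact_interior box hI hq hc.
have hcT : - T <= c0 <= T by case: hc.
pose G t q := gap phi I q t; pose Gt t q := cut_field phi F t (I t q) - dphi t.
have hG : derive_near G Gt c0 q0.
  apply: filterS (near_time_level hq hc') => p [hp1 hp2].
  exact: (gap_is_derive box hI).
have cGt : {for (c0, q0), continuous (fun p : R * R => Gt p.1 p.2)}.
  apply: cvgB; first by apply: along_flow_cont2 => // *; exact: (cut_field_cont box).
  apply: (@continuous_cvg _ _ _ (nbhs (c0, q0)) _ fst dphi c0); first exact: (dphi_cont box).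
  exact: cvg_fst.
have Gt0 : Gt c0 q0 = - dphi c0.
  by case: hc => _ e; rewrite /Gt /cut_field /cut e ltxx sub0r.
have G0 : G c0 q0 = 0 by case: hc => _ e; rewrite /G /gap e subrr.
have cG : \forall t \near c0, {for q0, continuous (G t)}.
  apply: filterS (near_time hc') => t /andP[t1 t2]; apply: cvgB; last exact: cvg_cst.
  by apply: (flow_cont_level box hI hq); rewrite !ltW.
have dG : is_derive q0 1 (G c0) (jac c0 q0).
  by rewrite -[jac _ _]subr0; apply: is_deriveB; exact: (jac_is_derive box hI).
have finish (c : R -> R) : c q0 = c0 -> {for q0, continuous c} ->
    nbhs (c0, q0) (fun p : R * R => (I p.1 p.2 == phi p.1) = (p.1 == c p.2)) ->
    is_derive q0 1 c (jac c0 q0 / dphi c0).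
  move=> cq cc hz.
  have -> : jac c0 q0 / dphi c0 = - jac c0 q0 / Gt c0 q0.
    by rewrite Gt0 invrN mulrN mulNr opprK.
  apply: (is_derive_implicit hG cGt) => //; first by rewrite Gt0 oppr_eq0.
  have {}hz : \forall q \near q0, (I (c q) q == phi (c q)) = (c q == c q).
    move: hz => [[U V] /= [Uc Vq] UV]; rewrite -cq in Uc.
    have U' : \forall q \near q0, U (c q) := cc _ Uc.
    have V' : \forall q \near q0, V q := Vq.
    by apply: filterS2 U' V' => q h1 h2; exact: (UV (c q, q)).
  by apply: filterS hz => q; rewrite eqxx /G /gap => /eqP ->; rewrite subrr.
move: (dc); rewrite neq_lt => /orP[dn|dp].
- have Gtp : 0 < Gt c0 q0 by rewrite Gt0 oppr_gt0.
  have [c [cq cc hp]] := implicit_branch hG cGt Gtp G0 cG.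
  have hz : nbhs (c0, q0) (fun p : R * R => (I p.1 p.2 == phi p.1) = (p.1 == c p.2)).
    apply: filterS hp => p; rewrite /G /gap subr_gt0 subr_lt0 => -[h1 h2].
    by rewrite !eq_le !leNgt h1 h2 andbC.
  exists c; split => //; first exact: finish.
  apply: filterS2 hz hp => p h0; rewrite /G /gap subr_gt0 subr_lt0 => -[h1 h2].
  by split => // dp; move: (lt_trans dn dp); rewrite ltxx.
- pose G' t q := - G t q; pose Gt' t q := - Gt t q.
  have hG' : derive_near G' Gt' c0 q0 by apply: filterS hG => p; exact: is_deriveN.
  have cGt' : {for (c0, q0), continuous (fun p : R * R => Gt' p.1 p.2)} by apply: cvgN; exact: cGt.
  have Gtp : 0 < Gt' c0 q0 by rewrite /Gt' Gt0 opprK.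
  have cG' : \forall t \near c0, {for q0, continuous (G' t)}.
    by apply: filterS cG => t ct; apply: cvgN; exact: ct.
  have G0' : G' c0 q0 = 0 by rewrite /G' G0 oppr0.
  have [c [cq cc hp]] := implicit_branch hG' cGt' Gtp G0' cG'.
  have hz : nbhs (c0, q0) (fun p : R * R => (I p.1 p.2 == phi p.1) = (p.1 == c p.2)).
    apply: filterS hp => p; rewrite /G' /G /gap oppr_gt0 oppr_lt0 subr_gt0 subr_lt0 => -[h1 h2].
    by rewrite !eq_le !leNgt h1 h2 andbC.
  exists c; split => //; first exact: finish.
  apply: filterS2 hz hp => p h0; rewrite /G' /G /gap oppr_gt0 oppr_lt0 subr_gt0 subr_lt0 => -[h1 h2].
  by split => // dn; move: (lt_trans dn dp); rewrite ltxx.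
Qed.

(** The restriction on the time allows t to be an end point of the interval. *)
Lemma gap_near q t e : `|q| < rho -> - T <= t <= T -> 0 < e ->
  nbhs (t, q) (fun p : R * R => - T <= p.1 <= T ->
    `|gap phi I q t - gap phi I p.2 p.1| < e).
Proof.
move=> hq ht e0; have e2 : 0 < e / 2 by rewrite divr_gt0.
have e4 : 0 < e / 4 by rewrite divr_gt0.
exists ([set s | `|gap phi I q t - gap phi I q s| < e / 2],
        [set z | `|z| < rho /\ `|q - z| < e / 4]).
  split; first by move=> /=; exact: (continuous_dist_lt (gap_cont box hI ht) e2).
  by apply: filterI; [exact: near_level|exact: near_dist_lt].
move=> [s z] /= [h1 [h2 h3]] hs.
have -> : gap phi I q t - gap phi I z s =
   (gap phi I q t - gap phi I q s) + (I s q - I s z) by rewrite /gap; ring.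
apply: le_lt_trans (ler_normD _ _) _.
by have := flow_lipschitz box hI hq h2 hs; lra.
Qed.

(** Each end of an arc follows its own branch.  That no other contact appears is
checked locally at every time t0 and then spread over the interval by
compactness: at an end of an arc the branch accounts for all nearby contacts,
elsewhere the gap keeps its sign and the moved ends keep their order relative
to the time. *)
Lemma arcs_persist q0 N (A B : 'I_N -> R) : `|q0| < rho -> active_arcs q0 A B ->
  exists A' B' : 'I_N -> R -> R,
  [/\ (forall k, A' k q0 = A k /\ B' k q0 = B k),
      (forall k, is_derive q0 1 (A' k) (jac (A k) q0 / dphi (A k))),
      (forall k, is_derive q0 1 (B' k) (jac (B k) q0 / dphi (B k))) &
      \forall q \near q0, active_arcs q (A'^~ q) (B'^~ q)].
Proof.
move=> hq arcs.
have inA k : - T < A k < T.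
  by have [h1 h2] := arcs_in arcs k; rewrite h1 (lt_trans (arcs_lt arcs k) h2).
have inB k : - T < B k < T.
  by have [h1 h2] := arcs_in arcs k; rewrite h2 (lt_trans h1 (arcs_lt arcs k)).
have cA k : contact q0 (A k).
  have hA : - T <= A k <= T by case/andP: (inA k) => *; rewrite !ltW.
  by split => //; apply/(arcs_contact arcs hA); exists k; left.
have cB k : contact q0 (B k).
  have hB : - T <= B k <= T by case/andP: (inB k) => *; rewrite !ltW.
  by split => //; apply/(arcs_contact arcs hB); exists k; right.
have nA k : dphi (A k) != 0 by rewrite lt_eqF// (arcs_entry arcs).
have nB k : dphi (B k) != 0 by rewrite gt_eqF// (arcs_exit arcs).
have [A' hA'] := choice (fun k => contact_branch hq (cA k) (nA k)).
have [B' hB'] := choice (fun k => contact_branch hq (cB k) (nB k)).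
have A0 k : A' k q0 = A k by case: (hA' k).
have B0 k : B' k q0 = B k by case: (hB' k).
have cA' k : {for q0, continuous (A' k)} by case: (hA' k) => _ d _; exact: is_derive_continuous d.
have cB' k : {for q0, continuous (B' k)} by case: (hB' k) => _ d _; exact: is_derive_continuous d.
exists A', B'; split => //; first by move=> k; case: (hA' k).
  by move=> k; case: (hB' k).
have tri (k l : 'I_N) : [\/ k = l, (k < l)%N | (l < k)%N].
  by case: (ltngtP k l) => [||/val_inj]; [constructor 2|constructor 3|constructor 1].
have ltA (k l : 'I_N) : (k < l)%N -> A k < A l.
  by move=> kl; exact: lt_trans (arcs_lt arcs k) (arcs_sep arcs kl).
have ltB (k l : 'I_N) : (k < l)%N -> B k < B l.
  by move=> kl; exact: lt_trans (arcs_sep arcs kl) (arcs_lt arcs l).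
have Ainj k l : A k = A l -> k = l.
  by move=> e; case: (tri k l) => // /ltA; rewrite e ltxx.
have Binj k l : B k = B l -> k = l.
  by move=> e; case: (tri k l) => // /ltB; rewrite e ltxx.
have AB k l : A k != B l.
  apply/eqP => e; case: (tri k l) => [kl|kl|kl].
  - by have := arcs_lt arcs k; rewrite e kl ltxx.
  - by have := lt_trans (ltA _ _ kl) (arcs_lt arcs l); rewrite e ltxx.
  - by have := arcs_sep arcs kl; rewrite e ltxx.
have notinA k l : A l < A k < B l -> False.
  move=> /andP[h1 h2]; case: (tri k l) => [kl|kl|kl].
  - by move: h1; rewrite kl ltxx.
  - by move: (lt_trans h1 (ltA _ _ kl)); rewrite ltxx.
  - by move: (lt_trans h2 (arcs_sep arcs kl)); rewrite ltxx.
have notinB k l : A l < B k < B l -> False.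
  move=> /andP[h1 h2]; case: (tri k l) => [kl|kl|kl].
  - by move: h2; rewrite kl ltxx.
  - by move: (lt_trans h1 (arcs_sep arcs kl)); rewrite ltxx.
  - by move: (lt_trans h2 (ltB _ _ kl)); rewrite ltxx.
pose P q t := - T <= t <= T ->
   (phi t < I t q <-> exists k, A' k q < t < B' k q) /\
   (I t q = phi t <-> exists k, t = A' k q \/ t = B' k q).
have main : \forall q \near q0, forall t, - T <= t <= T -> P q t.
  apply: (@near_itv _ _ (nbhs q0) _ (- T) T P) => t0 ht0.
  have nearA : nbhs (t0, q0) (fun p : R * R => forall k, A k != t0 ->
      (A' k p.2 < p.1) = (A k < t0) /\ p.1 != A' k p.2).
    apply: (@filter_forall _ _ _ (nbhs (t0, q0)) _) => k; have [->|ne] := eqVneq (A k) t0; first by apply: nearW.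
    rewrite -A0 in ne.
    have on := order_near (cA' k) ne; rewrite A0 in on.
    by apply: filterS on => p [h1 _ h3] _.
  have nearB : nbhs (t0, q0) (fun p : R * R => forall k, B k != t0 ->
      (p.1 < B' k p.2) = (t0 < B k) /\ p.1 != B' k p.2).
    apply: (@filter_forall _ _ _ (nbhs (t0, q0)) _) => k; have [->|ne] := eqVneq (B k) t0; first by apply: nearW.
    rewrite -B0 in ne.
    have on := order_near (cB' k) ne; rewrite B0 in on.
    by apply: filterS on => p [_ h2 h3] _.
  suff : nbhs (t0, q0) (fun p : R * R => P p.2 p.1) by [].
  have [[_ ct]|nc] := pselect (contact q0 t0).
    have [+ _] := arcs_contact arcs ht0 => /(_ ct)[k0 [e|e]]; subst t0.
    - have [_ _ hb] := hA' k0.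
      have nb p : (forall k, B k != A k0 -> (p.1 < B' k p.2) = (A k0 < B k) /\ p.1 != B' k p.2) ->
        forall k, (p.1 < B' k p.2) = (A k0 < B k) /\ p.1 != B' k p.2.
        by move=> h k; apply: h; rewrite eq_sym.
      apply: filterS3 nearA nearB hb => p hA /nb hB [h1 _ h2] hp.
      rewrite (h1 (arcs_entry arcs k0)); split.
        split => [h|[k /andP[k1 k2]]].
          by exists k0; rewrite h (hB k0).1 (arcs_lt arcs).
        have [e|ne] := eqVneq (A k) (A k0); first by rewrite -(Ainj _ _ e).
        move: k1 k2; rewrite (hA k ne).1 (hB k).1 => k1 k2.
        by exfalso; apply: (notinA k0 k); rewrite k1 k2.
      split => [/eqP|[k [e|e]]]; first by rewrite h2 => /eqP e; exists k0; left.
        have [e'|ne] := eqVneq (A k) (A k0).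
          by apply/eqP; rewrite h2 -(Ainj _ _ e'); apply/eqP.
        by have [_ /eqP] := hA k ne.
      by have [_ /eqP] := hB k.
    - have [_ _ hb] := hB' k0.
      have na p : (forall k, A k != B k0 -> (A' k p.2 < p.1) = (A k < B k0) /\ p.1 != A' k p.2) ->
        forall k, (A' k p.2 < p.1) = (A k < B k0) /\ p.1 != A' k p.2.
        by move=> h k; apply: h.
      apply: filterS3 nearA nearB hb => p /na hA hB [_ h1 h2] hp.
      rewrite (h1 (arcs_exit arcs k0)); split.
        split => [h|[k /andP[k1 k2]]].
          by exists k0; rewrite h (hA k0).1 (arcs_lt arcs).
        have [e|ne] := eqVneq (B k) (B k0); first by rewrite -(Binj _ _ e).
        move: k1 k2; rewrite (hA k).1 (hB k ne).1 => k1 k2.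
        by exfalso; apply: (notinB k0 k); rewrite k1 k2.
      split => [/eqP|[k [e|e]]]; first by rewrite h2 => /eqP e; exists k0; right.
        by have [_ /eqP] := hA k.
      have [e'|ne] := eqVneq (B k) (B k0).
        by apply/eqP; rewrite h2 -(Binj _ _ e'); apply/eqP.
      by have [_ /eqP] := hB k ne.
  have g0 : 0 < `|gap phi I q0 t0|.
    by rewrite normr_gt0 subr_eq0; apply/eqP => e; apply: nc.
  have neA k : A k != t0.
    by apply/eqP => e; apply: nc; rewrite -e.
  have neB k : B k != t0.
    by apply/eqP => e; apply: nc; rewrite -e.
  apply: filterS3 nearA nearB (gap_near hq ht0 g0) => p hA hB hg hp.
  have {hg} := hg hp => hg.
  have hne : I p.1 p.2 != phi p.1.
    apply/eqP => e; move: hg; have -> : gap phi I p.2 p.1 = 0 by rewrite /gap e subrr.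
    by rewrite subr0 ltxx.
  have hlt : (phi p.1 < I p.1 p.2) = (phi t0 < I t0 q0).
    move: hg g0; rewrite -[RHS]subr_gt0 -[LHS]subr_gt0 -!/(gap phi I _ _).
    move: (gap phi I q0 t0) (gap phi I p.2 p.1) => x y hg.
    rewrite normr_gt0 neq_lt => /orP[x0|x0].
      rewrite (ltr0_norm x0) in hg; rewrite [RHS]ltNge (ltW x0) /=; apply/negbTE; rewrite -leNgt.
      by move: hg; rewrite ltr_norml => /andP[? ?]; lra.
    rewrite (gtr0_norm x0) in hg; rewrite x0.
    by move: hg; rewrite ltr_norml => /andP[? ?]; lra.
  rewrite hlt; split.
    rewrite (arcs_active arcs ht0); split => -[k /andP[k1 k2]]; exists k.
      by rewrite (hA k (neA k)).1 (hB k (neB k)).1 k1.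
    by rewrite -(hA k (neA k)).1 -(hB k (neB k)).1 k1.
  split => [e|[k [e|e]]]; first by rewrite e eqxx in hne.
    by have [_ /eqP] := hA k (neA k).
  by have [_ /eqP] := hB k (neB k).
have n1 : \forall q \near q0, forall k, A' k q < B' k q.
  apply: (@filter_forall _ _ _ (nbhs q0) _) => k.
  have cd : {for q0, continuous (fun q => A' k q - B' k q)} by apply: cvgB; [exact: cA'|exact: cB'].
  have h0 : (fun q => A' k q - B' k q) q0 < 0 by rewrite /= A0 B0 subr_lt0 (arcs_lt arcs).
  by apply: filterS (continuous_lt cd h0) => q; rewrite subr_lt0.
have n2 : \forall q \near q0, forall k l : 'I_N, (k < l)%N -> B' k q < A' l q.
  apply: (@filter_forall _ _ _ (nbhs q0) _) => k; apply: (@filter_forall _ _ _ (nbhs q0) _) => l.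
  have [kl|nkl] := boolP (k < l)%N; last by apply: nearW.
  have cd : {for q0, continuous (fun q => B' k q - A' l q)} by apply: cvgB; [exact: cB'|exact: cA'].
  have h0 : (fun q => B' k q - A' l q) q0 < 0 by rewrite /= A0 B0 subr_lt0 (arcs_sep arcs kl).
  by apply: filterS (continuous_lt cd h0) => q; rewrite subr_lt0.
have n3 : \forall q \near q0, forall k, - T < A' k q /\ B' k q < T.
  apply: (@filter_forall _ _ _ (nbhs q0) _) => k; have [h1 h2] := arcs_in arcs k.
  rewrite -A0 in h1; rewrite -B0 in h2.
  by apply: filterI; [exact: (continuous_gt (cA' k) h1)|exact: (continuous_lt (cB' k) h2)].
have n4 : \forall q \near q0, forall k, dphi (A' k q) < 0.
  apply: (@filter_forall _ _ _ (nbhs q0) _) => k; apply: (@continuous_lt _ _ (fun q => dphi (A' k q))).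
    apply: (@continuous_cvg _ _ _ (nbhs q0) _ (A' k) dphi (A' k q0)) => //; last exact: cA'.
    by rewrite A0; apply: (dphi_cont box); case: (cA k).
  by rewrite A0 (arcs_entry arcs).
have n5 : \forall q \near q0, forall k, 0 < dphi (B' k q).
  apply: (@filter_forall _ _ _ (nbhs q0) _) => k; apply: (@continuous_gt _ _ (fun q => dphi (B' k q))).
    apply: (@continuous_cvg _ _ _ (nbhs q0) _ (B' k) dphi (B' k q0)) => //; last exact: cB'.
    by rewrite B0; apply: (dphi_cont box); case: (cB k).
  by rewrite B0 (arcs_exit arcs).
near=> q.
have hP : forall t, - T <= t <= T -> P q t by near: q.
split; try by near: q.
- by move=> t ht; have [] := hP t ht ht.
- by move=> t ht; have [] := hP t ht ht.
Unshelve. all: by end_near. Qed.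

End SecondDerivative.

(** * The second derivative in the initial level *)

Section SecondDerivativeFormula.
Context {R : realType}.
Variables (phi dphi : R -> R) (F Fx Fxx : R -> R -> R) (T r K K2 rho : R) (nu : nat).
Hypothesis box : scalar_box phi dphi F Fx Fxx T r K K2 rho nu.
Variable I : R -> R -> R.
Hypothesis hI : flow phi F T rho I.
Hypothesis nu0 : (0 < nu)%N.
Implicit Types (t s q x : R).
Notation mu := (@lebesgue_measure R).
Local Notation jac := (jac phi Fx T I).
Local Notation log_jac := (log_jac phi Fx T I).
Local Notation active_arcs := (active_arcs phi dphi T I).
Local Notation contact := (contact phi T I).
Local Notation prim := (prim Fx T I).

(** The arcs are disjoint, so at each active time exactly one summand survives. *)
Lemma arcs_integral q N (A B : 'I_N -> R) (C : R) (h : R -> R) :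
  active_arcs q A B -> bmeas (- T) T C h ->
  \int[mu]_(s in `[- T, T]) cut (phi s) (I s q) (h s) =
  \sum_(k < N) (\int[mu]_(s in `[- T, B k]) h s - \int[mu]_(s in `[- T, A k]) h s).
Proof.
move=> arcs hh; pose f (k : 'I_N) s := if A k < s < B k then h s else 0.
have hf k : bmeas (- T) T C (f k) /\ \int[mu]_(s in `[- T, T]) f k s =
    \int[mu]_(s in `[- T, B k]) h s - \int[mu]_(s in `[- T, A k]) h s.
  have [h1 h2] := arcs_in arcs k.
  by apply: integral_arc => //; [exact: ltW|exact: (arcs_lt arcs)|exact: ltW].
under [RHS]eq_bigr => k _ do rewrite -(hf k).2.
have [_ <-] := @integral_sum R 'I_N (index_enum 'I_N) (- T) T C f (fun k => (hf k).1).
apply: eq_Rintegral => s; rewrite inE /= in_itv /= => hs.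
rewrite /cut; case: ifPn => hact.
  have [k /[dup] hk /andP[k1 k2]] := (arcs_active arcs hs).1 hact.
  rewrite (bigD1 k)//= /f hk big1 ?addr0// => l lk; case: ifP => // /andP[l1 l2].
  case: (ltngtP k l) => [kl|kl|/val_inj e]; last by rewrite e eqxx in lk.
    by have := lt_trans (lt_trans l1 k2) (arcs_sep arcs kl); rewrite ltxx.
  by have := lt_trans (lt_trans k1 l2) (arcs_sep arcs kl); rewrite ltxx.
rewrite big1// => k _; rewrite /f; case: ifP => // hk.
by case/negP: hact; apply/(arcs_active arcs hs); exists k.
Qed.

(** The second derivative of the trajectory at time T in its initial level, written
for an arbitrary list of arcs so that its continuity can be studied along the
branches. *)
Definition curvature q N (A B : 'I_N -> R) : R :=
  jac T q * (\sum_(k < N) (Fx (B k) (I (B k) q) * jac (B k) q / dphi (B k)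
                         - Fx (A k) (I (A k) q) * jac (A k) q / dphi (A k))
    + \int[mu]_(s in `[- T, T]) cut (phi s) (I s q) (Fxx s (I s q) * jac s q)).

Let arcs_interior q N (A B : 'I_N -> R) : active_arcs q A B ->
  (forall k, - T < A k < T) /\ (forall k, - T < B k < T).
Proof.
move=> arcs; split=> k; have [h1 h2] := arcs_in arcs k.
  by rewrite h1 (lt_trans (arcs_lt arcs k)).
by rewrite h2 (lt_trans h1 (arcs_lt arcs k)).
Qed.

(** Leibniz' rule at a moving end point. *)
Lemma prim_along_branch q c (c' : R) : `|q| < rho -> - T < c q < T ->
  is_derive q 1 c c' ->
  is_derive q 1 (fun z => prim (c z) z)
    (Fx (c q) (I (c q) q) * c' + \int[mu]_(s in `[- T, c q]) (Fxx s (I s q) * jac s q)).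
Proof.
move=> hq hc dc; apply: (@is_derive_along_curve _ prim (fun t q => Fx t (I t q))) => //.
- apply: filterS (near_time_level hq hc) => p [hp1 hp2].
  exact: (prim_is_derive_time box hI).
- by apply: (along_flow_cont2 box hI) => //; exact: (Fx_cont box).
- by apply: (prim_is_derive_level box hI nu0 hq); case/andP: hc => *; rewrite !ltW.
Qed.

(** Near q the quantity log J(T) equals a sum of values of prim at the moved ends,
so each end contributes F_I J / phi' and the active set the integral of F_II J. *)
Lemma jac_is_derive_level q N (A B : 'I_N -> R) : `|q| < rho -> active_arcs q A B ->
  is_derive q 1 (jac T) (curvature q A B).
Proof.
move=> hq arcs; have [A' [B' [AB0 dA dB near_arcs]]] := arcs_persist box hI nu0 hq arcs.
have [inA inB] := arcs_interior arcs.
have [T0 _ _ _ _] := box_facts box.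
have dlog : is_derive q 1 (log_jac T) (\sum_(k < N)
   ((Fx (B k) (I (B k) q) * (jac (B k) q / dphi (B k)) +
       \int[mu]_(s in `[- T, B k]) (Fxx s (I s q) * jac s q)) -
    (Fx (A k) (I (A k) q) * (jac (A k) q / dphi (A k)) +
       \int[mu]_(s in `[- T, A k]) (Fxx s (I s q) * jac s q)))).
  apply: (@near_eq_is_derive _ _ _
    (\sum_(k < N) (fun z => prim (B' k z) z - prim (A' k z) z))).
    apply: filterS2 (near_level hq) near_arcs => z hz arcs_z.
    rewrite fct_sumE /log_jac; apply/esym; apply: (arcs_integral arcs_z).
    by apply: (along_flow_bmeas box hI) => //; [exact: (Fx_cont box)|exact: (Fx_le box)].
  apply: is_derive_sum => k; have [A0 B0] := AB0 k.
  apply: is_deriveB.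
    have := prim_along_branch hq _ (dB k); rewrite B0; apply; exact: inB.
  have := prim_along_branch hq _ (dA k); rewrite A0; apply; exact: inA.
have := @is_derive1_comp _ expR (log_jac T) q _ _ (is_derive_expR _) dlog.
move=> h; apply: is_derive_eq h _.
rewrite /curvature -/(jac T q); congr (_ * _).
rewrite (arcs_integral arcs (curvature_bmeas box hI hq)) -big_split /=.
by apply: eq_bigr => k _; rewrite !mulrA opprD addrACA.
Qed.

(** On a neighbourhood the derivative is given by curvature along the branches, and
every term of it is continuous in the level. *)
Lemma jac_derive_cont q N (A B : 'I_N -> R) : `|q| < rho -> active_arcs q A B ->
  {for q, continuous ((jac T)^`()%classic)}.
Proof.
move=> hq arcs; have [A' [B' [AB0 dA dB near_arcs]]] := arcs_persist box hI nu0 hq arcs.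
have [inA inB] := arcs_interior arcs.
have eqc z (A1 B1 : 'I_N -> R) : `|z| < rho -> active_arcs z A1 B1 ->
    (jac T)^`()%classic z = curvature z A1 B1.
  move=> hz az; have d := jac_is_derive_level hz az.
  by rewrite derive1E (@derive_val _ _ _ _ _ _ _ d).
have cc : {for q, continuous (fun z => curvature z (A'^~ z) (B'^~ z))}.
  have term (c : R -> R) c' : is_derive q 1 c c' -> - T < c q < T -> dphi (c q) != 0 ->
      {for q, continuous (fun z => Fx (c z) (I (c z) z) * jac (c z) z / dphi (c z))}.
    move=> dc hc nc; have hc' : - T <= c q <= T by case/andP: hc => *; rewrite !ltW.
    have cc := is_derive_continuous dc.
    apply: cvgM; last first.
      apply: cvgV => //.
      by apply: (@continuous_cvg _ _ _ (nbhs q) _ c dphi (c q)) => //; exact: (dphi_cont box).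
    apply: cvgM.
      apply: (@continuous2_cvg _ _ _ _ (nbhs q) _ c id (fun t z => Fx t (I t z)) (c q) q) => //.
      by apply: (along_flow_cont2 box hI) => //; exact: (Fx_cont box).
    apply: (@continuous2_cvg _ _ _ _ (nbhs q) _ c id jac (c q) q) => //.
    exact: (jac_cont2 box hI nu0).
  have [T0 _ _ _ _] := box_facts box.
  have TT : - T <= T <= T by rewrite lexx; lra.
  apply: cvgM; first exact: (jac_cont_level box hI nu0).
  apply: cvgD.
    apply: sum_continuous => k; have [A0 B0] := AB0 k.
    apply: cvgB.
    - by apply: (term _ _ (dB k)); rewrite B0 ?gt_eqF// (arcs_exit arcs).
    - by apply: (term _ _ (dA k)); rewrite A0 ?lt_eqF// (arcs_entry arcs).
  apply: (@active_integral_cont _ _ _ _ _ _ _ _ _ _ _ _ box _ hI nu0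
    (fun z s => Fxx s (I s z) * jac s z) (K2 * (4 / 3))) => //.
    by move=> z hz; exact: (curvature_bmeas box hI).
  move=> s hs; apply: cvgM.
    by apply: (along_flow_cont_level box hI) => //; exact: (Fxx_cont box).
  exact: (jac_cont_level box hI nu0).
rewrite /prop_for /continuous_at.
have near_arcs' : \forall z \near q, curvature z (A'^~ z) (B'^~ z) = (jac T)^`()%classic z.
  by apply: filterS2 (near_level hq) near_arcs => z hz az; rewrite (eqc z _ _ hz az).
rewrite -(nbhs_singleton near_arcs').
by apply: cvg_trans cc; apply: near_eq_cvg.
Qed.

End SecondDerivativeFormula.

(** * Directional smoothness and the Euclidean norm *)

Section RealCk.
Context {R : realType}.
Implicit Types (U : set R) (f g : R -> R) (k : nat).

Lemma continuous_near_eq (V : topologicalType) (f g : V -> R) (x : V) :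
  (\forall y \near x, f y = g y) -> {for x, continuous f} -> {for x, continuous g}.
Proof.
move=> fg cf; rewrite /prop_for /continuous_at -(nbhs_singleton fg).
by apply: cvg_trans cf; apply: near_eq_cvg.
Qed.

Lemma Ck_on_eq k U f g : open U -> (forall x, U x -> f x = g x) ->
  Ck_on k U f -> Ck_on k U g.
Proof.
move=> oU; elim: k f g => [|k IH] f g fg.
  move=> cf x Ux; apply: continuous_near_eq (cf x Ux).
  by apply: filterS (open_nbhs_nbhs (conj oU Ux)) => y /fg.
have fgn x : U x -> \forall y \near x, f y = g y.
  by move=> Ux; apply: filterS (open_nbhs_nbhs (conj oU Ux)) => y /fg.
move=> [df dvf]; split.
  move=> x Ux; apply/derivable1_diffP; apply: near_eq_derivable (fgn x Ux) _.
  by apply/derivable1_diffP; exact: df.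
by move=> v; apply: IH (dvf v) => x Ux; apply: near_eq_derive; exact: fgn.
Qed.

Lemma Ck_on_cst0 k U : Ck_on k U (cst 0 : R -> R).
Proof.
elim: k => [|k IH] /=; first by move=> x _; exact: cvg_cst.
split; first by move=> x _; exact: differentiable_cst.
move=> v; have -> : 'D_v (cst 0 : R -> R) = cst 0 by apply/funext => x; rewrite derive_cst.
exact: IH.
Qed.

Lemma is_derive_scaled f (x v l : R) : is_derive x 1 f l -> 'D_v f x = v * l.
Proof.
move=> dl; have df : differentiable f x by apply/derivable1_diffP; case: dl.
rewrite -(@derive_val _ _ _ _ _ _ _ dl) !deriveE//.
have e : v = v *: (1 : R) by rewrite /GRing.scale /= mulr1.
by rewrite {1}e linearZ.
Qed.

Lemma C2_on_real U f (f1 f2 : R -> R) : open U ->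
  (forall x, U x -> is_derive x 1 f (f1 x)) ->
  (forall x, U x -> is_derive x 1 f1 (f2 x)) ->
  (forall x, U x -> {for x, continuous f2}) -> Ck_on 2 U f.
Proof.
move=> oU d1 d2 c2; split.
  by move=> x /d1[df _]; apply/derivable1_diffP.
move=> v; apply: (@Ck_on_eq 1 U (fun x => v * f1 x)) => //.
  by move=> x /d1 dx; rewrite (is_derive_scaled v dx).
have dv x : U x -> is_derive x 1 (fun x => v * f1 x) (v * f2 x).
  by move=> /d2 dx; exact: is_deriveZ.
split; first by move=> x /dv[df _]; apply/derivable1_diffP.
move=> w; apply: (@Ck_on_eq 0 U (fun x => w * (v * f2 x))) => //.
  by move=> x /dv dx; rewrite (is_derive_scaled w dx).
by move=> x Ux; apply: cvgM; [exact: cvg_cst|apply: cvgM; [exact: cvg_cst|exact: c2]].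
Qed.

End RealCk.

Section Directional.
Context {R : realType}.

(** A directional derivative sees only the restriction of the map to a line. *)
Lemma derive_on_line (V W : normedModType R) (G : V -> R) (g : W -> R) (p v : V) (a w : W) :
  (forall h : R, G (h *: v + p) = g (h *: w + a)) ->
  (derivable G p v -> derivable g a w) /\ 'D_v G p = 'D_w g a.
Proof.
move=> hG.
have e : (fun h : R => h^-1 *: ((G \o shift p) (h *: v) - G p)) =
         (fun h : R => h^-1 *: ((g \o shift a) (h *: w) - g a)).
  apply/funext => h /=; have := hG 0; rewrite !scale0r !add0r => <-.
  by rewrite hG.
by split; rewrite /derivable /derive e.
Qed.

Lemma differentiable_line_derive (V : normedModType R) (G : V -> R) (g : R -> R)
    (p v : V) (a : R) : differentiable G p ->
  (forall h : R, G (h *: v + p) = g (h + a)) -> is_derive a 1 g ('D_v G p).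
Proof.
move=> dG hG; have hG' h : G (h *: v + p) = g (h *: (1 : R) + a).
  by rewrite hG /GRing.scale /= mulr1.
have [h1 h2] := derive_on_line hG'.
by split; [apply: h1; exact: diff_derivable|rewrite h2].
Qed.

Variable m : nat.
Notation E := ('rV[R]_m).

(** Time derivatives of Phi at fixed parameter are the iterated derivatives in the
direction (1, 0); as functions of both variables they inherit joint regularity. *)
Lemma iterated_time_derivative (Phi : R -> E -> R) (T delta : R) nu k :
  let U := [set p : R * E | `|p.1| < T /\ enorm p.2 < delta] in
  Ck_on nu U (fun p => Phi p.1 p.2) -> (k <= nu)%N ->
  exists G : R * E -> R, [/\ Ck_on (nu - k) U G,
    (forall (t : R) th, `|t| < T -> enorm th < delta -> G (t, th) = (Phi^~ th)^`(k)%classic t) &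
    (forall j (t : R) th, (j < k)%N -> `|t| < T -> enorm th < delta ->
       is_derive t 1 ((Phi^~ th)^`(j)%classic) ((Phi^~ th)^`(j.+1)%classic t))].
Proof.
move=> U hPhi; elim: k => [_|k IH kn].
  by exists (fun p => Phi p.1 p.2); rewrite subn0.
have [G [cG eG dG]] := IH (ltnW kn).
have nuk : (nu - k = (nu - k.+1).+1)%N by lia.
rewrite nuk in cG; have [diffG dirG] := cG.
have step (t : R) (th : E) : `|t| < T -> enorm th < delta ->
    is_derive t 1 ((Phi^~ th)^`(k)%classic) ('D_((1, 0) : R * E) G (t, th)).
  move=> ht hth.
  have h : forall h : R, G (h *: ((1, 0) : R * E) + (t, th)) = (fun s => G (s, th)) (h + t).
    by move=> h /=; congr G; apply: injective_projections; rewrite /= ?scaler0 ?add0r// /GRing.scale /= mulr1.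
  apply: near_eq_is_derive (differentiable_line_derive (diffG (t, th) (conj ht hth)) h).
  have e0 : 0 < T - `|t| by rewrite subr_gt0.
  apply: filterS (near_dist_lt t e0) => s hs; apply: eG => //.
  rewrite -(subrK t s); apply: le_lt_trans (ler_normD _ _) _.
  by rewrite distrC; lra.
exists ('D_((1, 0) : R * E) G); split; first exact: dirG.
  move=> t th ht hth; have d := step t th ht hth.
  by rewrite derive1nS derive1E (@derive_val _ _ _ _ _ _ _ d).
move=> j t th; rewrite ltnS leq_eqVlt => /predU1P[->|jk] ht hth; last exact: dG.
have d := step t th ht hth; rewrite derive1nS derive1E (@derive_val _ _ _ _ _ _ _ d).
exact: d.
Qed.

Lemma Ck_on_continuous (V : normedModType R) k (U : set V) (G : V -> R) x :
  Ck_on k U G -> U x -> {for x, continuous G}.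
Proof.
case: k => [|k] /=; first exact.
by move=> [dG _] /dG; exact: differentiable_continuous.
Qed.

Lemma space_derivatives (B : R -> R -> E -> R) (T r delta : R) :
  Ck_on 2 [set p : R * R * E | [/\ `|p.1.1| < T, `|p.1.2| < r & enorm p.2 < delta] ]
    (fun p => B p.1.1 p.1.2 p.2) ->
  exists Bx Bxx : R -> R -> E -> R, forall (t x : R) th,
    `|t| < T -> `|x| < r -> enorm th < delta ->
    [/\ is_derive x 1 (fun u => B t u th) (Bx t x th),
        is_derive x 1 (fun u => Bx t u th) (Bxx t x th),
        {for (t, x, th), continuous (fun p : R * R * E => B p.1.1 p.1.2 p.2)},
        {for (t, x, th), continuous (fun p : R * R * E => Bx p.1.1 p.1.2 p.2)} &
        {for (t, x, th), continuous (fun p : R * R * E => Bxx p.1.1 p.1.2 p.2)}].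
Proof.
move=> [d0 hB]; pose v : R * R * E := ((0, 1), 0).
have [d1 hB1] := hB v; have c2 := hB1 v.
exists (fun t x th => 'D_v (fun p => B p.1.1 p.1.2 p.2) (t, x, th)).
exists (fun t x th => 'D_v ('D_v (fun p => B p.1.1 p.1.2 p.2)) (t, x, th)).
move=> t x th ht hx hth.
have eta (G : R * R * E -> R) : (fun p : R * R * E => G (p.1.1, p.1.2, p.2)) = G.
  by apply/funext => -[[]].
have ceta (G : R * R * E -> R) : {for (t, x, th), continuous G} ->
    {for (t, x, th), continuous (fun p : R * R * E =>
      (fun t x th => G (t, x, th)) p.1.1 p.1.2 p.2)} by rewrite /= eta.
have line (h : R) : h *: v + (t, x, th) = (t, h + x, th).
  apply: injective_projections => /=; last by rewrite scaler0 add0r.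
  by apply: injective_projections; rewrite /= /GRing.scale /= ?mulr0 ?mulr1 ?add0r.
split.
- by apply: (differentiable_line_derive (d0 (t, x, th) _)) => // h; rewrite line.
- by apply: (differentiable_line_derive (d1 (t, x, th) _)) => // h; rewrite line.
- by apply: differentiable_continuous; exact: d0.
- have c1 : differentiable ('D_v (fun p => B p.1.1 p.1.2 p.2)) (t, x, th) by exact: d1.
  exact: (ceta _ (differentiable_continuous c1)).
- exact: (ceta _ (c2 (t, x, th) _)).
Qed.

End Directional.

Section EuclideanNorm.
Context {R : realType} {m : nat}.
Notation E := ('rV[R]_m).
Implicit Types (th : E).

Lemma enorm_ge0 th : 0 <= enorm th.
Proof. exact: sqrtr_ge0. Qed.

Lemma enorm0 : enorm (0 : E) = 0.
Proof. by rewrite /enorm big1 ?sqrtr0// => i _; rewrite mxE expr0n. Qed.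

(** The topology comes from the sup norm while the smallness conditions are
Euclidean; one inequality is enough to pass from neighbourhoods to radii. *)
Lemma norm_le_enorm th : `|th| <= enorm th.
Proof.
rewrite (_ : `|th| = mx_norm th)// mx_normrE; apply/bigmax_leP; split => [|[i j] _ /=]; first exact: enorm_ge0.
rewrite (ord1 i) -sqrtr_sqr /enorm ler_sqrt; last by apply: sumr_ge0 => k _; exact: sqr_ge0.
by rewrite (bigD1 j)//= lerDl; apply: sumr_ge0 => k _; exact: sqr_ge0.
Qed.

Lemma enorm_continuous : continuous (@enorm R m).
Proof.
move=> th; apply: (@continuous_cvg _ _ _ (nbhs th) _ (fun th : E => \sum_(i < m) th ord0 i ^+ 2)
  (@Num.sqrt R)); first exact: sqrt_continuous.
apply: (@sum_continuous _ _ _ _ (fun i (th : E) => th ord0 i ^+ 2)) => i.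
apply: (@continuous_cvg _ _ _ (nbhs th) _ (fun th : E => th ord0 i) (fun x : R => x ^+ 2)).
  exact: exprn_continuous.
exact: coord_continuous.
Qed.

Lemma near_enorm_lt th d : enorm th < d -> \forall z \near th, enorm z < d.
Proof. by apply: continuous_lt; exact: enorm_continuous. Qed.

Lemma near_param0 (P : set (R * E)) : nbhs ((0, 0) : R * E) P ->
  exists2 d, 0 < d & forall (q : R) th, `|q| + enorm th < d -> P (q, th).
Proof.
move=> /nbhs_ballP[d /= d0 hd]; exists d => // q th h; apply: hd; split => /=.
  rewrite /ball /= sub0r normrN; apply: le_lt_trans h; rewrite lerDl; exact: enorm_ge0.
rewrite -ball_normE /ball_ /= sub0r normrN; apply: le_lt_trans (norm_le_enorm th) _.
by apply: le_lt_trans h; rewrite lerDr.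
Qed.

Lemma near_theta0 (P : set E) : nbhs (0 : E) P ->
  exists2 d, 0 < d & forall th, enorm th < d -> P th.
Proof.
move=> /nbhs_ballP[d /= d0 hd]; exists d => // th h; apply: hd.
rewrite -ball_normE /ball_ /= sub0r normrN; by apply: le_lt_trans (norm_le_enorm th) _.
Qed.

End EuclideanNorm.

(** * The common box *)

Section ParameterBox.
Context {R : realType} {m : nat}.
Notation E := ('rV[R]_m).
Implicit Types (th : E) (t x q : R).

(** The I-derivatives of (I - Phi) B, in terms of candidates Bx and Bxx for those
of B. *)
Definition field_F_I (Phi : R -> E -> R) (B Bx : R -> R -> E -> R) t x th : R :=
  B t x th + (x - Phi t th) * Bx t x th.
Definition field_F_I2 (Phi : R -> E -> R) (Bx Bxx : R -> R -> E -> R) t x th : R :=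
  2 * Bx t x th + (x - Phi t th) * Bxx t x th.

(** The data of the shrunk box.  Each parameter gives a scalar box with the same
constants; the other fields are joint continuity, the sign of B, and the
comparison of Phi_theta with Phi_0 >= (a/2) |t|^nu. *)
Record param_box (Phi : R -> E -> R) (B Bx Bxx : R -> R -> E -> R)
    (T r d rho K K2 b0 a beta : R) (nu : nat) : Prop := ParamBox {
  pb_scalar : forall th, enorm th < d ->
    scalar_box (Phi^~ th) (dPhi Phi th) (fun t x => field_F Phi B t x th)
      (fun t x => field_F_I Phi B Bx t x th) (fun t x => field_F_I2 Phi Bx Bxx t x th)
      T r K K2 rho nu;
  pb_d_gt0 : 0 < d;
  pb_b0_gt0 : 0 < b0;
  pb_a_gt0 : 0 < a;
  pb_sign : forall t x th, `|t| <= T -> `|x| <= r -> enorm th < d ->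
    Num.sg (B t x th) = Num.sg beta /\ b0 <= `|B t x th|;
  pb_Phi_cont : forall t th, `|t| <= T -> enorm th < d ->
    {for (t, th), continuous (fun p : R * E => Phi p.1 p.2)};
  pb_dPhi_cont : forall t th, `|t| <= T -> enorm th < d ->
    {for (t, th), continuous (fun p : R * E => dPhi Phi p.2 p.1)};
  pb_B_cont : forall t x th, `|t| <= T -> `|x| <= r -> enorm th < d ->
    {for (t, x, th), continuous (fun p : R * R * E => B p.1.1 p.1.2 p.2)};
  pb_Bx_cont : forall t x th, `|t| <= T -> `|x| <= r -> enorm th < d ->
    {for (t, x, th), continuous (fun p : R * R * E => Bx p.1.1 p.1.2 p.2)};
  pb_Phi0_ge : forall t, `|t| <= T -> a / 2 * `|t| ^+ nu <= Phi t 0;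
  pb_Phi00 : Phi 0 0 = 0;
  pb_dPhi00 : dPhi Phi 0 0 = 0;
  pb_Phi_close : forall t th, `|t| <= T -> enorm th < d ->
    `|Phi t th - Phi t 0| < rho / 2;
  pb_field_F_II : forall t x th, `|t| <= T -> `|x| <= r -> enorm th < d ->
    field_F_II Phi B t x th = field_F_I2 Phi Bx Bxx t x th }.

Lemma slice_continuous (H : R * R * E -> R) t x th :
  {for (t, x, th), continuous H} ->
  {for (t, x), continuous (fun p : R * R => H (p.1, p.2, th))}.
Proof.
move=> cH A /cH [[U V] /= [Utx Vth] hUV]; move: Utx => [[U1 U2] /= [h1 h2] hU].
exists (U1, U2) => //= -[s y] /= [s1 y2]; apply: hUV; split => /=.
  exact: (hU (s, y)).
exact: nbhs_singleton Vth.
Qed.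

Lemma slice_time_continuous (H : R * E -> R) t th :
  {for (t, th), continuous H} -> {for t, continuous (fun s => H (s, th))}.
Proof.
move=> cH A /cH [[U V] /= [Ut Vth] hUV]; apply: filterS Ut => s Us.
by apply: hUV; split => //=; exact: nbhs_singleton Vth.
Qed.

Section ThresholdCurve.
Variables (nu : nat) (Phi : R -> E -> R) (T delta a : R).
Hypotheses (hnu2 : (2 <= nu)%N) (hT : 0 < T) (hdelta : 0 < delta).
Hypothesis hPhi : Ck_on nu [set p : R * E | `|p.1| < T /\ enorm p.2 < delta]
  (fun p => Phi p.1 p.2).
Hypothesis ha : 0 < a.
Hypothesis hPhi0 : (fun t : R => Phi t 0 - a * t ^+ nu) =o_ (nbhs (0 : R)) (fun t : R => `|t| ^+ nu).

Lemma Phi_time_derivatives k t th : (k < nu)%N -> `|t| < T -> enorm th < delta ->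
  is_derive t 1 ((Phi^~ th)^`(k)%classic) ((Phi^~ th)^`(k.+1)%classic t).
Proof.
move=> kn ht hth; have [G [_ _ h]] := iterated_time_derivative hPhi (leqnn nu).
exact: h.
Qed.

Lemma Phi_joint_continuous t th : `|t| < T -> enorm th < delta ->
  {for (t, th), continuous (fun p : R * E => Phi p.1 p.2)}.
Proof. by move=> ht hth; apply: Ck_on_continuous hPhi _. Qed.

Lemma enorm_near_itv t th : `|t| < T -> enorm th < delta ->
  nbhs (t, th) (fun p : R * E => `|p.1| < T /\ enorm p.2 < delta).
Proof.
move=> ht hth; exists ([set s | `|s| < T], [set z | enorm z < delta]) => //.
split => /=; last exact: near_enorm_lt.
have e0 : 0 < T - `|t| by rewrite subr_gt0.
apply: filterS (near_dist_lt t e0) => s; rewrite distrC => hs.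
by rewrite -(subrK t s); apply: le_lt_trans (ler_normD _ _) _; lra.
Qed.

Lemma dPhi_joint_continuous t th : `|t| < T -> enorm th < delta ->
  {for (t, th), continuous (fun p : R * E => dPhi Phi p.2 p.1)}.
Proof.
move=> ht hth; have n1 : (1 <= nu)%N by exact: ltnW.
have [G [cG eG _]] := iterated_time_derivative hPhi n1.
apply: (continuous_near_eq _ (Ck_on_continuous cG (conj ht hth : _ (t, th)))).
apply: filterS (enorm_near_itv ht hth) => -[s z] /= [hs hz].
by rewrite eG.
Qed.

Lemma Phi0_lower : exists2 d, 0 < d & forall t, `|t| < d ->
  `|Phi t 0 - a * t ^+ nu| <= a / 2 * `|t| ^+ nu.
Proof.
have a2 : 0 < a / 2 by rewrite divr_gt0.
have := hPhi0; move/eqoP => /(_ _ a2) /nbhs_ballP[d /= d0 hd].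
exists d => // t ht; have := hd t; rewrite /ball /= sub0r normrN => /(_ ht).
by rewrite [in X in _ <= _ * X]ger0_norm ?exprn_ge0.
Qed.

Lemma Phi00 : Phi 0 0 = 0.
Proof.
have [d d0 /(_ 0)] := Phi0_lower; rewrite normr0 => /(_ d0).
rewrite !expr0n; have -> : (nu == 0)%N = false by rewrite gtn_eqF// ltnW.
by rewrite !mulr0 subr0 normr_le0 => /eqP.
Qed.

(** Phi_0 is bounded by a multiple of t^2 near 0, because nu >= 2. *)
Lemma dPhi00 : dPhi Phi 0 0 = 0.
Proof.
have e00 : enorm (0 : E) < delta by rewrite enorm0.
have t00 : `|0 : R| < T by rewrite normr0.
have nu0 : (0 < nu)%N := ltnW hnu2.
have := Phi_time_derivatives nu0 t00 e00; rewrite derive1n0 derive1n1 -/(dPhi Phi 0 0) => dd.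
have [d d0 hd] := Phi0_lower.
suff d0' : is_derive (0 : R) 1 (Phi^~ 0) 0.
  by rewrite -(@derive_val _ _ _ _ _ _ _ dd) (@derive_val _ _ _ _ _ _ _ d0').
pose k z := if z == 0 then 0 else Phi z 0 / z.
have k0 : k 0 = 0 by rewrite /k eqxx.
rewrite -[X in is_derive _ _ _ X]k0; apply: (@is_derive_slope _ (Phi^~ 0) k).
  near=> z; rewrite Phi00 /k !subr0; case: eqVneq => [->|z0]; rewrite ?mulr0 ?Phi00// divfK//.
apply/cvgrPdist_lt => e e0.
have e2 : 0 < e / (2 * a) by rewrite divr_gt0// mulr_gt0.
near=> z; rewrite k0 sub0r normrN /k; case: eqVneq => [_|z0]; first by rewrite normr0.
have zd : `|z| < d by rewrite -normrN -sub0r; near: z; exact: near_dist_lt.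
have z1 : `|z| < 1 by rewrite -normrN -sub0r; near: z; exact: near_dist_lt.
have ze : `|z| < e / (2 * a) by rewrite -normrN -sub0r; near: z; exact: near_dist_lt.
have zn0 : 0 < `|z| by rewrite normr_gt0.
have hz : `|Phi z 0| <= 2 * a * (`|z| * `|z|).
  have -> : Phi z 0 = (Phi z 0 - a * z ^+ nu) + a * z ^+ nu by rewrite subrK.
  apply: le_trans (ler_normD _ _) _; rewrite normrM normrX (gtr0_norm ha).
  have h1 := hd z zd.
  have h2 : `|z| ^+ nu <= `|z| * `|z|.
    by rewrite -expr2; apply: ler_wiXn2l => //; rewrite ltW.
  have h3 := ler_wpM2l (ltW ha) h2.
  have := mulr_ge0 (ltW ha) (exprn_ge0 nu (normr_ge0 z)); lra.
rewrite normrM normfV ltr_pdivrMr//; apply: le_lt_trans hz _.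
rewrite mulrA ltr_pM2r//; move: ze; rewrite ltr_pdivlMr ?mulr_gt0//.
by rewrite mulrC.
Unshelve. all: by end_near. Qed.

End ThresholdCurve.
End ParameterBox.

(** Order of the choices: first a neighbourhood where B, its derivatives and Phi
are controlled, which fixes the Lipschitz constant K; then a time T1 with
2 K T1 <= 1/4; then r1 below half the height (a/2) T1^nu of Phi_0 at the ends,
and rho = r1 / 3; last the parameter germ, so small that Phi_theta stays
within rho / 2 of Phi_0. *)
Lemma param_box_exists (R : realType) (m nu : nat)
  (Phi : R -> 'rV[R]_m -> R) (B : R -> R -> 'rV[R]_m -> R)
  (T r delta a kappa beta : R)
  (hnu2 : (2 <= nu)%N) (hnu : ~~ odd nu)
  (hT : 0 < T) (hr : 0 < r) (hdelta : 0 < delta)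
  (hPhi : Ck_on nu [set p : R * 'rV[R]_m | `|p.1| < T /\ enorm p.2 < delta]
            (fun p => Phi p.1 p.2))
  (hB : Ck_on 2 [set p : R * R * 'rV[R]_m |
                   [/\ `|p.1.1| < T, `|p.1.2| < r & enorm p.2 < delta] ]
            (fun p => B p.1.1 p.1.2 p.2))
  (ha : 0 < a)
  (hPhi0 : (fun t : R => Phi t 0 - a * t ^+ nu)
             =o_ (nbhs (0 : R)) (fun t : R => `|t| ^+ nu))
  (hkappa : 0 < kappa)
  (hPhinu : forall (t : R) (th : 'rV[R]_m), `|t| < T -> enorm th < delta ->
     kappa <= ((Phi ^~ th)^`(nu))%classic t)
  (hbeta : B 0 0 0 = beta) (hbeta0 : beta != 0) : exists Bx Bxx T1 r1 d1 rho K K2 b0,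
  [/\ 0 < T1 < T, 0 < r1 < r, d1 <= delta &
      param_box Phi B Bx Bxx T1 r1 d1 rho K K2 b0 a beta nu].
Proof.
have [Bx [Bxx hBx]] := space_derivatives hB.
have z1 : `|0 : R| < T by rewrite normr0.
have z2 : `|0 : R| < r by rewrite normr0.
have z3 : enorm (0 : 'rV[R]_m) < delta by rewrite enorm0.
have [_ _ cB cBx cBxx] := hBx 0 0 0 z1 z2 z3.
have bb : 0 < `|beta| by rewrite normr_gt0.
have bb2 : 0 < `|beta| / 2 by rewrite divr_gt0.
pose M1 := `|Bx 0 0 0| + 1; pose M2 := `|Bxx 0 0 0| + 1.
have M10 : 1 <= M1 by rewrite /M1 lerDr.
have M20 : 1 <= M2 by rewrite /M2 lerDr.
have n1 := continuous_dist_lt cB bb2.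
have n2 := continuous_dist_lt cBx ltr01.
have n3 := continuous_dist_lt cBxx ltr01.
have [e1 /= e10 he1] := (nbhs_ballP ((0, 0, 0) : R * R * 'rV[R]_m) _).1 (filterI n1 (filterI n2 n3)).
have n4 := continuous_dist_lt (Phi_joint_continuous hPhi z1 z3) ltr01.
have [e2 /= e20 he2] := (nbhs_ballP ((0, 0) : R * 'rV[R]_m) _).1 n4.
have [e3 e30 he3] := Phi0_lower ha hPhi0.
pose K := 2 * `|beta| + 2 * M1; pose K2 := 2 * M1 + 2 * M2.
have K0 : 0 < K by rewrite /K; lra.
(* the bound (4 K)^-1 on the doubled time makes K (T1 - - T1) at most 1/4 *)
have [T1 [T10 T1T T1e1 T1e2 [T1e3 T1K]]] : exists T1,
    [/\ 0 < T1, T1 < T, T1 < e1, T1 < e2 & T1 < e3 /\ K * (T1 - - T1) <= 4^-1].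
  pose s := Num.min (Num.min T e1) (Num.min (Num.min e2 e3) (4 * K)^-1).
  have s0 : 0 < s by rewrite !lt_min hT e10 e20 e30 invr_gt0 mulr_gt0.
  have [s1 s2 s3 s4 s5] : [/\ s <= T, s <= e1, s <= e2, s <= e3 & s <= (4 * K)^-1].
    by rewrite /s; split; rewrite !ge_min lexx ?orbT.
  have bnd (u : R) : s <= u -> s / 2 < u by move: s0 => + h; clear - h; lra.
  exists (s / 2); split; [by rewrite divr_gt0|exact: bnd|exact: bnd|exact: bnd|].
  split; first exact: bnd.
  have -> : s / 2 - - (s / 2) = s by field.
  have := ler_wpM2l (ltW K0) s5; rewrite invfM mulrCA divff ?mulr1//; exact: lt0r_neq0.
pose c := a / 2 * T1 ^+ nu.
have c0 : 0 < c by rewrite /c mulr_gt0 ?divr_gt0// exprn_gt0.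
pose r1 := Num.min (Num.min (e1 / 2) (r / 2)) (Num.min 1 (c / 2)).
have r10 : 0 < r1 by rewrite !lt_min !divr_gt0// ltr01.
have [q1 q2 q3 q4] : [/\ r1 <= e1 / 2, r1 <= r / 2, r1 <= 1 & r1 <= c / 2].
  by rewrite /r1; split; rewrite !ge_min lexx ?orbT.
have r1e1 : r1 < e1 by clear - q1 e10; lra.
have r1r : r1 < r by clear - q2 hr; lra.
pose rho := r1 / 3; have rho0 : 0 < rho by rewrite divr_gt0.
have rho2 : 0 < rho / 2 by rewrite divr_gt0.
have TT (t : R) : - T1 <= t <= T1 -> `|t| <= T1 by rewrite ler_norml.
have [d' d'0 hd'] : exists2 d', 0 < d' & forall th, enorm th < d' ->
    forall t, - T1 <= t <= T1 -> `|Phi t th - Phi t 0| < rho / 2.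
  apply: near_theta0; apply: (@uniform_cvg_itv _ _ Phi 0 (- T1) T1) => // t /TT ht.
  by apply: (Phi_joint_continuous hPhi) => //; exact: le_lt_trans T1T.
pose d1 := Num.min (Num.min e1 e2) (Num.min delta d').
have d10 : 0 < d1 by rewrite !lt_min e10 e20 hdelta.
have [p1 p2 p3 p4] : [/\ d1 <= e1, d1 <= e2, d1 <= delta & d1 <= d'].
  by rewrite /d1; split; rewrite !ge_min lexx ?orbT.
have inB (t x : R) th : `|t| <= T1 -> `|x| <= r1 -> enorm th < d1 ->
    [/\ `|B t x th - beta| < `|beta| / 2, `|Bx t x th| <= M1 & `|Bxx t x th| <= M2].
  move=> ht hx hth.
  have hb : ball ((0, 0, 0) : R * R * 'rV[R]_m) e1 (t, x, th).
    split; first by split; rewrite /ball /= sub0r normrN; [exact: le_lt_trans T1e1|exact: le_lt_trans hx r1e1].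
    rewrite -ball_normE /ball_ /= sub0r normrN; apply: le_lt_trans (norm_le_enorm th) _.
    exact: lt_le_trans p1.
  have [h1 [h2 h3]] := he1 _ hb; rewrite /= hbeta in h1 h2 h3; split.
  - by rewrite distrC.
  - rewrite -(subrK (Bx 0 0 0) (Bx t x th)); apply: le_trans (ler_normD _ _) _.
    by rewrite distrC addrC lerD2l ltW.
  - rewrite -(subrK (Bxx 0 0 0) (Bxx t x th)); apply: le_trans (ler_normD _ _) _.
    by rewrite distrC addrC lerD2l ltW.
have inPhi (t : R) th : `|t| <= T1 -> enorm th < d1 -> `|Phi t th| <= 1.
  move=> ht hth; have hb : ball ((0, 0) : R * 'rV[R]_m) e2 (t, th).
    split; first by rewrite /ball /= sub0r normrN; exact: le_lt_trans T1e2.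
    rewrite -ball_normE /ball_ /= sub0r normrN; apply: le_lt_trans (norm_le_enorm th) _.
    exact: lt_le_trans p2.
  by have := he2 _ hb; rewrite /= (Phi00 hnu2 ha hPhi0) sub0r normrN => /ltW.
have absB (t x : R) th : `|t| <= T1 -> `|x| <= r1 -> enorm th < d1 -> `|B t x th| <= 3 / 2 * `|beta|.
  move=> ht hx hth; have [h _ _] := inB t x th ht hx hth.
  rewrite -(subrK beta (B t x th)); apply: le_trans (ler_normD _ _) _.
  by clear - h; lra.
have dist2 (t x : R) th : `|t| <= T1 -> `|x| <= r1 -> enorm th < d1 -> `|x - Phi t th| <= 2.
  move=> ht hx hth; apply: le_trans (ler_normB _ _) _; have h := inPhi t th ht hth.
  by have := lerD (le_trans hx q3) h; clear; lra.
have lts (t : R) : `|t| <= T1 -> `|t| < T by move=> h; exact: le_lt_trans T1T.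
have ltr_ (x : R) : `|x| <= r1 -> `|x| < r by move=> h; exact: le_lt_trans h r1r.
have ltd (th : 'rV[R]_m) : enorm th < d1 -> enorm th < delta by move=> h; exact: lt_le_trans p3.
have Fder (t x : R) th : `|t| <= T1 -> `|x| < r -> enorm th < d1 ->
    is_derive x 1 (fun u => field_F Phi B t u th) (field_F_I Phi B Bx t x th).
  move=> ht hx hth; have [dB _ _ _ _] := hBx t x th (lts _ ht) hx (ltd _ hth).
  have dx : is_derive x 1 (fun u : R => u - Phi t th) 1.
    by rewrite -[X in is_derive _ _ _ X]subr0; exact: is_deriveB.
  apply: is_derive_eq (is_deriveM dx dB) _.
  by rewrite /field_F_I /GRing.scale /=; ring.
have Fxder (t x : R) th : `|t| <= T1 -> `|x| < r -> enorm th < d1 ->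
    is_derive x 1 (fun u => field_F_I Phi B Bx t u th) (field_F_I2 Phi Bx Bxx t x th).
  move=> ht hx hth; have [dB dBx _ _ _] := hBx t x th (lts _ ht) hx (ltd _ hth).
  have dx : is_derive x 1 (fun u : R => u - Phi t th) 1.
    by rewrite -[X in is_derive _ _ _ X]subr0; exact: is_deriveB.
  apply: is_derive_eq (is_deriveD dB (is_deriveM dx dBx)) _.
  by rewrite /field_F_I2 /GRing.scale /=; ring.
have FIle (t x : R) th : `|t| <= T1 -> `|x| <= r1 -> enorm th < d1 ->
    `|field_F_I Phi B Bx t x th| <= K.
  move=> ht hx hth; apply: le_trans (ler_normD _ _) _; rewrite normrM.
  have [_ h2 _] := inB t x th ht hx hth.
  have h3 := ler_pM (normr_ge0 _) (normr_ge0 _) (dist2 t x th ht hx hth) h2.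
  by have := absB t x th ht hx hth; rewrite /K; clear - h3 bb; lra.
have FI2le (t x : R) th : `|t| <= T1 -> `|x| <= r1 -> enorm th < d1 ->
    `|field_F_I2 Phi Bx Bxx t x th| <= K2.
  move=> ht hx hth; apply: le_trans (ler_normD _ _) _; rewrite !normrM.
  have [_ h2 h2'] := inB t x th ht hx hth.
  have h3 := ler_pM (normr_ge0 _) (normr_ge0 _) (dist2 t x th ht hx hth) h2'.
  by rewrite (ger0_norm (_ : 0 <= 2))// /K2; clear - h2 h3; lra.
have Phi0ge (t : R) : `|t| <= T1 -> a / 2 * `|t| ^+ nu <= Phi t 0.
  move=> ht; have := he3 t (le_lt_trans ht T1e3); rewrite ler_norml => /andP[h _].
  have -> : `|t| ^+ nu = t ^+ nu by rewrite -normrX ger0_norm// real_exprn_even_ge0 ?num_real.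
  rewrite -normrX ger0_norm in h; last by rewrite real_exprn_even_ge0 ?num_real.
  by clear - h; lra.
have Phiclose (t : R) th : `|t| <= T1 -> enorm th < d1 -> `|Phi t th - Phi t 0| < rho / 2.
  move=> ht hth; apply: hd'; first exact: lt_le_trans p4.
  by rewrite -ler_norml.
have Phiends (t : R) th : `|t| = T1 -> enorm th < d1 -> r1 <= Phi t th.
  move=> ht hth; have ht' : `|t| <= T1 by rewrite ht.
  have := Phiclose t th ht' hth; rewrite ltr_norml => /andP[h1 _].
  have := Phi0ge t ht'; rewrite ht -/c => h2; rewrite /rho in h1.
  by clear - h1 h2 q4 r10; lra.
exists Bx, Bxx, T1, r1, d1, rho, K, K2, (`|beta| / 2); split => //.
- by rewrite T10 T1T.
- by rewrite r10.
split => //.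
- move=> th hth; split => //.
  + exact: ltW.
  + by rewrite /rho mulrC divfK.
  + move=> t /TT ht; have nu0 : (0 < nu)%N := ltnW hnu2.
    exact: (Phi_time_derivatives hPhi nu0 (lts _ ht) (ltd _ hth)).
  + move=> t /TT ht.
    exact: (slice_time_continuous (dPhi_joint_continuous hnu2 hPhi (lts _ ht) (ltd _ hth))).
  + by apply: Phiends => //; rewrite normrN gtr0_norm.
  + by apply: Phiends => //; rewrite gtr0_norm.
  + move=> t /TT ht; have := Phiclose t th ht hth; rewrite ltr_norml => /andP[h1 _].
    have := Phi0ge t ht.
    have : 0 <= a / 2 * `|t| ^+ nu by rewrite mulr_ge0 ?exprn_ge0// ltW// divr_gt0.
    by clear - h1 rho0; lra.
  + have nu1 : (1 <= nu)%N := ltnW hnu2.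
    have := @at_most_roots _ nu (fun k => (Phi^~ th)^`(k)%classic) (- T1) T1 _ _ 1%N nu1.
    rewrite subn1; apply.
      move=> k t kn /TT ht; exact: (Phi_time_derivatives hPhi kn (lts _ ht) (ltd _ hth)).
    move=> t /TT ht; apply: lt0r_neq0; apply: lt_le_trans hkappa _.
    exact: (hPhinu t th (lts _ ht) (ltd _ hth)).
  + by move=> t; rewrite /field_F subrr mul0r.
  + by move=> t x /TT ht hx; apply: Fder => //; exact: ltr_.
  + by move=> t x /TT ht hx; apply: Fxder => //; exact: ltr_.
  + by move=> t x /TT ht hx; exact: FIle.
  + by move=> t x /TT ht hx; exact: FI2le.
  + move=> t x /TT ht hx; have [_ _ c1 c2 c3] := hBx t x th (lts _ ht) (ltr_ _ hx) (ltd _ hth).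
    have cP := slice_time_continuous (Phi_joint_continuous hPhi (lts _ ht) (ltd _ hth)).
    apply: cvgM; last exact: (slice_continuous c1).
    apply: cvgB; first exact: cvg_snd.
    by apply: (@continuous_cvg _ _ _ (nbhs (t, x)) _ fst (Phi^~ th) t) => //; exact: cvg_fst.
  + move=> t x /TT ht hx; have [_ _ c1 c2 c3] := hBx t x th (lts _ ht) (ltr_ _ hx) (ltd _ hth).
    have cP := slice_time_continuous (Phi_joint_continuous hPhi (lts _ ht) (ltd _ hth)).
    apply: cvgD; first exact: (slice_continuous c1).
    apply: cvgM; last exact: (slice_continuous c2).
    apply: cvgB; first exact: cvg_snd.
    by apply: (@continuous_cvg _ _ _ (nbhs (t, x)) _ fst (Phi^~ th) t) => //; exact: cvg_fst.
  + move=> t x /TT ht hx; have [_ _ c1 c2 c3] := hBx t x th (lts _ ht) (ltr_ _ hx) (ltd _ hth).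
    have cP := slice_time_continuous (Phi_joint_continuous hPhi (lts _ ht) (ltd _ hth)).
    apply: cvgD.
      by apply: cvgM; [exact: cvg_cst|exact: (slice_continuous c2)].
    apply: cvgM; last exact: (slice_continuous c3).
    apply: cvgB; first exact: cvg_snd.
    by apply: (@continuous_cvg _ _ _ (nbhs (t, x)) _ fst (Phi^~ th) t) => //; exact: cvg_fst.
- move=> t x th ht hx hth; have [h _ _] := inB t x th ht hx hth.
  move: h; rewrite ltr_norml => /andP[h1 h2].
  have [bp|bn] : 0 < beta \/ beta < 0 by move: hbeta0; rewrite neq_lt => /orP[]; [right|left].
    rewrite (gtr0_norm bp) in h1 h2 *; have Bp : 0 < B t x th by clear - h1 bp; lra.
    by rewrite !gtr0_sg// (gtr0_norm Bp); split => //; clear - h1; lra.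
  rewrite (ltr0_norm bn) in h1 h2 *; have Bn : B t x th < 0 by clear - h2 bn; lra.
  by rewrite !ltr0_sg// (ltr0_norm Bn); split => //; clear - h2; lra.
- by move=> t th ht hth; apply: (Phi_joint_continuous hPhi); [exact: lts|exact: ltd].
- by move=> t th ht hth; apply: (dPhi_joint_continuous hnu2 hPhi); [exact: lts|exact: ltd].
- by move=> t x th ht hx hth; have [] := hBx t x th (lts _ ht) (ltr_ _ hx) (ltd _ hth).
- by move=> t x th ht hx hth; have [] := hBx t x th (lts _ ht) (ltr_ _ hx) (ltd _ hth).
- exact: (Phi00 hnu2 ha hPhi0).
- exact: (dPhi00 hnu2 hT hdelta hPhi ha hPhi0).
- move=> t x th ht hx hth; have hx' := ltr_ _ hx.
  rewrite /field_F_II derive1nS derive1n1 derive1E.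
  have e0 : 0 < r - `|x| by rewrite subr_gt0.
  have near_eq : \forall u \near x, field_F_I Phi B Bx t u th = ((fun u => field_F Phi B t u th)^`()%classic) u.
    apply: filterS (near_dist_lt x e0) => u; rewrite distrC => hu.
    have hu' : `|u| < r.
      by rewrite -(subrK x u); apply: le_lt_trans (ler_normD _ _) _; clear - hu; lra.
    have du := Fder t u th ht hu' hth.
    by rewrite derive1E (@derive_val _ _ _ _ _ _ _ du).
  have d2 := near_eq_is_derive near_eq (Fxder t x th ht hx' hth).
  by rewrite (@derive_val _ _ _ _ _ _ _ d2).
Qed.

(** * Dependence on the parameter *)

Section ParameterFlow.
Context {R : realType} {m : nat}.
Notation E := ('rV[R]_m).
Variables (nu : nat) (Phi : R -> E -> R) (B Bx Bxx : R -> R -> E -> R).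
Variables (T r d rho K K2 b0 a beta : R).
Hypothesis PB : param_box Phi B Bx Bxx T r d rho K K2 b0 a beta nu.
Implicit Types (th : E) (t x q s : R).

Local Notation Fth th := (fun t x => field_F Phi B t x th).
Local Notation FIth th := (fun t x => field_F_I Phi B Bx t x th).
Local Notation sflow th := (flow (Phi^~ th) (Fth th) T rho).

Lemma cut_fieldE th t x :
  cut_field (Phi^~ th) (Fth th) t x = Num.max (x - Phi t th) 0 * B t x th.
Proof.
rewrite /cut_field /cut /field_F; case: ltP => h.
  by rewrite max_l// subr_ge0 ltW.
by rewrite max_r ?mul0r// subr_le0.
Qed.

Lemma time_norm t : - T <= t <= T -> `|t| <= T. Proof. by rewrite ler_norml. Qed.

Lemma trajectory_solution th q y :
  is_trajectory Phi B T r q th y <-> solution (Phi^~ th) (Fth th) T r q y.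
Proof.
split => -[h1 h2 h3 h4]; split => // t ht; have := h4 t ht.
  by rewrite cut_fieldE.
by rewrite cut_fieldE.
Qed.

Lemma param_flow_exists : exists I : R -> R -> E -> R,
  forall th, enorm th < d -> sflow th (fun t q => I t q th).
Proof.
have ex th : exists I, enorm th < d -> sflow th I.
  have [h|h] := pselect (enorm th < d); last by exists (fun _ _ => 0).
  by have [I hI] := flow_exists (pb_scalar PB h); exists I.
have [I hI] := choice ex; exists (fun t q th => I th t q) => th hth.
exact: hI.
Qed.

Variable I : R -> R -> E -> R.
Hypothesis hI : forall th, enorm th < d -> sflow th (fun t q => I t q th).

Lemma cvg_field (V : Type) (G : set_system V) {FG : Filter G} (H : R -> R -> E -> R)
    (tt xx : V -> R) (hh : V -> E) t x th :
  {for (t, x, th), continuous (fun p : R * R * E => H p.1.1 p.1.2 p.2)} ->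
  tt v @[v --> G] --> t -> xx v @[v --> G] --> x -> hh v @[v --> G] --> th ->
  H (tt v) (xx v) (hh v) @[v --> G] --> H t x th.
Proof.
move=> cH ct cx ch A /cH [[U V0] /= [Utx Vth] hUV].
move: Utx => [[U1 U2] /= [h1 h2] hU].
have n1 : G (tt @^-1` U1) := ct _ h1.
have n2 : G (xx @^-1` U2) := cx _ h2.
have n3 : G (hh @^-1` V0) := ch _ Vth.
suff hG : G [set v : V | A (H (tt v) (xx v) (hh v))] by exact: hG.
apply: (@filterS3 V G _ _ _ _ _ _ n1 n2 n3) => v v1 v2 v3.
exact: (hUV (tt v, xx v, hh v) (conj (hU (tt v, xx v) (conj v1 v2)) v3)).
Qed.

Lemma cvg_Phi (V : Type) (G : set_system V) {FG : Filter G} (tt : V -> R) (hh : V -> E) t th :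
  `|t| <= T -> enorm th < d ->
  tt v @[v --> G] --> t -> hh v @[v --> G] --> th ->
  Phi (tt v) (hh v) @[v --> G] --> Phi t th.
Proof.
move=> ht hth ct ch A /(pb_Phi_cont PB ht hth) [[U1 V0] /= [h1 Vth] hUV].
have n1 : G (tt @^-1` U1) := ct _ h1.
have n3 : G (hh @^-1` V0) := ch _ Vth.
suff hG : G [set v : V | A (Phi (tt v) (hh v))] by exact: hG.
apply: (@filterS2 V G _ _ _ _ _ n1 n3) => v v1 v3.
exact: (hUV (tt v, hh v) (conj v1 v3)).
Qed.

Lemma cvg_field_F_I (V : Type) (G : set_system V) {FG : Filter G}
    (tt xx : V -> R) (hh : V -> E) t x th :
  `|t| <= T -> `|x| <= r -> enorm th < d ->
  tt v @[v --> G] --> t -> xx v @[v --> G] --> x -> hh v @[v --> G] --> th ->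
  field_F_I Phi B Bx (tt v) (xx v) (hh v) @[v --> G] --> field_F_I Phi B Bx t x th.
Proof.
move=> ht hx hth ct cx ch; apply: cvgD.
  exact: (cvg_field (pb_B_cont PB ht hx hth)).
apply: cvgM; last exact: (cvg_field (pb_Bx_cont PB ht hx hth)).
by apply: cvgB => //; exact: cvg_Phi.
Qed.

(** Written with the positive part the cut field is visibly jointly continuous,
even across the curve. *)
Lemma cvg_cut_field (V : Type) (G : set_system V) {FG : Filter G}
    (tt xx : V -> R) (hh : V -> E) t x th :
  `|t| <= T -> `|x| <= r -> enorm th < d ->
  tt v @[v --> G] --> t -> xx v @[v --> G] --> x -> hh v @[v --> G] --> th ->
  cut_field (Phi^~ (hh v)) (Fth (hh v)) (tt v) (xx v) @[v --> G] -->
  cut_field (Phi^~ th) (Fth th) t x.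
Proof.
move=> ht hx hth ct cx ch.
have maxE (z : R) : Num.max z 0 = (z + `|z|) / 2.
  by case: (leP 0 z) => h; rewrite ?(ger0_norm h) ?(ltr0_norm h); field.
rewrite (_ : (fun v => cut_field _ _ _ _) = fun v =>
    (xx v - Phi (tt v) (hh v) + `|xx v - Phi (tt v) (hh v)|) / 2 * B (tt v) (xx v) (hh v)).
  rewrite cut_fieldE maxE; apply: cvgM; last exact: (cvg_field (pb_B_cont PB ht hx hth)).
  have cd : xx v - Phi (tt v) (hh v) @[v --> G] --> x - Phi t th.
    by apply: cvgB => //; exact: cvg_Phi.
  by apply: cvgM; [apply: cvgD => //; exact: cvg_norm|exact: cvg_cst].
by apply/funext => v; rewrite cut_fieldE maxE.
Qed.

Let box th := pb_scalar PB (th := th).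

(** The difference of two trajectories satisfies a Lipschitz differential
inequality with an error equal to the change of the field with the parameter
along the fixed trajectory, which is uniformly small on the time interval. *)
Lemma flow_param_near q th e : `|q| < rho -> enorm th < d -> 0 < e ->
  nbhs (q, th) (fun p : R * E => [/\ `|p.1| < rho, enorm p.2 < d &
    forall t, - T <= t <= T -> `|I t p.1 p.2 - I t q th| < e]).
Proof.
move=> hq hth e0; have [T0 K0 KT rho0 rr] := box_facts (box hth).
have TT : - T <= T by lra.
have TT0 : 0 < T - - T by lra.
pose e1 := e / (8 * (T - - T)).
have e10 : 0 < e1 by rewrite divr_gt0// mulr_gt0.
have e4 : 0 < e / 8 by rewrite divr_gt0.
have close : \forall th' \near th, forall t, - T <= t <= T ->
   `|cut_field (Phi^~ th') (Fth th') t (I t q th) - cut_field (Phi^~ th) (Fth th) t (I t q th)| < e1.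
  apply: (@uniform_cvg_itv _ _ (fun t th' => cut_field (Phi^~ th') (Fth th') t (I t q th))) => // t ht.
  apply: (@cvg_cut_field _ (nbhs (t, th)) _ fst (fun p => I p.1 q th) snd).
  - exact: time_norm.
  - exact: (flow_le (box hth) (hI hth)).
  - by [].
  - exact: cvg_fst.
  - apply: (@continuous_cvg _ _ _ (nbhs (t, th)) _ fst (fun s => I s q th) t); last exact: cvg_fst.
    exact: (flow_cont (hI hth)).
  - exact: cvg_snd.
exists ([set q' | `|q'| < rho /\ `|q - q'| < e / 8],
        [set th' | enorm th' < d /\ (forall t, - T <= t <= T ->
   `|cut_field (Phi^~ th') (Fth th') t (I t q th) - cut_field (Phi^~ th) (Fth th) t (I t q th)| < e1)]).
  split => /=.
    by apply: filterI; [exact: near_level|exact: near_dist_lt].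
  by apply: filterI; [exact: near_enorm_lt|exact: close].
move=> [q' th'] /= [[hq' qq'] [hth' hcl]]; split => // t ht.
have hT : - T <= - T <= T by rewrite lexx.
have := @gronwall_short _ (fun t => I t q' th' - I t q th)
  (fun t => cut_field (Phi^~ th') (Fth th') t (I t q' th') - cut_field (Phi^~ th) (Fth th) t (I t q th))
  (- T) T K e1 TT K0 (ltW e10) _ _ _ _ (- T) t hT ht.
rewrite (flow_init (hI hth)) (flow_init (hI hth')) => h.
apply: le_lt_trans (h _ _ _ _) _.
- by apply: le_trans KT _; lra.
- by apply: within_continuous_cc => s _; apply: cvgB; [exact: (flow_cont (hI hth'))|exact: (flow_cont (hI hth))].
- by move=> s hs; apply: is_deriveB; [exact: (flow_der (hI hth'))|exact: (flow_der (hI hth))].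
- move=> s /andP[s1 s2]; have hs : - T <= s <= T by rewrite !ltW.
  rewrite -(subrK (cut_field (Phi^~ th') (Fth th') s (I s q th)) (cut_field (Phi^~ th') _ _ _)) -addrA.
  apply: le_trans (ler_normD _ _) _; apply: lerD; last exact: ltW (hcl s hs).
  apply: (cut_field_lipschitz (box hth')) => //.
    exact: (flow_le (box hth') (hI hth')).
  exact: (flow_le (box hth) (hI hth)).
- have -> : 2 * e1 * (T - - T) = e / 4 by rewrite /e1; field; apply/eqP; lra.
  by rewrite distrC; lra.
Qed.

Lemma flow_param_cvg q th t : `|q| < rho -> enorm th < d -> - T <= t <= T ->
  I t p.1 p.2 @[p --> ((q, th) : R * E)] --> I t q th.
Proof.
move=> hq hth ht; apply/cvgrPdist_lt => e e0.
by apply: filterS (flow_param_near hq hth e0) => p [_ _ h]; rewrite distrC; exact: h.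
Qed.

Hypothesis nu0 : (0 < nu)%N.

Definition pjac t q th := jac (Phi^~ th) (FIth th) T (fun t q => I t q th) t q.

(** The same bounded convergence as in one parameter value: the cut converges at
every time that is not a contact of the limiting trajectory. *)
Lemma pjac_param_cvg q th t : `|q| < rho -> enorm th < d -> - T <= t <= T ->
  pjac t p.1 p.2 @[p --> ((q, th) : R * E)] --> pjac t q th.
Proof.
move=> hq hth ht; apply: continuous_cvg; first exact: continuous_expR.
have near_in : nbhs (q, th) (fun p : R * E => `|p.1| < rho /\ enorm p.2 < d).
  by apply: filterS (flow_param_near hq hth ltr01) => p [].
apply: (@bounded_cvg_integral _ (R * E)%type (nbhs (q, th)) _
  (fun p => growth (Phi^~ p.2) (FIth p.2) (fun t q => I t q p.2) p.1) _ _ _ K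
  (contact (Phi^~ th) T (fun t q => I t q th) q)).
- exact: (@nbhs_countable_base R (R * E)%type (q, th)).
- exact: (contact_finite (box hth) (hI hth)).
- apply: filterS near_in => p [h1 h2]; apply: sub_bmeas => //.
  exact: (growth_bmeas (box h2) (hI h2)).
- by case: (sub_bmeas ht (growth_bmeas (box hth) (hI hth) hq)).
- move=> s /andP[s1 s2] ns.
  have hs : - T <= s <= T by rewrite s1 (le_trans s2)//; case/andP: ht.
  apply: cvg_cut.
  + apply: cvg_Phi => //; [exact: time_norm|exact: cvg_cst|exact: cvg_snd].
  + exact: flow_param_cvg.
  + apply: cvg_field_F_I => //; [exact: time_norm|exact: (flow_le (box hth) (hI hth))|
      exact: cvg_cst|exact: flow_param_cvg|exact: cvg_snd].
  + by apply/eqP => e; apply: ns.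
Qed.

End ParameterFlow.

(** * The displacement and its exceptional levels *)

Lemma Ck_on_sub (R : realType) (V : normedModType R) k (U U' : set V) (f : V -> R) :
  U' `<=` U -> Ck_on k U f -> Ck_on k U' f.
Proof.
move=> sub; elim: k f => [|k IH] f /=; first by move=> h x /sub; exact: h.
by move=> [h1 h2]; split => [x /sub|v]; [exact: h1|exact: IH].
Qed.

Lemma opp_le_self (R : realType) (x : R) : 0 < x -> - x <= x.
Proof. by move=> x0; rewrite (@le_trans _ _ 0)// ?oppr_le0 ltW. Qed.

Section Displacement.
Context {R : realType} {m : nat}.
Notation E := ('rV[R]_m).
Variables (nu : nat) (Phi : R -> E -> R) (B Bx Bxx : R -> R -> E -> R).
Variables (T r d rho K K2 b0 a beta : R).
Hypothesis PB : param_box Phi B Bx Bxx T r d rho K K2 b0 a beta nu.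
Variable I : R -> R -> E -> R.
Local Notation Fth th := (fun t x => field_F Phi B t x th).
Local Notation FIth th := (fun t x => field_F_I Phi B Bx t x th).
Local Notation FI2th th := (fun t x => field_F_I2 Phi Bx Bxx t x th).
Local Notation slice th := (fun t q => I t q th).
Hypothesis hI : forall th, enorm th < d -> flow (Phi^~ th) (Fth th) T rho (slice th).
Hypothesis nu0 : (0 < nu)%N.
Implicit Types (th : E) (t x q s c : R).

Let box th := pb_scalar PB (th := th).
Local Notation pjac := (pjac Phi B Bx T I).
Local Notation pregular q th := (regular (Phi^~ th) (dPhi Phi th) T (slice th) q).
Local Notation parcs q th := (active_arcs (Phi^~ th) (dPhi Phi th) T (slice th) q).

Let facts th (hth : enorm th < d) := box_facts (box hth).

Lemma tau_attained th : enorm th < d -> exists t0,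
  [/\ - T <= t0 <= T, tau Phi T th = Phi t0 th &
      forall t, - T <= t <= T -> tau Phi T th <= Phi t th].
Proof.
move=> hth; have [T0 _ _ _ _] := facts hth.
have cP : {within `[- T, T], continuous (Phi^~ th)}.
  by apply: within_continuous_cc => t; exact: (phi_cont (box hth)).
have [t0] := EVT_min (opp_le_self T0) cP.
rewrite in_itv /= => h0 hmin.
have hm t : - T <= t <= T -> Phi t0 th <= Phi t th by move=> ht; apply: hmin; rewrite in_itv.
have e : tau Phi T th = Phi t0 th.
  apply/eqP; rewrite eq_le /tau; apply/andP; split.
    apply: ge_inf; last by exists t0 => //=; rewrite in_itv.
    by exists (Phi t0 th) => _ [t /= + <-]; rewrite in_itv /=; exact: hm.
  apply: lb_le_inf; first by exists (Phi t0 th), t0 => //=; rewrite in_itv.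
  by move=> _ [t /= + <-]; rewrite in_itv /=; exact: hm.
by exists t0; split => // t ht; rewrite e; exact: hm.
Qed.

(** tau is at most Phi_theta(0), and at least the minimum of Phi_0 >= 0 minus
rho / 2. *)
Lemma tau_lt_rho th : enorm th < d -> `|tau Phi T th| < rho.
Proof.
move=> hth; have [T0 _ _ rho0 rr] := facts hth.
have [t0 [ht0 e hm]] := tau_attained hth.
have h0 : - T <= 0 <= T by rewrite oppr_le0 ltW.
have d0 := pb_d_gt0 PB.
have e0 : enorm (0 : E) < d by rewrite enorm0.
have hc0 := pb_Phi_close PB (time_norm h0) hth.
have hc1 := pb_Phi_close PB (time_norm ht0) hth.
have hp := pb_Phi0_ge PB (time_norm ht0).
have hp0 : 0 <= a / 2 * `|t0| ^+ nu.
  by rewrite mulr_ge0 ?exprn_ge0// ltW// divr_gt0// (pb_a_gt0 PB).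
have := hm 0 h0; rewrite (pb_Phi00 PB) subr0 in hc0.
move: hc0 hc1; rewrite !ltr_norml e => /andP[? ?] /andP[? ?] ?.
by apply/andP; split; lra.
Qed.

Lemma level_above_tau q th : enorm th < d -> tau Phi T th < q < rho -> `|q| < rho.
Proof.
move=> /tau_lt_rho; rewrite !ltr_norml => /andP[h1 h2] /andP[h3 ->].
by rewrite (lt_trans h1 h3).
Qed.

(** Uniqueness is uniqueness for the cut field, as the positive part of I - Phi is
the cut in another form. *)
Lemma trajectories q th : `|q| < rho -> enorm th < d ->
  [/\ is_trajectory Phi B T r q th (fun t => I t q th),
      (forall y : R -> R, is_trajectory Phi B T r q th y ->
         forall t : R, - T <= t <= T -> y t = I t q th),
      inactive Phi I q th (- T) & inactive Phi I q th T].
Proof.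
move=> hq hth; split.
- by apply/trajectory_solution; exact: (flow_solution (box hth) (hI hth) hq).
- move=> y /trajectory_solution hy t ht.
  exact: (solution_unique (box hth) (hI hth) hq hy ht).
- by have [h _] := gap_ends (box hth) (hI hth) hq; rewrite /inactive -subr_lt0.
- by have [_ h] := gap_ends (box hth) (hI hth) hq; rewrite /inactive -subr_lt0.
Qed.

Let hTT th : enorm th < d -> - T <= T <= T.
Proof. by move=> hth; have [T0 _ _ _ _] := facts hth; rewrite lexx andbT opp_le_self. Qed.

Lemma displacement_inactive q th : `|q| < rho -> enorm th < d -> q <= tau Phi T th ->
  displacement I T q th = 0.
Proof.
move=> hq hth le_; have [t0 [_ _ hm]] := tau_attained hth.
rewrite /displacement (flow_inactive (box hth) (hI hth) hq) ?subrr//; last exact: hTT hth.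
by move=> t ht; apply: le_trans le_ (hm t ht).
Qed.

Lemma pjac_is_derive q th t : `|q| < rho -> enorm th < d -> - T <= t <= T ->
  is_derive q 1 (fun u => I t u th) (pjac t q th).
Proof. by move=> hq hth ht; exact: (jac_is_derive (box hth) (hI hth) nu0 hq ht). Qed.

Lemma flow_qE q th t : `|q| < rho -> enorm th < d -> - T <= t <= T ->
  flow_q I q th t = pjac t q th.
Proof.
move=> hq hth ht; have dd := pjac_is_derive hq hth ht.
by rewrite /flow_q derive1E (@derive_val _ _ _ _ _ _ _ dd).
Qed.

Lemma displacement_is_derive q th : `|q| < rho -> enorm th < d ->
  is_derive q 1 (fun u => displacement I T u th) (pjac T q th - 1).
Proof. by move=> hq hth; apply: is_deriveB; exact: pjac_is_derive hq hth (hTT hth). Qed.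

Lemma displacement_qE q th : `|q| < rho -> enorm th < d ->
  displacement_q I T q th = pjac T q th - 1.
Proof.
move=> hq hth; have dd := displacement_is_derive hq hth.
by rewrite /displacement_q derive1E (@derive_val _ _ _ _ _ _ _ dd).
Qed.

Lemma near_param q th : `|q| < rho -> enorm th < d ->
  nbhs (q, th) (fun p : R * E => `|p.1| < rho /\ enorm p.2 < d).
Proof.
by move=> hq hth; apply: filterS (flow_param_near PB hI hq hth ltr01) => p [].
Qed.

Lemma displacement_q_continuous q th : `|q| < rho -> enorm th < d ->
  {for (q, th), continuous (fun p : R * E => displacement_q I T p.1 p.2)}.
Proof.
move=> hq hth; apply: (@continuous_near_eq _ _ (fun p : R * E => pjac T p.1 p.2 - 1)).
  by apply: filterS (near_param hq hth) => p [h1 h2]; rewrite displacement_qE.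
apply: cvgB; last exact: cvg_cst.
exact: (pjac_param_cvg PB hI nu0 hq hth (hTT hth)).
Qed.

Lemma regular_active_regular q th : regular_active Phi I T rho q th -> pregular q th.
Proof. by move=> [_ h] c hc; have [_] := h c hc. Qed.

Lemma regular_active_level q th : enorm th < d -> regular_active Phi I T rho q th -> `|q| < rho.
Proof. by move=> hth [h _]; exact: level_above_tau hth h. Qed.

(** At the threshold the trajectory is constant and touches the curve at a minimum,
which is interior because the ends of the curve are high; at another exceptional
level some event is not regular. *)
Lemma exceptional_critical q th : enorm th < d -> exceptional Phi I T rho th q ->
  `|q| < rho /\ exists c, [/\ - T <= c <= T, dPhi Phi th c = 0 & I c q th = Phi c th].
Proof.
move=> hth; have [T0 _ _ rho0 rr] := facts hth; case=> [->|[hq hn]].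
  have ht := tau_lt_rho hth; split => //.
  have [t0 [/andP[t1 t2] e hm]] := tau_attained hth.
  have lt_r : Phi t0 th < r by rewrite -e; move: ht; rewrite ltr_norml => /andP[_]; lra.
  have i1 : - T < t0.
    rewrite lt_neqAle t1 andbT; apply/eqP => e1.
    by have := phi_left (box hth); rewrite e1 leNgt lt_r.
  have i2 : t0 < T.
    rewrite lt_neqAle t2 andbT; apply/eqP => e1.
    by have := phi_right (box hth); rewrite -e1 leNgt lt_r.
  exists t0; split; first by rewrite t1 t2.
    have dt := phi_der (box hth) (_ : - T <= t0 <= T); rewrite t1 t2 in dt.
    have d0 : is_derive t0 1 (Phi^~ th) 0.
      apply: (@derive1_at_min _ _ (- T) T); first by lra.
      - move=> s; rewrite in_itv /= => /andP[s1 s2].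
        by have [] := phi_der (box hth) (_ : - T <= s <= T); rewrite ?ltW.
      - by rewrite in_itv /= i1 i2.
      - by move=> s; rewrite in_itv /= => /andP[s1 s2]; rewrite -e; apply: hm; rewrite !ltW.
    by rewrite -(@derive_val _ _ _ _ _ _ _ (dt isT)) (@derive_val _ _ _ _ _ _ _ d0).
  by rewrite (flow_inactive (box hth) (hI hth) ht) -?e// t1 t2.
split; first exact: level_above_tau hth hq.
have hn' : ~ forall c, event Phi I T q th c -> regular_event Phi I T q th c.
  by move=> h; apply: hn; split.
move/existsNP: hn' => [c /not_implyP[[hc e] nr]]; exists c; split => //.
by apply/eqP; apply: contrapT => /negP dn; apply: nr; split.
Qed.

(** Each exceptional trajectory passes through the curve at a critical time, and two
different trajectories cannot do so at the same time. *)
Lemma exceptional_few th : enorm th < d -> at_most nu.-1 (exceptional Phi I T rho th).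
Proof.
move=> hth.
have ex q : exists c, exceptional Phi I T rho th q ->
    [/\ - T <= c <= T, dPhi Phi th c = 0 & I c q th = Phi c th].
  have [h|h] := pselect (exceptional Phi I T rho th q); last by exists 0.
  by have [_ [c hc]] := exceptional_critical hth h; exists c.
have [c hc] := choice ex.
apply: (@at_most_inj _ _ _ _ c (crit_few (box hth))) => [q /hc[h1 h2 _]|q1 q2 E1 E2 e]; first by split.
have [h1 _ e1] := hc _ E1; have [_ _ e2] := hc _ E2.
apply/eqP; apply: contrapT => /negP ne.
have := flow_neq (box hth) (hI hth) (exceptional_critical hth E1).1 (exceptional_critical hth E2).1 h1 ne.
by rewrite e1 e e2 eqxx.
Qed.

Lemma not_exceptional q th : enorm th < d -> `|q| < rho -> ~ exceptional Phi I T rho th q ->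
  q < tau Phi T th \/ regular_active Phi I T rho q th.
Proof.
move=> hth hq nE; case: (ltgtP q (tau Phi T th)) => h.
- by left.
- right; apply: contrapT => nr; apply: nE; right; split => //.
  by rewrite h; move: hq; rewrite ltr_norml => /andP[].
- by case: nE; left.
Qed.

Lemma open_levels : open [set q : R | `|q| < rho].
Proof.
rewrite openE => q hq; exact: near_level.
Qed.

Lemma open_nonexceptional th : enorm th < d ->
  open [set q : R | `|q| < rho /\ ~ exceptional Phi I T rho th q].
Proof.
move=> hth; apply: openI; first exact: open_levels.
suff : open (~` exceptional Phi I T rho th) by [].
apply: closed_openC; apply: accessible_finite_set_closed.1; last first.
  exact: at_most_finite (exceptional_few hth).
by apply: hausdorff_accessible; exact: Rhausdorff.
Qed.

Lemma open_inactive th : open [set q : R | `|q| < rho /\ q < tau Phi T th].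
Proof. by apply: openI; [exact: open_levels|exact: open_lt]. Qed.

Lemma near_inactive q th : `|q| < rho -> q < tau Phi T th ->
  \forall z \near q, `|z| < rho /\ z < tau Phi T th.
Proof. by move=> hq lt_; apply: open_nbhs_nbhs; split; [exact: open_inactive|split]. Qed.

Lemma displacement_smooth_inactive th k : enorm th < d ->
  Ck_on k [set q : R | `|q| < rho /\ q < tau Phi T th] (fun q => displacement I T q th).
Proof.
move=> hth; apply: (@Ck_on_eq _ _ _ (cst 0)); first exact: open_inactive.
  by move=> q [h1 h2]; rewrite displacement_inactive// ltW.
exact: Ck_on_cst0.
Qed.

Lemma pjac_inactive q th : enorm th < d -> `|q| < rho -> q < tau Phi T th ->
  pjac T q th = 1.
Proof.
move=> hth hq lt_; have dd := displacement_is_derive hq hth.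
have d0 : is_derive q 1 (fun u => displacement I T u th) 0.
  apply: (@near_eq_is_derive _ _ _ (cst 0)).
  apply: filterS (near_inactive hq lt_) => z [z1 z2].
  by rewrite displacement_inactive// ltW.
apply/eqP; rewrite -subr_eq0; apply/eqP.
by rewrite -(@derive_val _ _ _ _ _ _ _ dd) (@derive_val _ _ _ _ _ _ _ d0).
Qed.

Lemma regular_arcs q th : enorm th < d -> regular_active Phi I T rho q th ->
  exists N (A0 B0 : 'I_N -> R), [/\ parcs q th A0 B0, (N.*2 <= nu)%N & (0 < N)%N].
Proof.
move=> hth hreg; have hq := regular_active_level hth hreg.
have [N [A0 [B0 [arcs h]]]] :=
  active_arcs_exist (box hth) (hI hth) nu0 hq (regular_active_regular hreg).
exists N, A0, B0; split => //.
apply: (active_arcs_nonempty (box hth) (hI hth) hq arcs).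
have [t0 [ht0 e _]] := tau_attained hth; exists t0 => //.
by rewrite -e; case: hreg => /andP[].
Qed.

(** A level that is not exceptional is either below the threshold, where the
displacement vanishes identically nearby, or regular active. *)
Lemma displacement_C2 th : enorm th < d ->
  Ck_on 2 [set q : R | `|q| < rho /\ ~ exceptional Phi I T rho th q]
    (fun q => displacement I T q th).
Proof.
move=> hth; have oU := open_nonexceptional hth.
apply: (@C2_on_real _ _ _ (fun q => pjac T q th - 1) ((fun q => pjac T q th)^`()%classic)) => //.
- by move=> q [hq _]; exact: displacement_is_derive.
- move=> q [hq nE]; case: (not_exceptional hth hq nE) => [lt_|hreg].
    have n0 : \forall z \near q, 1 = pjac T z th.
      apply: filterS (near_inactive hq lt_) => z [z1 z2].
      by rewrite pjac_inactive.
    have d1 : is_derive q 1 (fun q => pjac T q th) 0.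
      by apply: (@near_eq_is_derive _ _ _ (cst (1 : R))).
    rewrite derive1E (@derive_val _ _ _ _ _ _ _ d1) -[X in is_derive _ _ _ X]subr0.
    exact: is_deriveB.
  have [N [A0 [B0 [arcs _ _]]]] := regular_arcs hth hreg.
  have d1 := jac_is_derive_level (box hth) (hI hth) nu0 hq arcs.
  rewrite derive1E (@derive_val _ _ _ _ _ _ _ d1) -[X in is_derive _ _ _ X]subr0.
  exact: is_deriveB.
- move=> q [hq nE]; case: (not_exceptional hth hq nE) => [lt_|hreg].
    apply: (@continuous_near_eq _ _ (cst 0)); last exact: cvg_cst.
    apply: filterS (near_inactive hq lt_) => z [z1 z2].
    have n0 : \forall z' \near z, 1 = pjac T z' th.
      apply: filterS (near_inactive z1 z2) => z' [z1' z2'].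
      by rewrite pjac_inactive.
    have d1 : is_derive z 1 (fun q => pjac T q th) 0.
      by apply: (@near_eq_is_derive _ _ _ (cst (1 : R))).
    by rewrite derive1E (@derive_val _ _ _ _ _ _ _ d1).
  have [N [A0 [B0 [arcs _ _]]]] := regular_arcs hth hreg.
  exact: (jac_derive_cont (box hth) (hI hth) nu0 hq arcs).
Qed.

Lemma regular_active_not_exceptional th :
  enorm th < d -> [set q : R | regular_active Phi I T rho q th] `<=`
    [set q : R | `|q| < rho /\ ~ exceptional Phi I T rho th q].
Proof.
move=> hth q hreg; split; first exact: regular_active_level hth hreg.
move=> [e|[_ //]]; case: hreg => /andP[].
by rewrite e ltxx.
Qed.

Lemma exceptional_itv th : enorm th < d ->
  exceptional Phi I T rho th `<=` `[tau Phi T th, rho[.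
Proof.
move=> /tau_lt_rho; rewrite ltr_norml => /andP[_ h] q; rewrite /= in_itv /=.
by case=> [->|[/andP[h1 h2] _]]; rewrite ?lexx ?h// ltW.
Qed.

Local Notation pcurv q th := (curvature (Phi^~ th) (dPhi Phi th) (FIth th) (FI2th th) T (slice th) q).

Lemma displacement_q_is_derive q th N (A0 B0 : 'I_N -> R) : enorm th < d -> `|q| < rho ->
  parcs q th A0 B0 -> is_derive q 1 (fun u => displacement_q I T u th) (pcurv q th A0 B0).
Proof.
move=> hth hq arcs; apply: (@near_eq_is_derive _ _ _ (fun u => pjac T u th - 1)).
  by apply: filterS (near_level hq) => z hz; rewrite displacement_qE.
rewrite -[X in is_derive _ _ _ X]subr0; apply: is_deriveB.
exact: (jac_is_derive_level (box hth) (hI hth) nu0 hq arcs).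
Qed.

Lemma displacement_qqE q th N (A0 B0 : 'I_N -> R) : enorm th < d -> `|q| < rho ->
  parcs q th A0 B0 -> displacement_qq I T q th = pcurv q th A0 B0.
Proof.
move=> hth hq arcs; have dd := displacement_q_is_derive hth hq arcs.
by rewrite /displacement_qq derive1nS derive1n1 derive1E (@derive_val _ _ _ _ _ _ _ dd).
Qed.

Lemma active_setE q th : active_set Phi I T q th =
  `[- T, T] `&` [set t | Phi t th < I t q th].
Proof. by apply/seteqP; split => t; rewrite /active_set /active /= in_itv. Qed.

Lemma active_set_measurable q th : enorm th < d -> measurable (active_set Phi I T q th).
Proof.
move=> hth; rewrite active_setE.
have ml := measurable_fun_ltr (phi_measurable (box hth)) (flow_measurable (hI hth) q).
exact: (ml (measurable_itv `[- T, T]) [set true] Logic.I).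
Qed.

End Displacement.

(** * The formula for the second derivative of the displacement *)

Section Conclusions.
Context {R : realType} {m : nat}.
Notation E := ('rV[R]_m).
Notation mu := (@lebesgue_measure R).
Variables (nu : nat) (Phi : R -> E -> R) (B Bx Bxx : R -> R -> E -> R).
Variables (T r d rho K K2 b0 a beta : R).
Hypothesis PB : param_box Phi B Bx Bxx T r d rho K K2 b0 a beta nu.
Variable I : R -> R -> E -> R.
Local Notation Fth th := (fun t x => field_F Phi B t x th).
Local Notation FIth th := (fun t x => field_F_I Phi B Bx t x th).
Local Notation FI2th th := (fun t x => field_F_I2 Phi Bx Bxx t x th).
Local Notation slice th := (fun t q => I t q th).
Hypothesis hI : forall th, enorm th < d -> flow (Phi^~ th) (Fth th) T rho (slice th).
Hypothesis nu0 : (0 < nu)%N.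
Implicit Types (th : E) (t x q s c : R).

Let box th := pb_scalar PB (th := th).
Local Notation pjac := (pjac Phi B Bx T I).
Local Notation parcs q th := (active_arcs (Phi^~ th) (dPhi Phi th) T (slice th) q).
Local Notation A q th := (active_set Phi I T q th).

Let facts th (hth : enorm th < d) := box_facts (box hth).
Let hTT th : enorm th < d -> - T <= T <= T.
Proof. by move=> hth; have [T0 _ _ _ _] := facts hth; rewrite lexx andbT opp_le_self. Qed.

Lemma integral_active_set q th (h : R -> R) :
  \int[mu]_(s in `[- T, T]) cut (Phi s th) (I s q th) (h s) = \int[mu]_(s in A q th) h s.
Proof.
rewrite active_setE Rintegral_mkcondr; apply: eq_Rintegral => s _.
rewrite patchE /cut; case: ifPn => hs; first by rewrite mem_set.
by rewrite memNset//=; apply/negP.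
Qed.

Lemma active_set_sub q th : A q th `<=` `[- T, T].
Proof. by move=> t [ht _]; rewrite /= in_itv. Qed.

Lemma active_integrand q th : enorm th < d -> `|q| < rho ->
  {in A q th, (fun s => field_F_I2 Phi Bx Bxx s (I s q th) th * pjac s q th) =1
     (fun t => field_F_II Phi B t (I t q th) th * flow_q I q th t)}.
Proof.
move=> hth hq s; rewrite inE => -[hs _] /=.
rewrite (pb_field_F_II PB (time_norm hs) (flow_le (box hth) (hI hth) hq hs) hth).
by rewrite (flow_qE PB hI nu0).
Qed.

Lemma integrand_bmeas q th : enorm th < d -> `|q| < rho ->
  bmeas (- T) T (K2 * (4 / 3))
    (fun s => field_F_I2 Phi Bx Bxx s (I s q th) th * pjac s q th).
Proof. by move=> hth hq; exact: (curvature_bmeas (box hth) (hI hth) hq). Qed.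

Lemma active_integrable q th : enorm th < d -> `|q| < rho ->
  mu.-integrable (A q th)
    (EFin \o (fun s => field_F_I2 Phi Bx Bxx s (I s q th) th * pjac s q th)).
Proof.
move=> hth hq; apply: integrableS (bmeas_integrable (integrand_bmeas hth hq)) => //.
- exact: (active_set_measurable PB hI).
- exact: active_set_sub.
Qed.

(** The term carrying I - Phi disappears on the curve. *)
Lemma contact_value q th c : I c q th = Phi c th ->
  field_F_I Phi B Bx c (I c q th) th = B c (I c q th) th.
Proof. by move=> ->; rewrite /field_F_I subrr mul0r addr0. Qed.

Lemma arcs_contacts q th N (A0 B0 : 'I_N -> R) : parcs q th A0 B0 ->
  (forall k, - T <= A0 k <= T /\ I (A0 k) q th = Phi (A0 k) th) /\
  (forall k, - T <= B0 k <= T /\ I (B0 k) q th = Phi (B0 k) th).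
Proof.
move=> arcs; split=> k; have [h1 h2] := arcs_in arcs k; have h3 := arcs_lt arcs k.
  have hA : - T <= A0 k <= T by rewrite (ltW h1) (ltW (lt_trans h3 h2)).
  by split => //; apply/(arcs_contact arcs hA); exists k; left.
have hB : - T <= B0 k <= T by rewrite (ltW h2) (ltW (lt_trans h1 h3)).
by split => //; apply/(arcs_contact arcs hB); exists k; right.
Qed.

Lemma curvature_formula q th N (A0 B0 : 'I_N -> R) : enorm th < d -> `|q| < rho ->
  parcs q th A0 B0 ->
  displacement_qq I T q th =
    pjac T q th *
     (\sum_(k < N)
        (B (B0 k) (I (B0 k) q th) th * pjac (B0 k) q th / dPhi Phi th (B0 k)
         - B (A0 k) (I (A0 k) q th) th * pjac (A0 k) q th / dPhi Phi th (A0 k))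
      + \int[mu]_(t in A q th)
          (field_F_I2 Phi Bx Bxx t (I t q th) th * pjac t q th)).
Proof.
move=> hth hq arcs; rewrite (displacement_qqE PB hI nu0 hth hq arcs) /curvature.
have [cA cB] := arcs_contacts arcs.
rewrite integral_active_set; congr (_ * (_ + _)).
by apply: eq_bigr => k _; rewrite !contact_value; [|case: (cA k)|case: (cB k)].
Qed.

(** The arcs of the regular level, with their ends read as entry and exit through
the crossing directions of the gap. *)
Lemma regular_active_formula q th : enorm th < d -> regular_active Phi I T rho q th ->
  (forall t : R, - T <= t <= T ->
     derivable (fun u => I t u th) q 1 /\ 0 < flow_q I q th t) /\
  exists (N : nat) (a0 b1 : 'I_N -> R),
    let J := flow_q I q th in
    [/\ active_decomposition Phi I T q th a0 b1,
        (1 <= N <= nu./2)%N,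
        mu.-integrable (A q th) (fun t => (field_F_II Phi B t (I t q th) th * J t)%:E) &
        displacement_qq I T q th =
          J T *
          (\sum_(k < N)
             (B (b1 k) (I (b1 k) q th) th * J (b1 k) / dPhi Phi th (b1 k)
              - B (a0 k) (I (a0 k) q th) th * J (a0 k) / dPhi Phi th (a0 k))
           + \int[mu]_(t in A q th) (field_F_II Phi B t (I t q th) th * J t)) ].
Proof.
move=> hth hreg; have hq := regular_active_level PB hth hreg; split.
  move=> t ht; rewrite (flow_qE PB hI nu0 hq hth ht); split.
    by have [] := pjac_is_derive PB hI nu0 hq hth ht.
  exact: jac_gt0.
have [N [A0 [B0 [arcs Nnu N0]]]] := regular_arcs PB hI nu0 hth hreg.
have [cA cB] := arcs_contacts arcs.
exists N, A0, B0; split.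
- split.
  + apply/seteqP; split => [t [ht hact]|t [k _ /andP[k1 k2]]].
      by have [k hk] := (arcs_active arcs ht).1 hact; exists k.
    have [h1 h2] := arcs_in arcs k.
    have ht : - T <= t <= T by rewrite (ltW (lt_trans h1 k1)) (ltW (lt_trans k2 h2)).
    by split => //; apply/(arcs_active arcs ht); exists k; rewrite k1.
  + exact: (arcs_lt arcs).
  + exact: (arcs_sep arcs).
  + move=> k; have [_ h1 h2] := contact_up (box hth) (hI hth) hq (cA k) (arcs_entry arcs k).
    split; first exact: cA.
      by apply: filterS h1 => t; rewrite /gap subr_lt0.
    by apply: filterS h2 => t; rewrite /gap subr_gt0.
  + move=> k; have [_ h1 h2] := contact_down (box hth) (hI hth) hq (cB k) (arcs_exit arcs k).
    split; first exact: cB.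
      by apply: filterS h1 => t; rewrite /gap subr_gt0.
    by apply: filterS h2 => t; rewrite /gap subr_lt0.
- by rewrite N0 geq_half_double.
- have ai := active_integrable hth hq.
  apply: eq_integrable ai; first exact: (active_set_measurable PB hI).
  by move=> t ht; rewrite /= (active_integrand hth hq ht).
- rewrite (curvature_formula hth hq arcs) (flow_qE PB hI nu0 hq hth (hTT hth)).
  congr (_ * (_ + _)).
    by apply: eq_bigr => k _; rewrite !(flow_qE PB hI nu0 hq hth)//; [case: (cA k)|case: (cB k)].
  by apply: eq_Rintegral; exact: active_integrand.
Qed.

(** Phi_0 is nonnegative, so the level 0 is inactive throughout at theta = 0. *)
Lemma rest_trajectory t : - T <= t <= T -> I t 0 0 = 0.
Proof.
have e00 : enorm (0 : E) < d by rewrite enorm0 (pb_d_gt0 PB).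
have [_ _ _ rho0 _] := facts e00; have q00 : `|0 : R| < rho by rewrite normr0.
apply: (flow_inactive (box e00) (hI e00) q00) => s hs.
apply: le_trans (pb_Phi0_ge PB (time_norm hs)).
by rewrite mulr_ge0 ?exprn_ge0// ltW// divr_gt0// (pb_a_gt0 PB).
Qed.

(** At a time t with Phi <= I one has (a/2) |t|^nu <= Phi_0(t), and both Phi_theta
and I are uniformly within (a/4) e^nu of Phi_0 and of the rest trajectory 0. *)
Lemma contacts_shrink e : 0 < e -> exists2 p, 0 < p & forall q th, `|q| + enorm th < p ->
  [/\ `|q| < rho, enorm th < d &
      forall t, - T <= t <= T -> Phi t th <= I t q th -> `|t| < e].
Proof.
move=> e0; have d0 := pb_d_gt0 PB.
have e00 : enorm (0 : E) < d by rewrite enorm0.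
have [T0 _ _ rho0 _] := facts e00; have a0 := pb_a_gt0 PB.
have q00 : `|0 : R| < rho by rewrite normr0.
pose e1 := a / 4 * e ^+ nu.
have e10 : 0 < e1 by rewrite mulr_gt0 ?divr_gt0// exprn_gt0.
have n1 := flow_param_near PB hI q00 e00 e10.
have n2 : nbhs (0 : E) (fun th => forall t, - T <= t <= T -> `|Phi t th - Phi t 0| < e1).
  apply: (@uniform_cvg_itv _ _ Phi 0 (- T) T) => // t ht.
  by apply: (pb_Phi_cont PB) => //; exact: time_norm.
have n2' : nbhs ((0, 0) : R * E) (fun p : R * E => forall t, - T <= t <= T -> `|Phi t p.2 - Phi t 0| < e1).
  exists (setT, fun th => forall t, - T <= t <= T -> `|Phi t th - Phi t 0| < e1).
    by split => //; exact: filterT.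
  by move=> [q th] [_ h].
have [p p0 hp] := near_param0 (filterI n1 n2').
exists p => // q th /hp[[/= h1 h2 h3] h4]; split => // t ht le_.
have i1 := h3 t ht; have i2 := h4 t ht; rewrite (rest_trajectory ht) subr0 ltr_norml in i1.
rewrite ltr_norml in i2; have {i1} /andP[k1 k2] := i1; have {i2} /andP[k3 k4] := i2.
have k5 := pb_Phi0_ge PB (time_norm ht).
rewrite ltNge; apply/negP => et.
have k6 : e ^+ nu <= `|t| ^+ nu.
  by apply: lerXn2r; [rewrite nnegrE ltW|rewrite nnegrE normr_ge0|exact: et].
have k7 : a / 2 * e ^+ nu <= a / 2 * `|t| ^+ nu by rewrite ler_wpM2l// ltW// divr_gt0.
have k8 : a / 2 * e ^+ nu = 2 * e1 by rewrite /e1; field.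
lra.
Qed.

End Conclusions.

(** * The two moduli and the lower bound *)

(** The supremum of an empty set of reals is 0, which lies between the bounds. *)
Lemma sup_within (R : realType) (S : set R) (e : R) : 0 <= e ->
  (forall s, S s -> 0 <= s <= e) -> 0 <= sup S <= e /\ forall s, S s -> s <= sup S.
Proof.
move=> e0 hS; have [->|/set0P[s0 Ss0]] := eqVneq S set0; first by rewrite sup0 lexx e0.
have hs : has_sup S by split; [exists s0|exists e => s /hS/andP[]].
have ub s : S s -> s <= sup S by move=> Ss; exact: sup_upper_bound.
split => //; apply/andP; split.
  by apply: le_trans (ub _ Ss0); case/andP: (hS _ Ss0).
by apply: ge_sup => [|s /hS/andP[]//]; exists s0.
Qed.

(** Here JT stands for J(T), X for the contribution of the arc ends and Y for the
integral.  One arc gives X >= (3/2) b w and so JT X >= (9/8) b w, well above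
b w / 2.  The factor J(T) J <= 16/9 in the integral term is absorbed by the
choice of 2 K2 + 1 as the bound for F_II, instead of K2. *)
Lemma curvature_arithmetic (R : realType) (JT X Y w b L K2 : R) :
  3 / 4 <= JT -> JT <= 4 / 3 -> 0 <= w -> 0 <= L -> 0 <= K2 ->
  2 * (3 / 4 * (b * w)) <= X -> 0 <= b ->
  `|Y| <= K2 * (4 / 3) * L ->
  2^-1 * (b * w - 2 * (2 * K2 + 1) * L) <= JT * (X + Y).
Proof.
move=> h1 h2 w0 L0 K0 hX b0; rewrite ler_norml => /andP[y1 _].
have bw := mulr_ge0 b0 w0; have KL := mulr_ge0 K0 L0.
have e1 : 3 / 4 * (2 * (3 / 4 * (b * w))) <= JT * X by apply: ler_pM; lra.
have e2 : - (16 / 9 * (K2 * L)) <= JT * Y.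
  have [yp|yn] := leP 0 Y; first by apply: le_trans (mulr_ge0 _ yp); lra.
  have : JT * (- Y) <= 4 / 3 * (4 / 3 * (K2 * L)) by apply: ler_pM; lra.
  lra.
lra.
Qed.

Section Moduli.
Context {R : realType} {m : nat}.
Notation E := ('rV[R]_m).
Notation mu := (@lebesgue_measure R).
Variables (nu : nat) (Phi : R -> E -> R) (B Bx Bxx : R -> R -> E -> R).
Variables (T r d rho K K2 b0 a beta : R).
Hypothesis PB : param_box Phi B Bx Bxx T r d rho K K2 b0 a beta nu.
Variable I : R -> R -> E -> R.
Local Notation Fth th := (fun t x => field_F Phi B t x th).
Local Notation slice th := (fun t q => I t q th).
Hypothesis hI : forall th, enorm th < d -> flow (Phi^~ th) (Fth th) T rho (slice th).
Hypothesis nu0 : (0 < nu)%N.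
Implicit Types (th : E) (t x q s c : R).

Let box th := pb_scalar PB (th := th).
Local Notation pjac := (pjac Phi B Bx T I).
Local Notation A q th := (active_set Phi I T q th).
Local Notation L := (modulus_L Phi I T).
Local Notation omega := (modulus_omega Phi I T).

Let facts th (hth : enorm th < d) := box_facts (box hth).
Let e00 : enorm (0 : E) < d. Proof. by rewrite enorm0 (pb_d_gt0 PB). Qed.
Let T0 : 0 < T. Proof. by have [] := facts e00. Qed.
Let TT : - T <= T. Proof. exact: opp_le_self T0. Qed.
Let hTT : - T <= T <= T. Proof. by rewrite lexx TT. Qed.

Lemma active_measure_le q th e : enorm th < d -> 0 < e ->
  (forall t, A q th t -> `|t| <= e) -> 0 <= fine (mu (A q th)) <= 2 * e.
Proof.
move=> hth e0 he; apply/andP; split; first exact: fine_ge0.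
have sub : A q th `<=` `[- e, e].
  by move=> t /he; rewrite /= in_itv /= ler_norml.
have le_ : (mu (A q th) <= (2 * e)%:E)%E.
  apply: (@le_trans _ _ (mu `[- e, e])).
    apply: le_measure; rewrite ?inE//; first exact: (active_set_measurable PB hI).
  by rewrite lebesgue_measure_itv /= lte_fin; case: ifPn => _; rewrite -?EFinB lee_fin; lra.
have fin : mu (A q th) \is a fin_num by rewrite ge0_fin_numE// (le_lt_trans le_)// ltry.
by rewrite -lee_fin fineK.
Qed.

Lemma modulus_L_bounds e : 0 < e -> exists2 p, 0 < p & forall z, z < p ->
  0 <= L z <= e /\ forall q th, `|q| + enorm th <= z -> fine (mu (A q th)) <= L z.
Proof.
move=> e0; have e2 : 0 < e / 2 by rewrite divr_gt0.
have [p p0 hp] := contacts_shrink PB hI e2.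
exists p => // z zp.
have [|s [q [th [hq ->]]]|h1 h2] := @sup_within R [set l | exists q th,
    `|q| + enorm th <= z /\ l = fine (mu (A q th))] e; first exact: ltW.
  have [_ hth hA] := hp q th (le_lt_trans hq zp).
  have -> : e = 2 * (e / 2) by field.
  apply: active_measure_le => // t [ht /ltW hact]; exact: ltW (hA t ht hact).
by split => // q th hq; apply: h2; exists q, th.
Qed.

Lemma modulus_omega_bounds e : 0 < e -> exists2 p, 0 < p & forall z, z < p ->
  0 <= omega z <= e /\ forall q th c, `|q| + enorm th <= z ->
     regular_event Phi I T q th c -> `|dPhi Phi th c| <= omega z.
Proof.
move=> e0.
have t00 : `|0 : R| <= T by rewrite normr0 ltW.
have cd := pb_dPhi_cont PB t00 e00.
have n1 := continuous_dist_lt cd e0; rewrite /= (pb_dPhi00 PB) in n1.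
have [p1 p10 hp1] := near_param0 n1.
have p12 : 0 < p1 / 2 by rewrite divr_gt0.
have [p2 p20 hp2] := contacts_shrink PB hI p12.
exists (Num.min (p1 / 2) p2); first by rewrite lt_min p12.
move=> z; rewrite lt_min => /andP[z1 z2].
have [|s [q [th [c [hq [[hc ec] _] ->]]]]|h1 h2] := @sup_within R [set s |
    exists q th c, [/\ `|q| + enorm th <= z, regular_event Phi I T q th c &
      s = `|dPhi Phi th c| ] ] e; first exact: ltW.
  rewrite normr_ge0 /=.
  have [_ hth hA] := hp2 q th (le_lt_trans hq z2).
  have cs : `|c| < p1 / 2 by apply: hA => //; rewrite ec.
  have ths : enorm th < p1 / 2 by apply: le_lt_trans z1; apply: le_trans hq; rewrite lerDr.
  have := hp1 c th; rewrite /= sub0r normrN => h; apply: ltW; apply: h.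
  by rewrite -(divfK (_ : 2 != 0 :> R) p1)// mulr_natr mulr2n; apply: ltrD.
by split => // q th c hq hc; apply: h2; exists q, th, c.
Qed.

Lemma modulus_cvg0 (M : R -> R) :
  (forall e, 0 < e -> exists2 p, 0 < p & forall z, z < p -> 0 <= M z <= e) ->
  M z @[z --> 0^'+] --> 0.
Proof.
move=> hM; apply/cvgrPdist_le => e /hM[p p0 hp].
near=> z; rewrite sub0r normrN ger0_norm; last first.
  have /andP[] // : 0 <= M z <= e by apply: hp; near: z; exact: nbhs_right_lt.
have /andP[] // : 0 <= M z <= e by apply: hp; near: z; exact: nbhs_right_lt.
Unshelve. all: by end_near. Qed.

Lemma modulus_L_cvg0 : L z @[z --> 0^'+] --> 0.
Proof.
apply: modulus_cvg0 => e /modulus_L_bounds[p p0 hp].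
by exists p => // z /hp[].
Qed.

Lemma modulus_omega_cvg0 : omega z @[z --> 0^'+] --> 0.
Proof.
apply: modulus_cvg0 => e /modulus_omega_bounds[p p0 hp].
by exists p => // z /hp[].
Qed.

(** Below this radius both moduli are suprema of bounded sets, so that they bound
the quantities that they are made of. *)
Lemma moduli_radius : exists rho1,
  [/\ 0 < rho1 <= rho,
      forall q th, `|q| + enorm th <= rho1 -> `|q| < rho /\ enorm th < d &
      forall z q th, z <= rho1 -> `|q| + enorm th <= z ->
        [/\ 0 <= L z, fine (mu (A q th)) <= L z &
            forall c, regular_event Phi I T q th c -> `|dPhi Phi th c| <= omega z] ].
Proof.
have [p1 p10 hp1] := modulus_L_bounds ltr01.
have [p2 p20 hp2] := modulus_omega_bounds ltr01.
have [p3 p30 hp3] := contacts_shrink PB hI ltr01.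
have [_ _ _ rho0 _] := facts e00.
pose s := Num.min (Num.min p1 p2) (Num.min p3 rho).
have s0 : 0 < s by rewrite !lt_min p10 p20 p30 rho0.
have [s1 s2 s3 s4] : [/\ s <= p1, s <= p2, s <= p3 & s <= rho].
  by rewrite /s; split; rewrite !ge_min lexx ?orbT.
have hs u : s <= u -> s / 2 < u by move=> h; apply: lt_le_trans h; rewrite ltr_pdivrMr// ltr_pMr// ltr1n.
exists (s / 2); split.
- by rewrite divr_gt0// ltW// hs.
- by move=> q th h; have [] := hp3 q th (le_lt_trans h (hs _ s3)).
- move=> z q th zs hq.
  have [/andP[L0 _] hL] := hp1 z (le_lt_trans zs (hs _ s1)).
  have [_ hw] := hp2 z (le_lt_trans zs (hs _ s2)).
  by split => //; [exact: hL|move=> c; exact: hw].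
Qed.

Lemma regular_active_event q th : enorm th < d -> regular_active Phi I T rho q th ->
  exists c, event Phi I T q th c.
Proof.
move=> hth hreg; have [N [A0 [B0 [arcs _ N0]]]] := regular_arcs PB hI nu0 hth hreg.
have [cA _] := arcs_contacts arcs; exists (A0 (Ordinal N0)).
exact: cA.
Qed.

(** At an entry Phi' < 0 and the term carries a minus sign, at an exit Phi' > 0; so
every end contributes |B| J / |Phi'| after multiplication by the sign of beta.
Any upper bounds w and l for the slopes and the active time may be used. *)
Lemma displacement_qq_lower_bound q th w l : enorm th < d ->
  regular_active Phi I T rho q th ->
  (forall c, regular_event Phi I T q th c -> `|dPhi Phi th c| <= w) ->
  fine (mu (A q th)) <= l ->
  0 < w /\
  2^-1 * (b0 / w - 2 * (2 * K2 + 1) * l) <= Num.sg beta * displacement_qq I T q th.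
Proof.
move=> hth hreg hw hl; have hq := regular_active_level PB hth hreg.
have [N [A0 [B0 [arcs _ N0]]]] := regular_arcs PB hI nu0 hth hreg.
have [cA cB] := arcs_contacts arcs.
have wA k : 0 < - dPhi Phi th (A0 k) <= w.
  have h := arcs_entry arcs k; rewrite oppr_gt0 h /= -ltr0_norm//; apply: hw.
  by split; [exact: cA|rewrite lt_eqF].
have wB k : 0 < dPhi Phi th (B0 k) <= w.
  have h := arcs_exit arcs k; rewrite h /= -[leLHS]gtr0_norm//; apply: hw.
  by split; [exact: cB|rewrite gt_eqF].
have w0 : 0 < w by case/andP: (wB (Ordinal N0)) => h1 h2; exact: lt_le_trans h2.
split => //.
have bpos := pb_b0_gt0 PB.
rewrite (curvature_formula PB hI nu0 hth hq arcs) mulrCA [X in _ <= _ * X]mulrDr mulr_sumr.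
have sgB c : - T <= c <= T -> Num.sg beta * B c (I c q th) th = `|B c (I c q th) th| /\
    b0 <= `|B c (I c q th) th|.
  move=> hc; have [<- h] := pb_sign PB (time_norm hc) (flow_le (box hth) (hI hth) hq hc) hth.
  by split => //; rewrite -normrEsg.
have term c v : - T <= c <= T -> 0 < v <= w ->
    3 / 4 * (b0 * w^-1) <= Num.sg beta * (B c (I c q th) th * pjac c q th / v).
  move=> hc /andP[v0 vw]; have [e1 e2] := sgB c hc.
  have [j1 _] := jac_bounds (box hth) (hI hth) hq hc.
  have -> : Num.sg beta * (B c (I c q th) th * pjac c q th / v) =
      pjac c q th * (`|B c (I c q th) th| / v) by rewrite -e1; ring.
  apply: ler_pM => //; first by rewrite divr_ge0// ltW.
  by apply: ler_pM => //; rewrite ?invr_ge0 ?lef_pV2 ?posrE// ltW.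
have termB k := term _ _ (cB k).1 (wB k).
have termA k : 3 / 4 * (b0 * w^-1) <=
    - (Num.sg beta * (B (A0 k) (I (A0 k) q th) th * pjac (A0 k) q th / dPhi Phi th (A0 k))).
  by have := term _ _ (cA k).1 (wA k); rewrite invrN !mulrN.
have [j1 j2] := jac_bounds (box hth) (hI hth) hq hTT.
have K20 := Fxx_bound_ge0 (box hth).
have l0 : 0 <= l by apply: le_trans hl; exact: fine_ge0.
apply: curvature_arithmetic => //.
- by rewrite invr_ge0 ltW.
- rewrite (bigD1 (Ordinal N0))//= -[leLHS]addr0 [2 * _]mulr_natl mulr2n.
  apply: lerD; first by rewrite mulrBr; apply: lerD; [exact: termB|exact: termA].
  apply: sumr_ge0 => k _; rewrite mulrBr.
  have t0 : 0 <= 3 / 4 * (b0 * w^-1) by rewrite mulr_ge0// divr_ge0// ltW.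
  by apply: addr_ge0; apply: le_trans t0 _; [exact: termB|exact: termA].
- exact: ltW.
- pose h s := field_F_I2 Phi Bx Bxx s (I s q th) th * pjac s q th.
  have ai : mu.-integrable (A q th) (EFin \o h) := active_integrable PB hI hth hq.
  have mA := active_set_measurable PB hI q hth.
  have finA : (mu (A q th) < +oo)%E.
    apply: (@le_lt_trans _ _ (mu `[- T, T])).
      by apply: le_measure; rewrite ?inE//; exact: active_set_sub.
    by rewrite lebesgue_measure_itv /=; case: ifPn => _; rewrite ?ltry// -EFinB ltry.
  have C0 : 0 <= K2 * (4 / 3) by rewrite mulr_ge0.
  rewrite normrM; apply: (@le_trans _ _ `|\int[mu]_(s in A q th) h s|).
    by rewrite ler_piMl// normr_sg; case: (beta != 0).
  apply: le_trans (le_normr_Rintegral _ ai) _ => //.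
  apply: (@le_trans _ _ (\int[mu]_(s in A q th) (K2 * (4 / 3)))).
    apply: le_Rintegral => //.
    - exact: integrable_norm.
    - apply: (@integrableS _ _ _ mu `[- T, T]) => //; first exact: active_set_sub.
      apply: (@bmeas_integrable _ _ _ `|K2 * (4 / 3)|); split => //.
    by move=> s [hs _]; case: (integrand_bmeas PB hI hth hq) => _; apply.
  by rewrite Rintegral_cst// ler_wpM2l.
Qed.

Lemma displacement_cvg0 : displacement I T p.1 p.2 @[p --> ((0, 0) : R * E)] --> 0.
Proof.
have [_ _ _ rho0 _] := facts e00; have q00 : `|0 : R| < rho by rewrite normr0.
rewrite -[X in _ --> X](_ : I T 0 0 - 0 = 0); last by rewrite (rest_trajectory PB hI hTT) subr0.
by apply: cvgB; [exact: (flow_param_cvg PB hI q00 e00 hTT)|exact: cvg_fst].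
Qed.

(** At the rest point nothing is active, so log J(T) = 0. *)
Lemma displacement_q_cvg0 : displacement_q I T p.1 p.2 @[p --> ((0, 0) : R * E)] --> 0.
Proof.
have [_ _ _ rho0 _] := facts e00; have q00 : `|0 : R| < rho by rewrite normr0.
have cont := displacement_q_continuous PB hI nu0 q00 e00.
suff e : displacement_q I T 0 0 = 0 by move: cont; rewrite /prop_for /continuous_at /= e.
rewrite (displacement_qE PB hI nu0 q00 e00).
rewrite /pjac /jac /log_jac (@eq_Rintegral _ _ _ _ _ (cst 0)).
  by rewrite Rintegral_cst//= mul0r expR0 subrr.
move=> s; rewrite inE /= in_itv /= => hs.
rewrite /growth /cut (rest_trajectory PB hI hs); case: ifPn => //; rewrite ltNge.
move=> /negP[]; apply: le_trans (pb_Phi0_ge PB (time_norm hs)).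
by rewrite mulr_ge0 ?exprn_ge0// ltW// divr_gt0// (pb_a_gt0 PB).
Qed.

(** The function sgn(beta) D_q - M q is continuous, and nondecreasing between
exceptional levels. *)
Lemma increment_bound M q1 q2 th : enorm th < d ->
  tau Phi T th < q1 -> q1 < q2 -> q2 < rho ->
  (forall q, q1 < q < q2 -> regular_active Phi I T rho q th ->
     M <= Num.sg beta * displacement_qq I T q th) ->
  M * (q2 - q1) <=
    Num.sg beta * (displacement_q I T q2 th - displacement_q I T q1 th).
Proof.
move=> hth hq1 q12 q2r hM.
have [s [_ _ Es]] := at_most_enum (exceptional_few PB hI hth).
pose f z := Num.sg beta * displacement_q I T z th - M * z.
have lvl z : q1 <= z <= q2 -> `|z| < rho.
  move=> /andP[z1 z2]; apply: (level_above_tau PB hth).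
  by rewrite (lt_le_trans hq1 z1) (le_lt_trans z2 q2r).
have cq z : q1 <= z <= q2 -> {for z, continuous (fun z => displacement_q I T z th)}.
  move=> /lvl hz; have c2 := displacement_q_continuous PB hI nu0 hz hth.
  apply: (@cvg_comp _ _ _ (fun z => (z, th)) (fun p => displacement_q I T p.1 p.2)
    (nbhs z) (nbhs (z, th)) _ _ c2).
  move=> S [[S1 S2] /= [h1 h2] sub]; apply: filterS h1 => w hw.
  by apply: sub; split => //=; exact: nbhs_singleton.
suff : f q1 <= f q2.
  move=> h; rewrite -subr_ge0; have {}h : 0 <= f q2 - f q1 by rewrite subr_ge0.
  apply: le_trans h _.
  by rewrite le_eqVlt; apply/orP; left; apply/eqP; rewrite /f; ring.
apply: (@nondecreasing_off_finite _ f
  (fun z => Num.sg beta * displacement_qq I T z th - M) s) => //; first exact: ltW.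
  apply: within_continuous_cc => z hz; apply: cvgB.
    by apply: cvgM; [exact: cvg_cst|exact: cq].
  by apply: cvgM; [exact: cvg_cst|exact: cvg_id].
move=> z hz zs; have hz' : q1 <= z <= q2 by case/andP: hz => z1 z2; rewrite !ltW.
have nE : ~ exceptional Phi I T rho th z by move=> /Es; rewrite (negbTE zs).
have hreg : regular_active Phi I T rho z th.
  case: (not_exceptional hth (lvl z hz') nE) => // h.
  by case/andP: hz => z1 _; move: (lt_trans h (lt_trans hq1 z1)); rewrite ltxx.
split; last by rewrite subr_ge0; exact: hM.
have [N [A0 [B0 [arcs _ _]]]] := regular_arcs PB hI nu0 hth hreg.
have dd := displacement_q_is_derive PB hI nu0 hth (lvl z hz') arcs.
rewrite (displacement_qqE PB hI nu0 hth (lvl z hz') arcs).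
apply: is_deriveB.
rewrite -[X in is_derive _ _ _ X]mulr1.
exact: is_deriveZ.
Qed.

(** Once L <= 1 and omega <= w with b_0 / w = 2 M + 2 C_2 + 1, the lower bound
exceeds M.  A level between q1 and q2 is no farther from 0 than one of them,
so the bound holds all along the interval. *)
Lemma steep_radius rho1 eps M : 0 < rho1 -> 0 < eps -> 0 < M ->
  (forall q th, `|q| + enorm th <= rho1 -> `|q| < rho /\ enorm th < d) ->
  exists2 z, 0 < z <= rho1 &
    [/\ forall q th, `|q| + enorm th < z ->
          `|displacement I T q th| + `|displacement_q I T q th| < eps,
        forall q th, `|q| + enorm th < z -> regular_active Phi I T rho q th ->
          M < Num.sg beta * displacement_qq I T q th &
        forall q1 q2 th, tau Phi T th < q1 -> q1 < q2 ->
          `|q1| + enorm th < z -> `|q2| + enorm th < z ->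
          M * (q2 - q1) <=
            Num.sg beta * (displacement_q I T q2 th - displacement_q I T q1 th)].
Proof.
move=> r10 eps0 M0 hrho1.
have bpos := pb_b0_gt0 PB.
have K20 := Fxx_bound_ge0 (box e00).
pose w := b0 / (2 * M + 2 * (2 * K2 + 1) + 1).
have den0 : 0 < 2 * M + 2 * (2 * K2 + 1) + 1 by lra.
have w0 : 0 < w by rewrite divr_gt0.
have [p1 p10 hp1] := modulus_L_bounds ltr01.
have [p2 p20 hp2] := modulus_omega_bounds w0.
have eps2 : 0 < eps / 2 by rewrite divr_gt0.
have n1 : nbhs ((0, 0) : R * E) (fun p : R * E => `|displacement I T p.1 p.2| < eps / 2).
  have /cvgrPdist_lt/(_ _ eps2) := displacement_cvg0.
  by apply: filterS => p; rewrite sub0r normrN.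
have n2 : nbhs ((0, 0) : R * E) (fun p : R * E => `|displacement_q I T p.1 p.2| < eps / 2).
  have /cvgrPdist_lt/(_ _ eps2) := displacement_q_cvg0.
  by apply: filterS => p; rewrite sub0r normrN.
have [p3 p30 hp3] := near_param0 (filterI n1 n2).
pose s := Num.min (Num.min p1 p2) (Num.min p3 rho1).
have s0 : 0 < s by rewrite !lt_min p10 p20 p30.
have [s1 s2 s3 s4] : [/\ s <= p1, s <= p2, s <= p3 & s <= rho1].
  by rewrite /s; split; rewrite !ge_min lexx ?orbT.
have hs u : s <= u -> s / 2 < u by move=> h; apply: lt_le_trans h; rewrite ltr_pdivrMr// ltr_pMr// ltr1n.
have qq q th : `|q| + enorm th < s / 2 -> regular_active Phi I T rho q th ->
    M < Num.sg beta * displacement_qq I T q th.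
  move=> hq hreg.
  have [_ hth] := hrho1 q th (ltW (lt_trans hq (hs _ s4))).
  have [/andP[_ L1] hL] := hp1 _ (hs _ s1).
  have [/andP[_ w1] hw] := hp2 _ (hs _ s2).
  have [c hc|_] := displacement_qq_lower_bound (w := w) (l := 1) hth hreg _
      (le_trans (hL q th (ltW hq)) L1).
    by apply: le_trans w1; apply: hw hc; exact: ltW.
  apply: lt_le_trans; rewrite /w invf_div mulrCA mulfV ?gt_eqF// mulr1.
  lra.
exists (s / 2); first by rewrite divr_gt0// ltW// hs.
split => // [q th hq|q1 q2 th t1 q12 h1 h2].
  have [/= k1 k2] := hp3 q th (lt_trans hq (hs _ s3)).
  by rewrite [eps](splitr eps) ltrD.
have [_ hth] := hrho1 q1 th (ltW (lt_trans h1 (hs _ s4))).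
have [q2r _] := hrho1 q2 th (ltW (lt_trans h2 (hs _ s4))).
apply: increment_bound => //; first by move: q2r; rewrite ltr_norml => /andP[].
move=> q /andP[l1 l2] hreg; apply/ltW; apply: qq => //.
have [qp|qn] := leP 0 q.
  apply: le_lt_trans h2; rewrite lerD2r (ger0_norm qp).
  exact: le_trans (ltW l2) (ler_norm _).
apply: le_lt_trans h1; rewrite lerD2r (ltr0_norm qn).
by rewrite -(normrN q1) (le_trans _ (ler_norm _))// lerN2 ltW.
Qed.

End Moduli.

(** * Regularity and convexity of the displacement *)

Theorem theorem7p4 (R : realType) (m nu : nat)
  (Phi : R -> 'rV[R]_m -> R) (B : R -> R -> 'rV[R]_m -> R)
  (T r delta a kappa beta : R)
  (hnu2 : (2 <= nu)%N) (hnu : ~~ odd nu)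
  (hT : 0 < T) (hr : 0 < r) (hdelta : 0 < delta)
  (* regularity on the product neighbourhood |t| < T, |I| < r, |theta| < delta *)
  (hPhi : Ck_on nu [set p : R * 'rV[R]_m | `|p.1| < T /\ enorm p.2 < delta]
            (fun p => Phi p.1 p.2))
  (hB : Ck_on 2 [set p : R * R * 'rV[R]_m |
                   [/\ `|p.1.1| < T, `|p.1.2| < r & enorm p.2 < delta] ]
            (fun p => B p.1.1 p.1.2 p.2))
  (ha : 0 < a)
  (hPhi0 : (fun t : R => Phi t 0 - a * t ^+ nu)
             =o_ (nbhs (0 : R)) (fun t : R => `|t| ^+ nu))
  (hkappa : 0 < kappa)
  (hPhinu : forall (t : R) (th : 'rV[R]_m), `|t| < T -> enorm th < delta ->
     kappa <= ((Phi ^~ th)^`(nu))%classic t)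
  (hbeta : B 0 0 0 = beta) (hbeta0 : beta != 0) :
  (* the shrunk box |t| <= T1, |I| < r1, the parameter germ |theta| < d1,
     rho_0, and the trajectories I t q theta *)
  exists (T1 r1 d1 rho0 : R) (I : R -> R -> 'rV[R]_m -> R),
  [/\ [/\ 0 < T1 < T, 0 < r1 <= r, 0 < d1 <= delta & 0 < rho0],
      (forall th : 'rV[R]_m, enorm th < d1 -> `|tau Phi T1 th| < rho0),
      (forall (q : R) (th : 'rV[R]_m), `|q| < rho0 -> enorm th < d1 ->
         [/\ is_trajectory Phi B T1 r1 q th (fun t => I t q th),
             (forall y : R -> R, is_trajectory Phi B T1 r1 q th y ->
                forall t : R, - T1 <= t <= T1 -> y t = I t q th),
             inactive Phi I q th (- T1) &
             inactive Phi I q th T1]),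
      (* 1 *)
      [/\ (forall (q : R) (th : 'rV[R]_m), `|q| < rho0 -> enorm th < d1 ->
             q <= tau Phi T1 th -> displacement I T1 q th = 0),
          (forall (q : R) (th : 'rV[R]_m), `|q| < rho0 -> enorm th < d1 ->
             derivable (fun u => displacement I T1 u th) q 1 /\
             {for (q, th), continuous
                (fun p : R * 'rV[R]_m => displacement_q I T1 p.1 p.2)}),
          (forall th : 'rV[R]_m, enorm th < d1 ->
             let E := exceptional Phi I T1 rho0 th in
             [/\ E `<=` `[tau Phi T1 th, rho0[,
                 (E #<= `I_(nu.-1))%card,
                 E (tau Phi T1 th) &
                 Ck_on 2 [set q : R | `|q| < rho0 /\ ~ E q]
                   (fun q => displacement I T1 q th)]),
          (forall th : 'rV[R]_m, enorm th < d1 -> forall k,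
             Ck_on k [set q : R | `|q| < rho0 /\ q < tau Phi T1 th]
               (fun q => displacement I T1 q th)) &
          (forall th : 'rV[R]_m, enorm th < d1 ->
             Ck_on 2 [set q : R | regular_active Phi I T1 rho0 q th]
               (fun q => displacement I T1 q th))] &
      (* 2 *)
      (forall (q : R) (th : 'rV[R]_m), enorm th < d1 ->
         regular_active Phi I T1 rho0 q th ->
         (forall t : R, - T1 <= t <= T1 ->
            derivable (fun u => I t u th) q 1 /\ 0 < flow_q I q th t) /\
         exists (N : nat) (a b : 'I_N -> R),
           let J := flow_q I q th in
           [/\ active_decomposition Phi I T1 q th a b,
               (1 <= N <= nu./2)%N,
               (@lebesgue_measure R).-integrable (active_set Phi I T1 q th)
                 (fun t => (field_F_II Phi B t (I t q th) th * J t)%:E) &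
               displacement_qq I T1 q th =
                 J T1 *
                 (\sum_(k < N)
                    (B (b k) (I (b k) q th) th * J (b k) / dPhi Phi th (b k)
                     - B (a k) (I (a k) q th) th * J (a k) / dPhi Phi th (a k))
                  + \int[@lebesgue_measure R]_(t in active_set Phi I T1 q th)
                      (field_F_II Phi B t (I t q th) th * J t)) ]) /\
      (* 3 *)
      exists rho1 b0 C2 : R,
      [/\ [/\ 0 < rho1 <= rho0, 0 < b0, 0 < C2 &
              forall (q : R) (th : 'rV[R]_m), `|q| + enorm th <= rho1 ->
                `|q| < rho0 /\ enorm th < d1],
          (forall (t x : R) (th : 'rV[R]_m),
             `|t| <= T1 -> `|x| < r1 -> enorm th < d1 ->
             [/\ Num.sg (B t x th) = Num.sg beta,
                 b0 <= `|B t x th| &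
                 `|field_F_II Phi B t x th| <= C2]),
          [/\ modulus_L Phi I T1 rho @[rho --> 0^'+] --> 0,
              modulus_omega Phi I T1 rho @[rho --> 0^'+] --> 0 &
              (forall (rho q : R) (th : 'rV[R]_m), 0 < rho <= rho1 ->
                 `|q| + enorm th <= rho ->
                 regular_active Phi I T1 rho0 q th ->
                 [/\ (exists c, event Phi I T1 q th c),
                     0 < modulus_omega Phi I T1 rho &
                     2^-1 * (b0 / modulus_omega Phi I T1 rho
                             - 2 * C2 * modulus_L Phi I T1 rho)
                       <= Num.sg beta * displacement_qq I T1 q th])],
          [/\ displacement I T1 p.1 p.2
                @[p --> ((0, 0) : R * 'rV[R]_m)] --> 0,
              displacement_q I T1 p.1 p.2
                @[p --> ((0, 0) : R * 'rV[R]_m)] --> 0 &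
              (forall eps M : R, 0 < eps -> 0 < M ->
                 exists2 rho : R, 0 < rho <= rho1 &
                 [/\ (forall (q : R) (th : 'rV[R]_m), `|q| + enorm th < rho ->
                        `|displacement I T1 q th|
                          + `|displacement_q I T1 q th| < eps),
                     (forall (q : R) (th : 'rV[R]_m), `|q| + enorm th < rho ->
                        regular_active Phi I T1 rho0 q th ->
                        M < Num.sg beta * displacement_qq I T1 q th) &
                     (forall (q1 q2 : R) (th : 'rV[R]_m),
                        tau Phi T1 th < q1 -> q1 < q2 ->
                        `|q1| + enorm th < rho -> `|q2| + enorm th < rho ->
                        M * (q2 - q1) <=
                          Num.sg beta * (displacement_q I T1 q2 th
                                         - displacement_q I T1 q1 th))])] &
          exists2 rho : R, 0 < rho <= rho1 &
            forall (q1 q2 : R) (th : 'rV[R]_m),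
                        tau Phi T1 th < q1 -> q1 < q2 ->
              `|q1| + enorm th < rho -> `|q2| + enorm th < rho ->
              Num.sg beta * displacement_q I T1 q1 th
                < Num.sg beta * displacement_q I T1 q2 th]].
Proof.
have nu0 : (0 < nu)%N by exact: leq_trans hnu2.
have [Bx [Bxx [T1 [r1 [d1 [rho [K [K2 [b0 [hT1 hr1 hd1 PB]]]]]]]]]] :=
  param_box_exists hnu2 hnu hT hr hdelta hPhi hB ha hPhi0 hkappa hPhinu hbeta hbeta0.
have [I hI] := param_flow_exists PB.
have d10 := pb_d_gt0 PB.
have e00 : enorm (0 : 'rV[R]_m) < d1 by rewrite enorm0.
have [T10 _ _ rho0 _] := box_facts (pb_scalar PB e00).
exists T1, r1, d1, rho, I; split.
- by split => //; [case/andP: hr1 => -> /ltW|rewrite d10].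
- by move=> th hth; exact: (tau_lt_rho PB).
- by move=> q th hq hth; exact: (trajectories PB hI).
- split.
  + by move=> q th hq hth; exact: (displacement_inactive PB hI).
  + move=> q th hq hth; split; last exact: (displacement_q_continuous PB hI nu0).
    by have [] := displacement_is_derive PB hI nu0 hq hth.
  + move=> th hth; split.
    * exact: (exceptional_itv PB).
    * exact: at_most_card (exceptional_few PB hI hth).
    * by left.
    * exact: (displacement_C2 PB hI nu0).
  + by move=> th hth k; exact: (displacement_smooth_inactive PB hI).
  + move=> th hth; apply: Ck_on_sub (displacement_C2 PB hI nu0 hth).
    exact: (regular_active_not_exceptional PB hth).
split; first by move=> q th hth; exact: (regular_active_formula PB hI nu0 hth).
have [rho1 [hrho1 hin hmod]] := moduli_radius PB hI.
have r10 : 0 < rho1 by case/andP: hrho1.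
have K20 := Fxx_bound_ge0 (pb_scalar PB e00).
exists rho1, b0, (2 * K2 + 1); split.
- by split => //; [exact: pb_b0_gt0 PB|rewrite ltr_wpDl// mulr_ge0].
- move=> t x th ht hx hth; have [h1 h2] := pb_sign PB ht (ltW hx) hth; split => //.
  rewrite (pb_field_F_II PB ht (ltW hx) hth).
  apply: le_trans (Fxx_le (pb_scalar PB hth) _ (ltW hx)) _; first by rewrite -ler_norml.
  by lra.
- split; [exact: (modulus_L_cvg0 PB hI)|exact: (modulus_omega_cvg0 PB hI)|].
  move=> z q th /andP[z0 zr] hq hreg.
  have [_ hth] := hin q th (le_trans hq zr).
  have [_ hL hw] := hmod z q th zr hq.
  have [w0 bound] := displacement_qq_lower_bound PB hI nu0 hth hreg hw hL.
  by split => //; exact: (regular_active_event PB hI nu0 hth hreg).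
- split; [exact: (displacement_cvg0 PB hI)|exact: (displacement_q_cvg0 PB hI nu0)|].
  by move=> eps M eps0 M0; exact: (steep_radius PB hI nu0 r10 eps0 M0 hin).
have [z hz [_ _ inc]] := steep_radius PB hI nu0 r10 ltr01 ltr01 hin.
exists z => // q1 q2 th t1 q12 h1 h2.
have := inc q1 q2 th t1 q12 h1 h2; rewrite mul1r mulrBr -subr_gt0; apply: lt_le_trans.
by rewrite subr_gt0.
Qed.
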